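(* Let $\mathfrak g(\mathcal A)$ be an indecomposable, completely $Y$-coupled QKM algebra (i.e. $Y=0$) with simple roots $\alpha_1,\dots,\alpha_n$. Let $A=(a_{ij})=(\alpha_j(h_i))$ be its Cartan matrix and let $\mathfrak s=\mathfrak s(A)$ be the corresponding contragredient Kac--Moody Lie superalgebra, with root lattice $Q_{\mathfrak s}$. Set $$J_{\mathcal A}=\bigcap_{i=1}^n\operatorname{Ann}_{\mathfrak h}\mathfrak g_{\alpha_i},\qquad J_{\mathfrak s}=\bigcap_{0\neq\alpha\in Q_{\mathfrak s}}\operatorname{Ann}_{T\mathfrak s}(\mathfrak s_\alpha\otimes\mathbb C[\xi]).$$ Then: (1) up to rescaling of the generators $E_i,F_i$ one has $X=A$; (2) there is an embedding of Lie superalgebras $\mathfrak g(\mathcal A)/J_{\mathcal A}\hookrightarrow T\mathfrak s/J_{\mathfrak s}$ which is an isomorphism on all root spaces.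
   Context: Everything is over $\mathbb C$; $\bar v$ is the parity of a homogeneous $v$. **Quasi-toral algebras.** A finite-dimensional Lie superalgebra $\mathfrak h$ is quasi-toral if $[\mathfrak h_{\bar 0},\mathfrak h]=0$; put $\mathfrak t=\mathfrak h_{\bar 0}$. All $\mathfrak h$-modules considered are finite-dimensional with $\mathfrak t$ acting semisimply. For $\lambda\in\mathfrak t^*$, $\operatorname{rk}\lambda$ is the rank of the symmetric form $(x,y)\mapsto\lambda([x,y])$ on $\mathfrak h_{\bar 1}$. Let $\omega_{\mathfrak h}$ be the automorphism of $\mathfrak h$ equal to $-1$ on $\mathfrak h_{\bar 0}$ and $\sqrt{-1}$ on $\mathfrak h_{\bar 1}$. For an $\mathfrak h$-module $V$, $V^\vee=\{v^\vee: v\in V\}$ is the same superspace with action $x\cdot v^\vee=(\omega_{\mathfrak h}^{-1}(x)v)^\vee$. **Cartan datum.** A Cartan datum $\mathcal A$ consists of: a finite-dimensional quasi-toral $\mathfrak h$; a linearly independent set $\Pi=\{\alpha_1,\dots,\alpha_n\}\subseteq\mathfrak t^*$ (simple roots); for each $\alpha\in\pm\Pi$ an $\mathfrak h$-module $\mathfrak g_\alpha$ on which $\mathfrak t$ acts by $\alpha$; for each $\alpha\in\Pi$ an $\mathfrak h$-module morphism $[-,-]_\alpha:\mathfrak g_\alpha\otimes\mathfrak g_{-\alpha}\to\mathfrak h$ which is nondegenerate (nonzero on $U\otimes\mathfrak g_{-\alpha}$ and on $\mathfrak g_\alpha\otimes U'$ for all nonzero submodules $U,U'$). $\tilde{\mathfrak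 g}(\mathcal A)$ is the Lie superalgebra generated by $\bigoplus_i\mathfrak g_{-\alpha_i}\oplus\mathfrak h\oplus\bigoplus_i\mathfrak g_{\alpha_i}$ with relations: brackets inside $\mathfrak h$ are those of $\mathfrak h$; $[h,x]=h\cdot x$ for $h\in\mathfrak h$, $x\in\mathfrak g_{\pm\alpha_i}$; $[x,y]=\delta_{\alpha\beta}[x,y]_\alpha$ for $x\in\mathfrak g_\alpha$, $y\in\mathfrak g_{-\beta}$, $\alpha,\beta\in\Pi$. $\mathfrak g(\mathcal A)$ is the quotient of $\tilde{\mathfrak g}(\mathcal A)$ by its unique maximal ideal meeting $\mathfrak h$ trivially; root spaces are its nonzero-weight spaces for $\mathfrak t$. Put $\mathfrak h_\alpha=[\mathfrak g_\alpha,\mathfrak g_{-\alpha}]\subseteq\mathfrak h$; $\mathfrak g\langle\alpha\rangle$ is the subalgebra generated by $\mathfrak g_{\alpha}$ and $\mathfrak g_{-\alpha}$. **QKM.** $\mathfrak g(\mathcal A)$ (or $\mathcal A$) is QKM if: (KM1) for all $\alpha,\beta\in\pm\Pi$ one has $(\operatorname{ad}\mathfrak g_\alpha)^N\mathfrak g_\beta=0$ for some $N$, computed in $\mathfrak g(\mathcal A)$; (KM2) for $\alpha,\beta\in\Pi$, $[\mathfrak h_\alpha,\mathfrak g_\beta]=0$ implies $[\mathfrak h_\beta,\mathfrak g_\alpha]=0$; (KM3) $\operatorname{rk}\alpha=2$ for all $\alpha\in\Pi$; (KM4) each $\mathfrak g_\alpha$, $\alpha\in\Pi$, is irreducible and $\mathfrak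 g_{-\alpha}\simeq\mathfrak g_\alpha^\vee$; (KM5) $\mathfrak h_\alpha\not\subseteq\sum_{\beta\in\Pi\setminus\{\alpha\}}\mathfrak h_\beta$ for all $\alpha\in\Pi$. It is indecomposable if there is no nontrivial partition $\Pi=\Pi_1\sqcup\Pi_2$ with $[\mathfrak h_\alpha,\mathfrak g_\beta]=[\mathfrak h_\beta,\mathfrak g_\alpha]=0$ for all $\alpha\in\Pi_1,\beta\in\Pi_2$. **Types.** For $\mathfrak s'=\mathfrak{sl}(2),\mathfrak{osp}(1|2),\mathfrak{sl}(1|1)$ with supertrace form $(-,-)$, $\mathfrak{ts}'=\mathfrak s'\otimes\mathbb C[\xi]\oplus\mathbb C c$ with $\xi$ odd, $\xi^2=0$, $c$ even central, and $[x\otimes p,y\otimes q]=(-1)^{\bar p\bar y}[x,y]\otimes pq+(-1)^{\bar y}(x,y)\operatorname{Res}(p'q)c$, where $p'=\partial_\xi p$, $\operatorname{Res}(a+b\xi)=b$. In a QKM algebra each simple root $\alpha$ has exactly one type $Tak(\mathfrak s')$: $\mathfrak g\langle\alpha\rangle$ is a quotient of $\mathfrak{ts}'$ by a central ideal contained in $\mathbb C c$. **Generators.** Each $\mathfrak g_{\alpha_i}$ is $(1|1)$-dimensional; identify $\mathfrak g_{-\alpha_i}=\mathfrak g_{\alpha_i}^\vee$. If $\alpha_i$ has type $Tak(\mathfrak{sl}(2))$: $e_i$ even, $E_i$ odd nonzero in $\mathfrak g_{\alpha_i}$, $f_i=e_i^\vee$, $F_i=\sqrt{-1}E_i^\vee$,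 scaled so $\alpha_i([e_i,f_i])=2$. If $\alpha_i$ has type $Tak(\mathfrak{osp}(1|2))$ or $Tak(\mathfrak{sl}(1|1))$: $E_i$ even, $e_i$ odd, $f_i=\sqrt{-1}e_i^\vee$, $F_i=E_i^\vee$, scaled in the $\mathfrak{osp}(1|2)$ case so $\alpha_i([e_i,f_i])=1$. Put $h_i=[e_i,f_i]$, $c_i=[E_i,F_i]$, $H_i=[E_i,f_i]=[e_i,F_i]$. Matrices $X=(x_{ij})$, $Y=(y_{ij})$ are defined by $[H_i,e_j]=x_{ij}E_j$, $[H_i,E_j]=y_{ij}e_j$. One may rescale $E_i,F_i$ simultaneously by any nonzero scalar, changing $X$ accordingly. **Kac--Moody superalgebra.** $\mathfrak s(A)$ is the usual contragredient Lie superalgebra: a Cartan subalgebra $\mathfrak t_{\mathfrak s}$ (a minimal realization of $A$, with linearly independent simple roots $\tilde\alpha_i$ and linearly independent coroots $\tilde h_i$, $\tilde\alpha_j(\tilde h_i)=a_{ij}$) and Chevalley generators $\tilde e_i,\tilde f_i$, even if $a_{ii}=2$ and odd if $a_{ii}\in\{0,1\}$, with $[\tilde e_i,\tilde f_j]=\delta_{ij}\tilde h_i$ and the usual weights, modulo the maximal ideal meeting $\mathfrak t_{\mathfrak s}$ trivially. Root spaces of $\mathfrak g(\mathcal A)$ and $T\mathfrak s$ are compared via $\alpha_i\leftrightarrow\tilde\alpha_i$. **Takiff superalgebra.** For $\mathfrak s$ symmetrizable with nondegenerate invariant form $(-,-)$, $T\mathfrak s=\mathfrak s\otimes\mathbb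 C[\xi]\oplus\mathbb C\langle\partial_\xi,c,z\rangle$ with $\xi,\partial_\xi$ odd, $\xi^2=0$, $c,z$ even and central, $[x\otimes p,y\otimes q]=(-1)^{\bar p\bar y}[x,y]\otimes pq+(-1)^{\bar y}(x,y)\operatorname{Res}(p'q)c$, $[\partial_\xi,y\otimes q]=(-1)^{\bar y}y\otimes q'$, $[\partial_\xi,\partial_\xi]=z$. If $\mathfrak s$ is not symmetrizable, $T\mathfrak s$ is defined in the same way with $c$ omitted. For a subspace $V\subseteq T\mathfrak s$, $\operatorname{Ann}_{T\mathfrak s}(V)=\{u\in T\mathfrak s:[u,V]=0\}$. *)

(* Defs.v *)
From HB Require Import structures.
From mathcomp Require Import all_boot all_order all_algebra.
From mathcomp Require Import generic_quotient.
From mathcomp Require Import boolp classical_sets reals complex.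

Set Implicit Arguments.
Unset Strict Implicit.
Unset Printing Implicit Defensive.

Import GRing.Theory.
Local Open Scope ring_scope.
Local Open Scope classical_set_scope.
Local Open Scope quotient_scope.


(* A decision procedure for equations between integer combinations in a
   Z-module, used only in the proofs below. *)
Inductive zexp := ZVar of nat | ZAdd of zexp & zexp | ZOpp of zexp | ZZero.

Section ZModuleEquations.
Variable V : zmodType.
Fixpoint zeval (env : seq V) e : V :=
  match e with
  | ZVar n => env`_n
  | ZAdd e1 e2 => zeval env e1 + zeval env e2
  | ZOpp e1 => - zeval env e1
  | ZZero => 0
  end.
Fixpoint zcoef e (n : nat) : int :=
  match e with
  | ZVar m => (m == n)%:R
  | ZAdd e1 e2 => zcoef e1 n + zcoef e2 n
  | ZOpp e1 => - zcoef e1 n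
  | ZZero => 0
  end.
Lemma zevalE env e : zeval env e = \sum_(i < size env) env`_i *~ zcoef e i.
Proof.
elim: e => [n|e1 IH1 e2 IH2|e IH|] /=.
- have [ltn|gen] := ltnP n (size env).
    rewrite (bigD1 (Ordinal ltn)) //= eqxx mulr1z big1 ?addr0 // => i /eqP ne.
    by case: eqP => [e|_]; [case: ne; apply: val_inj | rewrite mulr0z].
  rewrite nth_default // big1 // => i _; case: eqP => [e|_]; last by rewrite mulr0z.
  by have := ltn_ord i; rewrite -e ltnNge gen.
- by rewrite IH1 IH2 -big_split; apply: eq_bigr => i _; rewrite mulrzDr.
- by rewrite IH -sumrN; apply: eq_bigr => i _; rewrite mulrNz.
- by rewrite big1 // => i _; rewrite mulr0z.
Qed.
Lemma zsolve env e1 e2 :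
  all (fun i => zcoef e1 i == zcoef e2 i) (iota 0 (size env)) ->
  zeval env e1 = zeval env e2.
Proof.
move=> /allP H; rewrite !zevalE; apply: eq_bigr => i _; congr (_ *~ _).
by apply/eqP; apply: H; rewrite mem_iota /=.
Qed.
End ZModuleEquations.

Ltac zmem a l := match l with
  | nil => constr:(false)
  | ?b :: _ => let _ := match goal with _ => unify a b end in constr:(true)
  | _ :: ?r => zmem a r end.
Ltac zidx a l := match l with
  | ?b :: _ => let _ := match goal with _ => unify a b end in constr:(0%N)
  | _ :: ?r => let n := zidx a r in constr:(S n) end.
Ltac zatoms l t := match t with
  | (?a + ?b)%R => let l := zatoms l a in zatoms l b
  | (- ?a)%R => zatoms l a
  | 0%R => l
  | _ => match zmem t l with true => l | false => constr:(t :: l) end end.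
Ltac zreify l t := match t with
  | (?a + ?b)%R => let x := zreify l a in let y := zreify l b in constr:(ZAdd x y)
  | (- ?a)%R => let x := zreify l a in constr:(ZOpp x)
  | 0%R => constr:(ZZero)
  | _ => let n := zidx t l in constr:(ZVar n) end.
Ltac zmod_eq := match goal with |- @eq ?T ?a ?b =>
  let l := zatoms (@nil T) a in let l := zatoms l b in
  let x := zreify l a in let y := zreify l b in
  refine (@zsolve _ l x y _); vm_compute; reflexivity end.


Section Superspaces.
Variable F : fieldType.

(* A Z/2-graded space V = V_0 (+) V_1, given by the two projections
   [spr false], [spr true] onto the even and odd parts. *)
Record superspace := Superspace {
  ss_sort :> lmodType F;
  spr : bool -> ss_sort -> ss_sort;
  spr_lin : forall b c x y, spr b (c *: x + y) = c *: spr b x + spr b y;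
  sprK : forall b x, spr b (spr b x) = spr b x;
  spr_sum : forall x, spr false x + spr true x = x }.

Definition homog (V : superspace) (b : bool) (x : V) : Prop := spr b x = x.

Record lieSuper := LieSuper {
  lie_space :> superspace;
  br : lie_space -> lie_space -> lie_space;
  br_linl : forall c x y z, br (c *: x + y) z = c *: br x z + br y z;
  br_linr : forall c x y z, br z (c *: x + y) = c *: br z x + br z y;
  br_homog : forall a b x y,
    homog a x -> homog b y -> homog (a (+) b) (br x y);
  br_skew : forall a b x y,
    homog a x -> homog b y -> br x y = - ((-1) ^+ (a && b) *: br y x);
  br_jacobi : forall a b x y z, homog a x -> homog b y ->
    br x (br y z) = br (br x y) z + (-1) ^+ (a && b) *: br y (br x z) }.

Section SuperspaceTheory.
Variable V : superspace.
Implicit Types (x y : V).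
Lemma sprD b x y : spr b (x + y) = spr b x + spr b y.
Proof. by rewrite -[x in LHS]scale1r spr_lin scale1r. Qed.
Lemma spr0 b : spr b 0 = 0 :> V.
Proof. by apply: (addrI (spr b 0)); rewrite -sprD !addr0. Qed.
Lemma sprZ b c x : spr b (c *: x) = c *: spr b x.
Proof. by rewrite -[c *: x]addr0 spr_lin spr0 addr0. Qed.
Lemma sprN b x : spr b (- x) = - spr b x.
Proof. by rewrite -scaleN1r sprZ scaleN1r. Qed.
Lemma sprB b x y : spr b (x - y) = spr b x - spr b y.
Proof. by rewrite sprD sprN. Qed.
Lemma sprC b x : spr b (spr (~~ b) x) = 0.
Proof.
have : spr b (spr b x + spr (~~ b) x) = spr b x.
  by congr (spr b _); case: b => /=; rewrite ?[spr true x + _]addrC spr_sum.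
by rewrite sprD sprK -[RHS]addr0 => /addrI.
Qed.
Lemma spr_spr a b x : spr a (spr b x) = if a == b then spr a x else 0.
Proof.
by case: a; case: b; rewrite /= ?sprK //; [exact: (sprC true) | exact: (sprC false)].
Qed.
Lemma homog_spr b x : homog b (spr b x). Proof. exact: sprK. Qed.
Lemma homog_oppo b x : homog b x -> spr (~~ b) x = 0.
Proof. by move=> <-; have := sprC (~~ b) x; rewrite negbK. Qed.
Lemma homog0 b : homog b (0 : V). Proof. exact: spr0. Qed.
Lemma homogD b x y : homog b x -> homog b y -> homog b (x + y).
Proof. by rewrite /homog sprD => -> ->. Qed.
Lemma homogZ b c x : homog b x -> homog b (c *: x).
Proof. by rewrite /homog sprZ => ->. Qed.
Lemma homogN b x : homog b x -> homog b (- x).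
Proof. by rewrite /homog sprN => ->. Qed.
End SuperspaceTheory.

Section LieTheory.
Variable L : lieSuper.
Implicit Types (x y z : L).
Lemma brDl x y z : br (x + y) z = br x z + br y z.
Proof. by rewrite -[x in LHS]scale1r br_linl scale1r. Qed.
Lemma brDr x y z : br z (x + y) = br z x + br z y.
Proof. by rewrite -[x in LHS]scale1r br_linr scale1r. Qed.
Lemma br0l z : br 0 z = 0.
Proof. by apply: (addrI (br 0 z)); rewrite -brDl !addr0. Qed.
Lemma br0r z : br z 0 = 0.
Proof. by apply: (addrI (br z 0)); rewrite -brDr !addr0. Qed.
Lemma brZl c x z : br (c *: x) z = c *: br x z.
Proof. by rewrite -[c *: x]addr0 br_linl br0l addr0. Qed.
Lemma brZr c x z : br z (c *: x) = c *: br z x.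
Proof. by rewrite -[c *: x]addr0 br_linr br0r addr0. Qed.
Lemma brNl x z : br (- x) z = - br x z.
Proof. by rewrite -scaleN1r brZl scaleN1r. Qed.
Lemma brNr x z : br z (- x) = - br z x.
Proof. by rewrite -scaleN1r brZr scaleN1r. Qed.
Lemma spr_br b x y :
  spr b (br x y) = br (spr false x) (spr b y) + br (spr true x) (spr (~~ b) y).
Proof.
rewrite -{1}[x]spr_sum brDl sprD -{1 2}[y]spr_sum !brDr !sprD.
have H a c d : spr a (br (spr c x) (spr d y)) =
    if a == c (+) d then br (spr c x) (spr d y) else 0.
  have := br_homog (homog_spr c x) (homog_spr d y).
  case: eqP => [->//|/eqP e /homog_oppo].
  by rewrite (_ : ~~ (c (+) d) = a) //; case: a c d e => [] [] [].
by rewrite !H; case: b => /=; rewrite ?br0r ?addr0 ?add0r.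
Qed.
End LieTheory.

Definition lie_morph (L M : lieSuper) (f : L -> M) : Prop :=
  [/\ forall c x y, f (c *: x + y) = c *: f x + f y,
      forall b x, f (spr b x) = spr b (f x)
    & forall x y, f (br x y) = br (f x) (f y)].

Definition graded_subspace (V : superspace) (U : set V) : Prop :=
  [/\ U 0, forall c x y, U x -> U y -> U (c *: x + y)
    & forall b x, U x -> U (spr b x)].

Definition lie_ideal (L : lieSuper) (I : set L) : Prop :=
  graded_subspace I /\ forall x y, I y -> I (br x y).

Definition subalgebra (L : lieSuper) (U : set L) : Prop :=
  graded_subspace U /\ forall x y, U x -> U y -> U (br x y).

(* The quotient [lie_quot S] below is by [ideal_gen S], and [lie_sub S] is the
   subalgebra [subalg_gen S]; ideals and subalgebras are graded. *)
Definition ideal_gen (L : lieSuper) (S : set L) : set L :=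
  [set x | forall I, lie_ideal I -> S `<=` I -> I x].

Definition subalg_gen (L : lieSuper) (S : set L) : set L :=
  [set x | forall U, subalgebra U -> S `<=` U -> U x].

End Superspaces.

(* Quotient of a "setoid algebra" by its equivalence: used both for free Lie
   superalgebras (quotients of terms) and for quotients by ideals. *)
Record preAlg (F : fieldType) := PreAlg {
  pa_sort : Type;
  pa0 : pa_sort;
  paD : pa_sort -> pa_sort -> pa_sort;
  paZ : F -> pa_sort -> pa_sort;
  paB : pa_sort -> pa_sort -> pa_sort;
  paE : pa_sort -> pa_sort -> Prop;
  paE_refl : forall x, paE x x;
  paE_sym : forall x y, paE x y -> paE y x;
  paE_trans : forall x y z, paE x y -> paE y z -> paE x z;
  paD_E : forall x x' y y', paE x x' -> paE y y' -> paE (paD x y) (paD x' y');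
  paZ_E : forall c x x', paE x x' -> paE (paZ c x) (paZ c x');
  paB_E : forall x x' y y', paE x x' -> paE y y' -> paE (paB x y) (paB x' y');
  paDA : forall x y z, paE (paD x (paD y z)) (paD (paD x y) z);
  paDC : forall x y, paE (paD x y) (paD y x);
  paD0 : forall x, paE (paD pa0 x) x;
  paDN : forall x, paE (paD (paZ (-1) x) x) pa0;
  paZA : forall a b x, paE (paZ a (paZ b x)) (paZ (a * b) x);
  paZ1 : forall x, paE (paZ 1 x) x;
  paZDr : forall a x y, paE (paZ a (paD x y)) (paD (paZ a x) (paZ a y));
  paZDl : forall a b x, paE (paZ (a + b) x) (paD (paZ a x) (paZ b x));
  paBl : forall c x y z, paE (paB (paD (paZ c x) y) z) (paD (paZ c (paB x z)) (paB y z));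
  paBr : forall c x y z, paE (paB z (paD (paZ c x) y)) (paD (paZ c (paB z x)) (paB z y))
}.

Section PreQuotient.
Variables (F : fieldType) (P : preAlg F).

Definition pa_car : Type := pa_sort P.
HB.instance Definition _ := gen_eqMixin pa_car.
HB.instance Definition _ := gen_choiceMixin pa_car.

Definition pa_rel : rel pa_car := fun x y => `[< paE x y >].
Lemma pa_rel_refl : reflexive pa_rel.
Proof. by move=> x; apply/asboolP; exact: paE_refl. Qed.
Lemma pa_rel_sym : symmetric pa_rel.
Proof. by move=> x y; apply/asboolP/asboolP; exact: paE_sym. Qed.
Lemma pa_rel_trans : transitive pa_rel.
Proof.
by move=> y x z /asboolP xy /asboolP yz; apply/asboolP; exact: paE_trans xy yz.
Qed.
Canonical pa_equiv := EquivRel pa_rel pa_rel_refl pa_rel_sym pa_rel_trans.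

Definition pa_quot := {eq_quot pa_rel}.
HB.instance Definition _ := Choice.on pa_quot.
Definition pa_pi (x : pa_car) : pa_quot := \pi_{eq_quot pa_rel} x.
Definition pa_repr (x : pa_quot) : pa_car := repr x.

Lemma pa_piP x y : pa_pi x = pa_pi y <-> paE (p := P) x y.
Proof.
split; first by move/eqmodP/asboolP.
by move=> e; apply/eqmodP/asboolP.
Qed.
Lemma pa_piK x : pa_pi (pa_repr x) = x. Proof. exact: reprK. Qed.
Lemma pa_reprK x : paE (p := P) (pa_repr (pa_pi x)) x.
Proof. by apply/pa_piP; rewrite pa_piK. Qed.
Lemma pa_W (Q : pa_quot -> Prop) : (forall x, Q (pa_pi x)) -> forall x, Q x.
Proof. by move=> H x; rewrite -(pa_piK x). Qed.

Definition pq0 : pa_quot := pa_pi (pa0 P).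
Definition pqD (x y : pa_quot) : pa_quot := pa_pi (paD (pa_repr x) (pa_repr y)).
Definition pqZ c (x : pa_quot) : pa_quot := pa_pi (paZ c (pa_repr x)).
Definition pqB (x y : pa_quot) : pa_quot := pa_pi (paB (pa_repr x) (pa_repr y)).
Definition pqN (x : pa_quot) : pa_quot := pqZ (-1) x.

Lemma pqDE x y : pqD (pa_pi x) (pa_pi y) = pa_pi (paD (p := P) x y).
Proof. by apply/pa_piP/paD_E; exact: pa_reprK. Qed.
Lemma pqZE c x : pqZ c (pa_pi x) = pa_pi (paZ (p := P) c x).
Proof. by apply/pa_piP/paZ_E; exact: pa_reprK. Qed.
Lemma pqBE x y : pqB (pa_pi x) (pa_pi y) = pa_pi (paB (p := P) x y).
Proof. by apply/pa_piP/paB_E; exact: pa_reprK. Qed.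

Lemma pqDA : associative pqD.
Proof.
by do 3![elim/pa_W => ?]; rewrite !pqDE; apply/pa_piP; exact: paDA.
Qed.
Lemma pqDC : commutative pqD.
Proof. by do 2![elim/pa_W => ?]; rewrite !pqDE; apply/pa_piP; exact: paDC. Qed.
Lemma pqD0 : left_id pq0 pqD.
Proof. by elim/pa_W => ?; rewrite !pqDE; apply/pa_piP; exact: paD0. Qed.
Lemma pqDN : left_inverse pq0 pqN pqD.
Proof. by elim/pa_W => ?; rewrite /pqN pqZE pqDE; apply/pa_piP; exact: paDN. Qed.
HB.instance Definition _ :=
  GRing.isZmodule.Build pa_quot pqDA pqDC pqD0 pqDN.
Lemma pqZA a b x : pqZ a (pqZ b x) = pqZ (a * b) x.
Proof. by elim/pa_W: x => ?; rewrite !pqZE; apply/pa_piP; exact: paZA. Qed.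
Lemma pqZ1 : left_id 1 pqZ.
Proof. by elim/pa_W => ?; rewrite !pqZE; apply/pa_piP; exact: paZ1. Qed.
Lemma pqZDr : right_distributive pqZ +%R.
Proof.
move=> a; do 2![elim/pa_W => ?]; rewrite /GRing.add /= !(pqDE,pqZE).
by apply/pa_piP; exact: paZDr.
Qed.
Lemma pqZDl v : {morph pqZ^~ v : a b / a + b >-> (a + b : pa_quot)}.
Proof.
move=> a b; elim/pa_W: v => ?; rewrite [in RHS]/GRing.add /= !(pqZE, pqDE).
by apply/pa_piP; exact: paZDl.
Qed.
HB.instance Definition _ :=
  GRing.Zmodule_isLmodule.Build F pa_quot pqZA pqZ1 pqZDr pqZDl.

Lemma pa_piD x y : pa_pi (paD (p := P) x y) = pa_pi x + pa_pi y.
Proof. by rewrite -pqDE. Qed.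
Lemma pa_piZ c x : pa_pi (paZ (p := P) c x) = c *: pa_pi x.
Proof. by rewrite -pqZE. Qed.
Lemma pa_pi0 : pa_pi (pa0 P) = 0. Proof. by []. Qed.
Lemma pqB_linl c x y z : pqB (c *: x + y) z = c *: pqB x z + pqB y z.
Proof.
elim/pa_W: x => x; elim/pa_W: y => y; elim/pa_W: z => z.
rewrite -pa_piZ -pa_piD !pqBE -pa_piZ -pa_piD; apply/pa_piP; exact: paBl.
Qed.
Lemma pqB_linr c x y z : pqB z (c *: x + y) = c *: pqB z x + pqB z y.
Proof.
elim/pa_W: x => x; elim/pa_W: y => y; elim/pa_W: z => z.
rewrite -pa_piZ -pa_piD !pqBE -pa_piZ -pa_piD; apply/pa_piP; exact: paBr.
Qed.
Lemma pqBD_l x y z : pqB (x + y) z = pqB x z + pqB y z.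
Proof. by rewrite -[x in LHS]scale1r pqB_linl scale1r. Qed.
Lemma pqBD_r x y z : pqB z (x + y) = pqB z x + pqB z y.
Proof. by rewrite -[x in LHS]scale1r pqB_linr scale1r. Qed.
Lemma pqB0l z : pqB 0 z = 0.
Proof. by apply: (addrI (pqB 0 z)); rewrite -pqBD_l !addr0. Qed.
Lemma pqB0r z : pqB z 0 = 0.
Proof. by apply: (addrI (pqB z 0)); rewrite -pqBD_r !addr0. Qed.
Lemma pqBZl c x z : pqB (c *: x) z = c *: pqB x z.
Proof. by rewrite -[c *: x]addr0 pqB_linl pqB0l addr0. Qed.
Lemma pqBZr c x z : pqB z (c *: x) = c *: pqB z x.
Proof. by rewrite -[c *: x]addr0 pqB_linr pqB0r addr0. Qed.
End PreQuotient.


Section LieQuotient.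
Variables (F : fieldType) (L : lieSuper F) (S : set L).

Lemma ideal_genP : lie_ideal (ideal_gen S).
Proof.
split; first split.
- by move=> I [[]].
- by move=> c x y Ix Iy I idI SI; case: (idI) => [[_ + _] _]; apply; [exact: Ix | exact: Iy].
- by move=> b x Ix I idI SI; case: (idI) => [[_ _ +] _]; apply; exact: Ix.
- by move=> x y Iy I idI SI; case: (idI) => [_ +]; apply; exact: Iy.
Qed.

Let I := ideal_gen S.
Let I0 : I 0. Proof. by case: ideal_genP => [[]]. Qed.
Let IZ c x : I x -> I (c *: x).
Proof. by case: ideal_genP => [[_ H _] _] Ix; rewrite -[_ *: _]addr0; apply: H. Qed.
Let ID x y : I x -> I y -> I (x + y).
Proof. by case: ideal_genP => [[_ H _] _] Ix Iy; rewrite -[x]scale1r; apply: H. Qed.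
Let IP b x : I x -> I (spr b x).
Proof. by case: ideal_genP => [[_ _ H] _]; exact: H. Qed.
Let IN x : I x -> I (- x).
Proof. by rewrite -scaleN1r; exact: IZ. Qed.
Let IBr x y : I y -> I (br x y).
Proof. by case: ideal_genP => [_ H]; exact: H. Qed.
Let IBl x y : I x -> I (br x y).
Proof.
move=> Ix; rewrite -[x]spr_sum brDl -[y]spr_sum !brDr.
have H a b : I (br (spr a x) (spr b y)).
  rewrite (br_skew (homog_spr a x) (homog_spr b y)).
  by apply: IN; apply: IZ; apply: IBr; exact: IP.
by apply: (ID (ID _ _) (ID _ _)); exact: H.
Qed.

Definition lq_rel (x y : L) : Prop := I (x - y).

Let E_refl x : lq_rel x x. Proof. by rewrite /lq_rel subrr. Qed.
Let E_eq x y : x = y -> lq_rel x y. Proof. by move->. Qed.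
Let E_sym x y : lq_rel x y -> lq_rel y x.
Proof. by move/IN; rewrite opprB. Qed.
Let E_trans x y z : lq_rel x y -> lq_rel y z -> lq_rel x z.
Proof. by move=> /ID H /H; rewrite /lq_rel addrA subrK. Qed.
Let D_E x x' y y' : lq_rel x x' -> lq_rel y y' -> lq_rel (x + y) (x' + y').
Proof. by move=> /ID H /H; rewrite /lq_rel opprD addrACA. Qed.
Let Z_E c x x' : lq_rel x x' -> lq_rel (c *: x) (c *: x').
Proof. by move=> /(IZ c); rewrite scalerBr. Qed.
Let B_E x x' y y' : lq_rel x x' -> lq_rel y y' -> lq_rel (br x y) (br x' y').
Proof.
move=> xx yy; apply: (@E_trans _ (br x' y)).
  by rewrite /lq_rel -brNl -brDl; exact: IBl.
by rewrite /lq_rel -brNr -brDr; exact: IBr.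
Qed.

Definition lq_pre : preAlg F := @PreAlg F L 0 +%R *:%R (@br F L) lq_rel
  E_refl E_sym E_trans D_E Z_E B_E
  (fun x y z => E_eq (addrA x y z)) (fun x y => E_eq (addrC x y))
  (fun x => E_eq (add0r x))
  (fun x => E_eq (etrans (congr1 (+%R^~ x) (scaleN1r x)) (addNr x)))
  (fun a b x => E_eq (scalerA a b x)) (fun x => E_eq (scale1r x))
  (fun a x y => E_eq (scalerDr a x y)) (fun a b x => E_eq (scalerDl x a b))
  (fun c x y z => E_eq (br_linl c x y z)) (fun c x y z => E_eq (br_linr c x y z)).

Let Q := pa_quot lq_pre.
Let pi (x : L) : Q := @pa_pi F lq_pre x.
Let rp (x : Q) : L := pa_repr x.

Definition lq_spr b (x : Q) : Q := pi (spr b (rp x)).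
Let sprE b x : lq_spr b (pi x) = pi (spr b x).
Proof. by apply/pa_piP; rewrite /= /lq_rel -sprB; apply: IP; exact: (pa_reprK (P := lq_pre) x). Qed.
Let piZ c x : pi (c *: x) = c *: pi x. Proof. exact: (pa_piZ (P := lq_pre)). Qed.
Let piD x y : pi (x + y) = pi x + pi y. Proof. exact: (pa_piD (P := lq_pre)). Qed.
Let piB x y : pqB (pi x) (pi y) = pi (br x y). Proof. exact: (pqBE (P := lq_pre)). Qed.
Let piW (X : Q -> Prop) : (forall x, X (pi x)) -> forall x, X x.
Proof. exact: (pa_W (P := lq_pre)). Qed.

Let spr_lin' b c x y : lq_spr b (c *: x + y) = c *: lq_spr b x + lq_spr b y.
Proof.
elim/piW: x => x; elim/piW: y => y.
by rewrite -piZ -piD !sprE -piZ -piD spr_lin.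
Qed.
Let sprK' b x : lq_spr b (lq_spr b x) = lq_spr b x.
Proof. by elim/piW: x => x; rewrite !sprE sprK. Qed.
Let spr_sum' x : lq_spr false x + lq_spr true x = x.
Proof. by elim/piW: x => x; rewrite !sprE -piD spr_sum. Qed.

Definition lq_space : superspace F := Superspace spr_lin' sprK' spr_sum'.

Let homogP b (x : lq_space) : homog b x -> exists2 y : L, homog b y & x = pi y.
Proof.
elim/piW: x => x; rewrite /homog /= sprE => e.
by exists (spr b x); rewrite ?e //; exact: homog_spr.
Qed.

Let homog' a b (x y : lq_space) :
  homog a x -> homog b y -> homog (V := lq_space) (a (+) b) (pqB x y).
Proof.
move=> /homogP[x' hx ->] /homogP[y' hy ->].
by rewrite /homog piB /= sprE (br_homog hx hy).
Qed.
Let skew' a b (x y : lq_space) : homog a x -> homog b y ->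
  pqB x y = - ((-1) ^+ (a && b) *: (pqB y x : lq_space)).
Proof.
move=> /homogP[x' hx ->] /homogP[y' hy ->].
by rewrite !piB (br_skew hx hy) -!scaleN1r !piZ.
Qed.
Let jacobi' a b (x y z : lq_space) : homog a x -> homog b y ->
  pqB x (pqB y z) = pqB (pqB x y) z + (-1) ^+ (a && b) *: (pqB y (pqB x z) : lq_space).
Proof.
move=> /homogP[x' hx ->] /homogP[y' hy ->]; elim/piW: z => z.
by rewrite !piB (br_jacobi _ hx hy) piD piZ.
Qed.

Definition lie_quot : lieSuper F :=
  @LieSuper F lq_space (@pqB F lq_pre) (@pqB_linl _ _) (@pqB_linr _ _) homog' skew' jacobi'.

Definition lie_pi (x : L) : lie_quot := pi x.
End LieQuotient.
Arguments lie_pi {F L} S x.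

Section SubLie.
Variables (F : fieldType) (L : lieSuper F) (S : set L).

Lemma subalg_genP : subalgebra (subalg_gen S).
Proof.
split; first split.
- by move=> I [[]].
- by move=> c x y Ix Iy I idI SI; case: (idI) => [[_ + _] _]; apply; [exact: Ix | exact: Iy].
- by move=> b x Ix I idI SI; case: (idI) => [[_ _ +] _]; apply; exact: Ix.
- by move=> x y Ix Iy I idI SI; case: (idI) => [_ +]; apply; [exact: Ix | exact: Iy].
Qed.

Definition sub_pred : {pred L} := fun x => `[< subalg_gen S x >].
Lemma sub_pred_closed : submod_closed sub_pred.
Proof.
case: subalg_genP => [[s0 sl sp] _]; split; first exact/asboolP.
by move=> c x y /asboolP sx /asboolP sy; apply/asboolP; exact: sl.
Qed.
HB.instance Definition _ := GRing.isSubmodClosed.Build F L sub_pred sub_pred_closed.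

Definition sub_car := {x : L | x \in sub_pred}.
HB.instance Definition _ := SubChoice.on sub_car.
HB.instance Definition _ := [SubChoice_isSubLmodule of sub_car by <:].

Lemma sub_sprP b (x : sub_car) : spr b (val x) \in sub_pred.
Proof. by apply/asboolP; case: subalg_genP => [[_ _ H] _]; apply: H; exact/asboolP/(valP x). Qed.
Lemma sub_brP (x y : sub_car) : br (val x) (val y) \in sub_pred.
Proof.
by apply/asboolP; case: subalg_genP => [_ H]; apply: H; [exact/asboolP/(valP x)|exact/asboolP/(valP y)].
Qed.
Definition sub_spr b (x : sub_car) : sub_car := Sub (spr b (val x)) (sub_sprP b x).
Definition sub_br (x y : sub_car) : sub_car := Sub (br (val x) (val y)) (sub_brP x y).

Let spr_lin' b c x y : sub_spr b (c *: x + y) = c *: sub_spr b x + sub_spr b y.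
Proof. by apply: val_inj; rewrite /= spr_lin. Qed.
Let sprK' b x : sub_spr b (sub_spr b x) = sub_spr b x.
Proof. by apply: val_inj; rewrite /= sprK. Qed.
Let spr_sum' x : sub_spr false x + sub_spr true x = x.
Proof. by apply: val_inj; rewrite /= spr_sum. Qed.
Definition sub_space : superspace F := Superspace spr_lin' sprK' spr_sum'.

Let homogP b (x : sub_space) : homog b x -> homog b (val x).
Proof. by move/(congr1 val). Qed.

Let linl c x y z : sub_br (c *: x + y) z = c *: sub_br x z + sub_br y z.
Proof. by apply: val_inj; rewrite /= br_linl. Qed.
Let linr c x y z : sub_br z (c *: x + y) = c *: sub_br z x + sub_br z y.
Proof. by apply: val_inj; rewrite /= br_linr. Qed.
Let homog' a b (x y : sub_space) :
  homog a x -> homog b y -> homog (V := sub_space) (a (+) b) (sub_br x y).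
Proof. by move=> /homogP hx /homogP hy; apply: val_inj; exact: br_homog. Qed.
Let skew' a b (x y : sub_space) : homog a x -> homog b y ->
  sub_br x y = - ((-1) ^+ (a && b) *: (sub_br y x : sub_space)).
Proof. by move=> /homogP hx /homogP hy; apply: val_inj; rewrite /= (br_skew hx hy). Qed.
Let jacobi' a b (x y z : sub_space) : homog a x -> homog b y ->
  sub_br x (sub_br y z) = sub_br (sub_br x y) z + (-1) ^+ (a && b) *: (sub_br y (sub_br x z) : sub_space).
Proof. by move=> /homogP hx /homogP hy; apply: val_inj; rewrite /= (br_jacobi _ hx hy). Qed.

Definition lie_sub : lieSuper F :=
  @LieSuper F sub_space sub_br linl linr homog' skew' jacobi'.
Definition lie_sub_val (x : lie_sub) : L := val (x : sub_car).
End SubLie.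

Section FreeLie.
Variables (F : fieldType) (I : Type) (W : I -> superspace F).

Inductive lterm : Type :=
| TGen (i : I) (w : W i)
| TZero
| TAdd (s t : lterm)
| TScale (c : F) (t : lterm)
| TBr (s t : lterm).

Fixpoint tpr (b : bool) (t : lterm) : lterm :=
  match t with
  | TGen i w => TGen (spr b w)
  | TZero => TZero
  | TAdd s t => TAdd (tpr b s) (tpr b t)
  | TScale c t => TScale c (tpr b t)
  | TBr s t => TAdd (TBr (tpr false s) (tpr b t)) (TBr (tpr true s) (tpr (~~ b) t))
  end.

Inductive teq : lterm -> lterm -> Prop :=
| teq_refl t : teq t t
| teq_sym s t : teq s t -> teq t s
| teq_trans s t u : teq s t -> teq t u -> teq s u
| teq_add s s' t t' : teq s s' -> teq t t' -> teq (TAdd s t) (TAdd s' t')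
| teq_scale c t t' : teq t t' -> teq (TScale c t) (TScale c t')
| teq_br s s' t t' : teq s s' -> teq t t' -> teq (TBr s t) (TBr s' t')
| teq_addA s t u : teq (TAdd s (TAdd t u)) (TAdd (TAdd s t) u)
| teq_addC s t : teq (TAdd s t) (TAdd t s)
| teq_add0 t : teq (TAdd TZero t) t
| teq_addN t : teq (TAdd (TScale (-1) t) t) TZero
| teq_scaleA a b t : teq (TScale a (TScale b t)) (TScale (a * b) t)
| teq_scale1 t : teq (TScale 1 t) t
| teq_scaleDr a s t : teq (TScale a (TAdd s t)) (TAdd (TScale a s) (TScale a t))
| teq_scaleDl a b t : teq (TScale (a + b) t) (TAdd (TScale a t) (TScale b t))
| teq_brl c s t u :
    teq (TBr (TAdd (TScale c s) t) u) (TAdd (TScale c (TBr s u)) (TBr t u))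
| teq_brr c s t u :
    teq (TBr u (TAdd (TScale c s) t)) (TAdd (TScale c (TBr u s)) (TBr u t))
| teq_gen i c (v w : W i) :
    teq (TGen (c *: v + w)) (TAdd (TScale c (TGen v)) (TGen w))
| teq_skew a b s t :
    teq (TBr (tpr a s) (tpr b t))
        (TScale (- (-1) ^+ (a && b)) (TBr (tpr b t) (tpr a s)))
| teq_jacobi a b s t u :
    teq (TBr (tpr a s) (TBr (tpr b t) u))
        (TAdd (TBr (TBr (tpr a s) (tpr b t)) u)
              (TScale ((-1) ^+ (a && b)) (TBr (tpr b t) (TBr (tpr a s) u)))).

Definition free_pre : preAlg F := @PreAlg F lterm TZero TAdd TScale TBr teq
  teq_refl teq_sym teq_trans teq_add teq_scale teq_br teq_addA teq_addC teq_add0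
  teq_addN teq_scaleA teq_scale1 teq_scaleDr teq_scaleDl teq_brl teq_brr.

Let Q := pa_quot free_pre.
Let pi (t : lterm) : Q := @pa_pi F free_pre t.
Let rp (x : Q) : lterm := pa_repr x.
Let pi0 : pi TZero = 0. Proof. by []. Qed.
Let piD s t : pi (TAdd s t) = pi s + pi t. Proof. exact: (pa_piD (P := free_pre)). Qed.
Let piZ c t : pi (TScale c t) = c *: pi t. Proof. exact: (pa_piZ (P := free_pre)). Qed.
Let piB s t : pi (TBr s t) = pqB (pi s) (pi t). Proof. by rewrite (pqBE (P := free_pre)). Qed.
Let piP s t : pi s = pi t <-> teq s t. Proof. exact: (pa_piP (P := free_pre)). Qed.
Let piW (X : Q -> Prop) : (forall x, X (pi x)) -> forall x, X x.
Proof. exact: (pa_W (P := free_pre)). Qed.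
Let BDl := @pqBD_l F free_pre.
Let BDr := @pqBD_r F free_pre.
Let BZl := @pqBZl F free_pre.
Let BZr := @pqBZr F free_pre.
Let B0l := @pqB0l F free_pre.
Let B0r := @pqB0r F free_pre.

Let genL i c (v w : W i) : pi (TGen (c *: v + w)) = c *: pi (TGen v) + pi (TGen w).
Proof. by rewrite -piZ -piD; apply/piP; exact: teq_gen. Qed.
Let genD i (v w : W i) : pi (TGen (v + w)) = pi (TGen v) + pi (TGen w).
Proof. by rewrite -[v in LHS]scale1r genL scale1r. Qed.
Let gen0 i : pi (TGen (0 : W i)) = 0.
Proof. by apply: (addrI (pi (TGen (0 : W i)))); rewrite -genD !addr0. Qed.

Let tpr_sum t : pi (tpr false t) + pi (tpr true t) = pi t.
Proof.
elim: t => [i w||s IHs t IHt|c t IHt|s IHs t IHt] /=.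
- by rewrite -genD spr_sum.
- by rewrite pi0 addr0.
- by rewrite !piD addrACA IHs IHt.
- by rewrite !piZ -scalerDr IHt.
- rewrite !piD !piB -IHs -IHt !BDl !BDr.
  by rewrite addrACA; congr (_ + _); rewrite addrC.
Qed.

Let tpr_tpr a b t : pi (tpr a (tpr b t)) = if a == b then pi (tpr a t) else 0.
Proof.
elim: t a b => [i w||s IHs t IHt|c t IHt|s IHs t IHt] a b /=.
- by rewrite spr_spr; case: eqP => // _; rewrite gen0.
- by case: eqP.
- by rewrite !piD IHs IHt; case: eqP => // _; rewrite addr0.
- by rewrite !piZ IHt; case: eqP => // _; rewrite scaler0.
- rewrite !piD !piB !IHs !IHt.
  by case: a; case: b => /=; rewrite ?B0l ?B0r ?addr0 ?add0r.
Qed.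

Let tpr_E b s t : teq s t -> pi (tpr b s) = pi (tpr b t).
Proof.
move=> e; elim: e b => {s t}.
- by [].
- by move=> s t _ IH b; rewrite IH.
- by move=> s t u _ IH1 _ IH2 b; rewrite IH1.
- by move=> s s' t t' _ IH1 _ IH2 b /=; rewrite !piD IH1 IH2.
- by move=> c s s' _ IH b /=; rewrite !piZ IH.
- by move=> s s' t t' _ IH1 _ IH2 b /=; rewrite !piD !piB !IH1 !IH2.
- by move=> s t u b /=; rewrite !piD addrA.
- by move=> s t b /=; rewrite !piD addrC.
- by move=> t b /=; rewrite !piD pi0 add0r.
- by move=> t b /=; rewrite !piD !piZ scaleN1r addNr.
- by move=> a a' t b /=; rewrite !piZ scalerA.
- by move=> t b /=; rewrite !piZ scale1r.
- by move=> a s t b /=; rewrite !(piD, piZ) scalerDr.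
- by move=> a a' t b /=; rewrite !(piD, piZ) scalerDl.
- move=> c s t u b /=; rewrite !(piD, piZ, piB) !(BDl, BZl) scalerDr.
  by rewrite addrACA.
- move=> c s t u b /=; rewrite !(piD, piZ, piB) !(BDr, BZr) scalerDr.
  by rewrite addrACA.
- by move=> i c v w b /=; rewrite !(piD, piZ) spr_lin genL.
- move=> a a' s t b /=; rewrite !(piD, piZ, piB) !tpr_tpr.
  have := teq_skew a a' s t; move/piP; rewrite piZ !piB => e.
  case: a e; case: a'; case: b => /=; rewrite ?B0l ?B0r ?addr0 ?add0r ?scaler0 //.
- move=> a a' s t u b /=; rewrite !(piD, piZ, piB) /= !(BDl, BDr) !tpr_tpr.
  have := teq_jacobi a a' s t (tpr b u); move/piP.
  have := teq_jacobi a a' s t (tpr (~~ b) u); move/piP.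
  rewrite !(piD, piZ, piB) => e1 e2.
  case: a e1 e2; case: a'; case: b => /= e1 e2;
    by do !rewrite ?B0l ?B0r ?addr0 ?add0r ?scaler0.
Qed.

Definition free_spr b (x : Q) : Q := pi (tpr b (rp x)).
Let sprE b t : free_spr b (pi t) = pi (tpr b t).
Proof. by apply: tpr_E; exact: (pa_reprK (P := free_pre) t). Qed.
Let spr_lin' b c x y : free_spr b (c *: x + y) = c *: free_spr b x + free_spr b y.
Proof.
elim/piW: x => x; elim/piW: y => y.
by rewrite -piZ -piD !sprE /= piD piZ.
Qed.
Let sprK' b x : free_spr b (free_spr b x) = free_spr b x.
Proof. by elim/piW: x => x; rewrite !sprE tpr_tpr eqxx. Qed.
Let spr_sum' x : free_spr false x + free_spr true x = x.
Proof. by elim/piW: x => x; rewrite !sprE tpr_sum. Qed.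
Definition free_space : superspace F := Superspace spr_lin' sprK' spr_sum'.

Let homogP b (x : free_space) : homog b x -> exists t, x = pi (tpr b t).
Proof. by elim/piW: x => t; rewrite /homog /= sprE => <-; exists t. Qed.

Let homog' a b (x y : free_space) :
  homog a x -> homog b y -> homog (V := free_space) (a (+) b) (pqB x y).
Proof.
move=> /homogP[s ->] /homogP[t ->].
rewrite /homog -piB /= sprE /= piD !piB !tpr_tpr.
by case: a; case: b => /=; rewrite ?B0l ?B0r ?addr0 ?add0r.
Qed.
Let skew' a b (x y : free_space) : homog a x -> homog b y ->
  pqB x y = - ((-1) ^+ (a && b) *: (pqB y x : free_space)).
Proof.
move=> /homogP[s ->] /homogP[t ->].
by rewrite -!piB -scaleNr -piZ; apply/piP; exact: teq_skew.
Qed.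
Let jacobi' a b (x y z : free_space) : homog a x -> homog b y ->
  pqB x (pqB y z) = pqB (pqB x y) z + (-1) ^+ (a && b) *: (pqB y (pqB x z) : free_space).
Proof.
move=> /homogP[s ->] /homogP[t ->]; elim/piW: z => u.
by rewrite -!piB -piZ -piD; apply/piP; exact: teq_jacobi.
Qed.

(* The free Lie superalgebra on the superspace \bigoplus_i W_i. *)
Definition free_lie : lieSuper F :=
  @LieSuper F free_space (@pqB F free_pre) (@pqB_linl _ _) (@pqB_linr _ _) homog' skew' jacobi'.
Definition free_gen (i : I) (w : W i) : free_lie := pi (TGen w).
End FreeLie.


Section MatrixAlgebras.
Variables (F : fieldType) (N : nat) (p : 'I_N -> bool).

Definition gl_spr (b : bool) (X : 'M[F]_N) : 'M[F]_N :=
  \matrix_(i, j) if p i (+) p j == b then X i j else 0.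
Let spr_lin' b c X Y : gl_spr b (c *: X + Y) = c *: gl_spr b X + gl_spr b Y.
Proof. by apply/matrixP => i j; rewrite !mxE; case: eqP => // _; rewrite mulr0 addr0. Qed.
Let sprK' b X : gl_spr b (gl_spr b X) = gl_spr b X.
Proof. by apply/matrixP => i j; rewrite !mxE; case: eqP. Qed.
Let spr_sum' X : gl_spr false X + gl_spr true X = X.
Proof. by apply/matrixP => i j; rewrite !mxE; case: (_ (+) _); rewrite /= ?addr0 ?add0r. Qed.

(* End(F^N) with the i-th basis vector of parity [p i]. *)
Definition gl_space : superspace F := Superspace spr_lin' sprK' spr_sum'.

Definition gl_br (X Y : gl_space) : gl_space :=
  \sum_(a : bool) \sum_(b : bool)
    (spr a X *m spr b Y - (-1) ^+ (a && b) *: (spr b Y *m spr a X)).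

Lemma gl_homogE b (X : gl_space) i j : homog b X -> p i (+) p j != b -> X i j = 0.
Proof. by move=> <- /negPf e; rewrite mxE e. Qed.

Lemma gl_homog_mul a b (X Y : gl_space) :
  homog a X -> homog b Y -> homog (V := gl_space) (a (+) b) (X *m Y).
Proof.
move=> hX hY; apply/matrixP => i j; rewrite mxE; case: eqP => // /eqP e.
rewrite mxE big1 // => k _.
have [e1|/(gl_homogE hX)->] := eqVneq (p i (+) p k) a; last by rewrite mul0r.
rewrite (gl_homogE hY) ?mulr0 //; apply: contraNneq e => <-.
by rewrite -e1; case: (p i) (p k) (p j) => [] [] [].
Qed.

Lemma gl_brE a b (X Y : gl_space) : homog a X -> homog b Y ->
  gl_br X Y = X *m Y - (-1) ^+ (a && b) *: (Y *m X).
Proof.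
move=> hX hY; rewrite /gl_br !big_bool.
have eX c : spr c X = if c == a then X else 0 by rewrite -{1}hX spr_spr; case: eqP => [->|].
have eY c : spr c Y = if c == b then Y else 0 by rewrite -{1}hY spr_spr; case: eqP => [->|].
rewrite !eX !eY; case: a {hX eX}; case: b {hY eY} => /=;
by rewrite ?(mul0mx, mulmx0, scaler0, subr0, oppr0, addr0, add0r).
Qed.

Let linl c X Y Z : gl_br (c *: X + Y) Z = c *: gl_br X Z + gl_br Y Z.
Proof.
rewrite /gl_br scaler_sumr -big_split; apply: eq_bigr => a _ /=.
rewrite scaler_sumr -big_split; apply: eq_bigr => b _ /=.
rewrite spr_lin' mulmxDl mulmxDr scalerDr scalerBr opprD -scalemxAl -scalemxAr.
by rewrite !scalerA [_ * c]mulrC addrACA.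
Qed.
Let linr c X Y Z : gl_br Z (c *: X + Y) = c *: gl_br Z X + gl_br Z Y.
Proof.
rewrite /gl_br scaler_sumr -big_split; apply: eq_bigr => a _ /=.
rewrite scaler_sumr -big_split; apply: eq_bigr => b _ /=.
rewrite spr_lin' mulmxDl mulmxDr scalerDr scalerBr opprD -scalemxAl -scalemxAr.
by rewrite !scalerA [_ * c]mulrC addrACA.
Qed.
Let homog' a b (X Y : gl_space) :
  homog a X -> homog b Y -> homog (V := gl_space) (a (+) b) (gl_br X Y).
Proof.
move=> hX hY; rewrite (gl_brE hX hY); apply: homogD; first exact: gl_homog_mul.
by apply: homogN; apply: homogZ; rewrite addbC; exact: gl_homog_mul.
Qed.
Let skew' a b (X Y : gl_space) : homog a X -> homog b Y ->
  gl_br X Y = - ((-1) ^+ (a && b) *: gl_br Y X).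
Proof.
move=> hX hY; rewrite (gl_brE hX hY) (gl_brE hY hX) andbC.
by rewrite scalerBr scalerA -signr_addb addbb scale1r opprB.
Qed.
Let jacobi' a b (X Y Z : gl_space) : homog a X -> homog b Y ->
  gl_br X (gl_br Y Z) = gl_br (gl_br X Y) Z + (-1) ^+ (a && b) *: gl_br Y (gl_br X Z).
Proof.
move=> hX hY.
have linrD U V W : gl_br U (V + W) = gl_br U V + gl_br U W.
  by rewrite -[V in LHS]scale1r linr scale1r.
have H c (hZ : homog c (spr c Z)) : gl_br X (gl_br Y (spr c Z)) =
    gl_br (gl_br X Y) (spr c Z) + (-1) ^+ (a && b) *: gl_br Y (gl_br X (spr c Z)).
  move: (spr c Z) hZ => {}Z hZ.
  rewrite (gl_brE hX (homog' hY hZ)) (gl_brE (homog' hX hY) hZ).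
  rewrite (gl_brE hY (homog' hX hZ)) (gl_brE hX hY) (gl_brE hX hZ) (gl_brE hY hZ).
  rewrite !(mulmxBl, mulmxBr, scalerBr, opprB, opprD, opprK, scalerA).
  rewrite -!scalemxAl -!scalemxAr !scalerA !mulmxA -!signr_addb.
  case: a b c {hX hY hZ} => [] [] [] /=;
  rewrite ?expr0 ?expr1 ?scaleN1r ?scale1r ?opprK;
  set x1 := X *m Y *m Z; set x2 := X *m Z *m Y; set x3 := Y *m Z *m X;
  set x4 := Z *m Y *m X; set x5 := Y *m X *m Z; set x6 := Z *m X *m Y;
  clearbody x1 x2 x3 x4 x5 x6; zmod_eq.
by rewrite -[Z]spr_sum !linrD !H ?homog_spr // scalerDr addrACA.
Qed.

Definition gl_lie : lieSuper F := @LieSuper F gl_space gl_br linl linr homog' skew' jacobi'.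

Definition supertrace (X : gl_lie) : F := \sum_i (-1) ^+ p i * (X : 'M[F]_N) i i.
End MatrixAlgebras.


(* Even supersymmetric invariant bilinear forms. The value space [K] is F for
   actual forms; the zero module is used to omit the central element of a
   Takiff superalgebra. *)
Record inv_form (F : fieldType) (L : lieSuper F) (K : lmodType F) := InvForm {
  form :> L -> L -> K;
  form_linl : forall c x y z, form (c *: x + y) z = c *: form x z + form y z;
  form_linr : forall c x y z, form z (c *: x + y) = c *: form z x + form z y;
  form_even : forall x y, homog false x -> homog true y -> form x y = 0;
  form_sym : forall a b x y, homog a x -> homog b y ->
    form x y = (-1) ^+ (a && b) *: form y x;
  form_inv : forall x y z, form (br x y) z = form x (br y z) }.

Definition nondegenerate (F : fieldType) (L : lieSuper F) (K : lmodType F)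
    (B : inv_form L K) : Prop :=
  forall x, (forall y, B x y = 0) -> x = 0.

Section FormTheory.
Variables (F : fieldType) (L : lieSuper F) (K : lmodType F) (B : inv_form L K).
Lemma formDl x y z : B (x + y) z = B x z + B y z.
Proof. by rewrite -[x in LHS]scale1r form_linl scale1r. Qed.
Lemma formDr x y z : B z (x + y) = B z x + B z y.
Proof. by rewrite -[x in LHS]scale1r form_linr scale1r. Qed.
Lemma form0l z : B 0 z = 0.
Proof. by apply: (addrI (B 0 z)); rewrite -formDl !addr0. Qed.
Lemma form0r z : B z 0 = 0.
Proof. by apply: (addrI (B z 0)); rewrite -formDr !addr0. Qed.
Lemma formZl c x z : B (c *: x) z = c *: B x z.
Proof. by rewrite -[c *: x]addr0 form_linl form0l addr0. Qed.
Lemma formZr c x z : B z (c *: x) = c *: B z x.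
Proof. by rewrite -[c *: x]addr0 form_linr form0r addr0. Qed.
Lemma formNl x z : B (- x) z = - B x z.
Proof. by rewrite -scaleN1r formZl scaleN1r. Qed.
Lemma formNr x z : B z (- x) = - B z x.
Proof. by rewrite -scaleN1r formZr scaleN1r. Qed.
Lemma form_odd x y : homog true x -> homog false y -> B x y = 0.
Proof. by move=> hx hy; rewrite (form_sym B hx hy) (form_even B hy hx) scaler0. Qed.
End FormTheory.

Definition zero_form (F : fieldType) (L : lieSuper F) (K : lmodType F) : inv_form L K.
Proof.
by exists (fun _ _ => 0) => *; rewrite ?scaler0 ?addr0.
Defined.

Definition sub_form (F : fieldType) (L : lieSuper F) (S : set L) (K : lmodType F)
  (B : inv_form L K) : inv_form (lie_sub S) K.
Proof.
exists (fun x y => B (lie_sub_val x) (lie_sub_val y)).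
- by move=> c x y z; exact: form_linl.
- by move=> c x y z; exact: form_linr.
- by move=> x y /(congr1 (@lie_sub_val _ _ S)) hx /(congr1 (@lie_sub_val _ _ S)) hy; exact: form_even.
- by move=> a b x y /(congr1 (@lie_sub_val _ _ S)) hx /(congr1 (@lie_sub_val _ _ S)) hy; exact: form_sym.
- by move=> x y z; exact: form_inv.
Defined.

Section SupertraceForm.
Variables (F : fieldType) (N : nat) (p : 'I_N -> bool).
Let L := gl_lie F p.
Definition str_prod (X Y : L) : F^o := @supertrace F N p (X *m Y).

Let str_lin c (X Y : L) : supertrace (c *: X + Y) = c * supertrace X + supertrace Y.
Proof.
rewrite /supertrace mulr_sumr -big_split; apply: eq_bigr => i _ /=.
by rewrite !mxE mulrDr mulrCA.
Qed.
Let str_odd (X : L) : homog true X -> supertrace X = 0.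
Proof.
by move=> hX; rewrite /supertrace big1 // => i _; rewrite (gl_homogE hX) ?mulr0 // addbb.
Qed.
Let linl c X Y Z : str_prod (c *: X + Y) Z = c *: str_prod X Z + str_prod Y Z.
Proof. by rewrite /str_prod mulmxDl -scalemxAl; exact: str_lin. Qed.
Let linr c X Y Z : str_prod Z (c *: X + Y) = c *: str_prod Z X + str_prod Z Y.
Proof. by rewrite /str_prod mulmxDr -scalemxAr; exact: str_lin. Qed.
Let even X Y : homog false X -> homog true Y -> str_prod X Y = 0.
Proof. by move=> hX hY; apply: str_odd; exact: (gl_homog_mul hX hY). Qed.
Let sym a b X Y : homog a X -> homog b Y ->
  str_prod X Y = (-1) ^+ (a && b) *: str_prod Y X.
Proof.
move=> hX hY.
rewrite /str_prod /supertrace scaler_sumr.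
under eq_bigr do rewrite mxE mulr_sumr.
under [RHS]eq_bigr do rewrite mxE mulr_sumr scaler_sumr.
rewrite exchange_big; apply: eq_bigr => i _; apply: eq_bigr => j _ /=.
have [e|/(gl_homogE hX) ->] := eqVneq (p j (+) p i) a; last by rewrite mul0r mulr0 !mulr0 scaler0.
have [e'|/(gl_homogE hY) ->] := eqVneq (p i (+) p j) b; last by rewrite mulr0 mul0r !mulr0 scaler0.
have {e'} <- : a = b by rewrite -e -e' addbC.
rewrite andbb [in RHS](mulrC (Y i j)) -[RHS]/(_ * (_ * _)) mulrA -signr_addb -e.
by case: (p i) (p j) => [] [].
Qed.
Let strB (X Y : L) : supertrace (X - Y) = supertrace X - supertrace Y.
Proof. by rewrite addrC -scaleN1r str_lin mulN1r addrC. Qed.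
Let strZ c (X : 'M[F]_N) : supertrace (p := p) (c *: X) = c * supertrace (p := p) X.
Proof. by rewrite /supertrace mulr_sumr; apply: eq_bigr => i _; rewrite !mxE mulrCA. Qed.
Let inv (X Y Z : L) : str_prod (br X Y) Z = str_prod X (br Y Z).
Proof.
have D1 U V W : str_prod (U + V) W = str_prod U W + str_prod V W.
  by rewrite -[U in LHS]scale1r linl scale1r.
have D2 U V W : str_prod W (U + V) = str_prod W U + str_prod W V.
  by rewrite -[U in LHS]scale1r linr scale1r.
have H a b c (hX : homog a (spr a X)) (hY : homog b (spr b Y)) (hZ : homog c (spr c Z)) :
    str_prod (br (spr a X) (spr b Y)) (spr c Z) = str_prod (spr a X) (br (spr b Y) (spr c Z)).
  move: (spr a X) (spr b Y) (spr c Z) hX hY hZ => {}X {}Y {}Z hX hY hZ.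
  rewrite /= (gl_brE hX hY) (gl_brE hY hZ) /str_prod mulmxBl mulmxBr.
  rewrite -[LHS]/(supertrace (_ - _ : L)) -[RHS]/(supertrace (_ - _ : L)) !strB mulmxA.
  congr (_ - _).
  have := sym hY (gl_homog_mul hX hZ); rewrite /str_prod !mulmxA => e.
  rewrite -scalemxAl -scalemxAr mulmxA.
  rewrite !strZ e.
  rewrite -[_ *: _]/(_ * _) mulrA -signr_addb.
  by case: a b c {hX hY hZ e} => [] [] [].
have {}H a b c := H a b c (homog_spr a X) (homog_spr b Y) (homog_spr c Z).
rewrite -[X]spr_sum -[Y]spr_sum -[Z]spr_sum.
by rewrite !(brDl, brDr, D1, D2) !H; do 8![move: (str_prod (spr _ _) (br _ _)) => ?]; zmod_eq.
Qed.
Definition str_form : inv_form L F^o := InvForm linl linr even sym inv.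
End SupertraceForm.

Section Takiff.
Variables (F : fieldType) (L : lieSuper F) (K : lmodType F) (B : inv_form L K).

Definition stw (V : superspace F) (v : V) : V := spr false v - spr true v.

Lemma stw_homog (V : superspace F) b (v : V) : homog b v -> stw v = (-1) ^+ b *: v.
Proof.
move=> h; rewrite /stw; case: b h => h; rewrite (h : spr _ _ = v) (homog_oppo h).
  by rewrite sub0r scaleN1r.
by rewrite subr0 scale1r.
Qed.
Lemma stw_lin (V : superspace F) c (v w : V) : stw (c *: v + w) = c *: stw v + stw w.
Proof. by rewrite /stw !spr_lin scalerBr opprD addrACA. Qed.

(* (x, y, d, k, z) stands for x (x) 1 + y (x) xi + d partial_xi + k c + z z,
   where k ranges over the line F c, or over 0 when c is omitted. *)
Definition tak_car : Type := (L * L * F^o * K * F^o)%type.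
HB.instance Definition _ := GRing.Lmodule.on tak_car.

Definition tak_elt (x y : L) (d : F) (k : K) (z : F) : tak_car := (x, y, d, k, z).

Definition tak_spr (b : bool) (u : tak_car) : tak_car :=
  let: (x, y, d, k, z) := u in
  tak_elt (spr b x) (spr (~~ b) y) (if b then d else 0)
    (if b then 0 else k) (if b then 0 else z).

(* The signs of the defining formulas are those of [stw y = (-1)^|y| y];
   [y (x) xi, partial_xi] = y by skew-symmetry. *)
Definition tak_br (u v : tak_car) : tak_car :=
  let: (x1, y1, d1, _, _) := u in
  let: (x2, y2, d2, _, _) := v in
  tak_elt (br x1 x2 + d1 *: stw y2 + d2 *: y1)
    (br x1 y2 + br y1 (stw x2))
    0 (B y1 (stw y2)) (d1 * d2).

Let car_eq (x x' y y' : L) (d d' : F) (k k' : K) (z z' : F) :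
  x = x' -> y = y' -> d = d' -> k = k' -> z = z' ->
  tak_elt x y d k z = tak_elt x' y' d' k' z'.
Proof. by do 5!move->. Qed.
Let eltL c x y d k z x' y' d' k' z' :
  c *: tak_elt x y d k z + tak_elt x' y' d' k' z' =
  tak_elt (c *: x + x') (c *: y + y') (c * d + d') (c *: k + k') (c * z + z').
Proof. by []. Qed.

Let eltZ c x y d k z :
  c *: tak_elt x y d k z = tak_elt (c *: x) (c *: y) (c * d) (c *: k) (c * z).
Proof. by []. Qed.

Let brE x y d k z x' y' d' k' z' :
  tak_br (tak_elt x y d k z) (tak_elt x' y' d' k' z') =
  tak_elt (br x x' + d *: stw y' + d' *: y) (br x y' + br y (stw x'))
    0 (B y (stw y')) (d * d').
Proof. by []. Qed.

Let spr_lin' b c u v : tak_spr b (c *: u + v) = c *: tak_spr b u + tak_spr b v.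
Proof.
case: u => [[[[x y] d] k] z]; case: v => [[[[x' y'] d'] k'] z'].
rewrite -/(tak_elt x y d k z) -/(tak_elt x' y' d' k' z') eltL /tak_spr.
by rewrite eltL; apply: car_eq; rewrite ?spr_lin //; case: b; rewrite ?(mulr0, scaler0, addr0).
Qed.
Let sprK' b u : tak_spr b (tak_spr b u) = tak_spr b u.
Proof.
case: u => [[[[x y] d] k] z]; apply: car_eq; rewrite ?sprK //; by case: b.
Qed.
Let spr_sum' u : tak_spr false u + tak_spr true u = u.
Proof.
case: u => [[[[x y] d] k] z]; rewrite -[tak_spr false _]scale1r /tak_spr eltL.
apply: car_eq; rewrite ?(scale1r, spr_sum, mulr0, mul1r, add0r, addr0) //.
by rewrite addrC spr_sum.
Qed.
Definition tak_space : superspace F := Superspace spr_lin' sprK' spr_sum'.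

Let linl c u v w : tak_br (c *: u + v) w = c *: tak_br u w + tak_br v w.
Proof.
case: u => [[[[x y] d] k] z]; case: v => [[[[x' y'] d'] k'] z'].
case: w => [[[[x2 y2] d2] k2] z2].
rewrite -/(tak_elt x y d k z) -/(tak_elt x' y' d' k' z') eltL /tak_br eltL.
apply: car_eq; rewrite ?br_linl ?form_linl ?mulr0 ?addr0 //.
- rewrite !scalerDr !scalerDl !scalerA [d2 * c]mulrC.
  by zmod_eq.
- by rewrite scalerDr addrACA.
- by rewrite mulrDl mulrA.
Qed.
Let linr c u v w : tak_br w (c *: u + v) = c *: tak_br w u + tak_br w v.
Proof.
case: u => [[[[x y] d] k] z]; case: v => [[[[x' y'] d'] k'] z'].
case: w => [[[[x2 y2] d2] k2] z2].
rewrite -/(tak_elt x y d k z) -/(tak_elt x' y' d' k' z') eltL /tak_br eltL.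
apply: car_eq; rewrite ?br_linr ?stw_lin ?br_linr ?form_linr ?mulr0 ?addr0 //.
- rewrite !scalerDr !scalerDl !scalerA [d2 * c]mulrC.
  by zmod_eq.
- by rewrite scalerDr addrACA.
- by rewrite mulrDr mulrCA.
Qed.

Let homogP b (u : tak_space) : homog b u -> exists x y d k z,
  [/\ u = tak_elt x y d k z, homog b x, homog (~~ b) y &
     if b then k = 0 /\ z = 0 else d = 0].
Proof.
case: u => [[[[x y] d] k] z] [ex ey ed ek ez].
exists x, y, d, k, z; split => //.
by case: b ed ek ez {ex ey} => /= [_ <- <-|<-].
Qed.

Let homog' a b (u v : tak_space) :
  homog a u -> homog b v -> homog (V := tak_space) (a (+) b) (tak_br u v).
Proof.
move=> /homogP[x [y [d [k [z [-> hx hy e]]]]]].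
move=> /homogP[x' [y' [d' [k' [z' [-> hx' hy' e']]]]]].
rewrite /homog /= (stw_homog hx') (stw_homog hy'); apply: car_eq.
- rewrite -[RHS]/(_ : L) !sprD !sprZ (br_homog hx hx').
  congr (_ + _ + _).
    case: a e {hx hy} => [_|->]; last by rewrite !scale0r.
    by congr (_ *: (_ *: _)); case: b hy' {hx' e'} => /=.
  case: b e' {hx' hy'} => [_|->]; last by rewrite !scale0r.
  by congr (_ *: _); case: a hy {hx e} => /=.
- rewrite -[RHS]/(_ : L) sprD brZr sprZ; congr (_ + _ *: _).
  + by have := br_homog hx hy'; rewrite addbN.
  + by have := br_homog hy hx'; rewrite addNb.
- by case: ifP.
- rewrite formZr; case: ifP => // ab.
  case: a b hx hy hx' hy' ab {e e'} => [] [] //= hx hy hx' hy' _.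
    by rewrite form_even ?scaler0.
  by rewrite form_odd ?scaler0.
- case: ifP => //; case: a e {hx hy} => [_|->]; last by rewrite mul0r.
  by case: b e' {hx' hy'} => [//|->]; rewrite mulr0.
Qed.
Let skew' a b (u v : tak_space) : homog a u -> homog b v ->
  tak_br u v = - ((-1) ^+ (a && b) *: (tak_br v u : tak_space)).
Proof.
move=> /homogP[x [y [d [k [z [-> hx hy e]]]]]].
move=> /homogP[x' [y' [d' [k' [z' [-> hx' hy' e']]]]]].
rewrite !brE -scaleNr eltZ.
rewrite (stw_homog hx) (stw_homog hy) (stw_homog hx') (stw_homog hy').
rewrite !brZr !formZr (br_skew hx hx') (br_skew hx hy') (br_skew hy hx') (form_sym B hy hy').
apply: car_eq; last 1 first.
- rewrite [d' * d]mulrC; case: a e {hx hy} => [_|->]; rewrite ?mul0r ?mulr0 //.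
  by case: b e' {hx' hy'} => [_|->]; rewrite ?mulr0 // expr1 opprK mul1r.
- rewrite !scalerDr !scalerA.
  case: a e {hx hy} => [_|->]; case: b e' {hx' hy'} => [_|->] /=;
  rewrite ?(expr0, expr1, mulr1, mul1r, mulrN1, mulN1r, opprK, mulr0, mul0r, oppr0);
  rewrite ?(scaleNr, scale1r, scale0r); zmod_eq.
- rewrite !scalerDr !scalerN !scalerA.
  case: a {hx hy e}; case: b {hx' hy' e'} => /=;
  rewrite ?(expr0, expr1, mulr1, mul1r, mulrN1, mulN1r, opprK);
  rewrite ?(scaleNr, scale1r, opprK); zmod_eq.
- by rewrite mulr0.
- rewrite !scalerA; congr (_ *: _).
  case: a {hx hy e}; case: b {hx' hy' e'} => /=;
  by rewrite ?(expr0, expr1, mulr1, mul1r, mulrN1, mulN1r, opprK).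
Qed.

Let stwK (V : superspace F) (v : V) : stw (stw v) = v.
Proof. by rewrite {1}/stw /stw !sprB !spr_spr /= subr0 sub0r opprK spr_sum. Qed.
Let stw_br (v w : L) : stw (br v w) = br (stw v) (stw w).
Proof.
rewrite /stw !spr_br !(brDl, brDr, brNl, brNr) /=.
by do 4![move: (br (spr _ _) (spr _ _)) => ?]; zmod_eq.
Qed.
Let stwD (V : superspace F) (v w : V) : stw (v + w) = stw v + stw w.
Proof. by rewrite -[v in LHS]scale1r stw_lin scale1r. Qed.
Let stw0 (V : superspace F) : stw (0 : V) = 0.
Proof. by rewrite /stw !spr0 subr0. Qed.
Let stwZ (V : superspace F) c (v : V) : stw (c *: v) = c *: stw v.
Proof. by rewrite -[_ *: v]addr0 stw_lin stw0 addr0. Qed.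

Let jacobi' a b (u v w : tak_space) : homog a u -> homog b v ->
  tak_br u (tak_br v w) =
  tak_br (tak_br u v) w + (-1) ^+ (a && b) *: (tak_br v (tak_br u w) : tak_space).
Proof.
move=> /homogP[x [y [d [k [z [-> hx hy e]]]]]].
move=> /homogP[x' [y' [d' [k' [z' [-> hx' hy' e']]]]]].
case: w => [[[[x2 y2] d2] k2] z2].
rewrite -/(tak_elt x2 y2 d2 k2 z2) !brE [RHS]addrC eltL !(stwD, stwZ, stw_br, stwK).
rewrite (stw_homog hx) (stw_homog hy) (stw_homog hx') (stw_homog hy').
move: (stw x2) (stw y2) => sx sy.
rewrite !(brDl, brDr, brZl, brZr, formDl, formDr, formZl, formZr).
apply: car_eq; last 1 first.
- by rewrite mul0r !mulr0 addr0.
- rewrite (br_jacobi _ hx hx') (br_skew hy hx').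
  case: a e hx hy => [_|->] hx hy; case: b e' hx' hy' => [_|->] hx' hy' /=;
  rewrite ?(scale0r, scaler0, addr0);
  rewrite ?(expr0, expr1, scaleNr, scale1r, scalerN, opprK, scalerDr); zmod_eq.
- rewrite (br_jacobi _ hx hx') (br_jacobi _ hx hy') (br_jacobi _ hy hx').
  rewrite (br_skew hy hy').
  case: a e hx hy => [_|->] hx hy; case: b e' hx' hy' => [_|->] hx' hy' /=;
  rewrite ?(scale0r, scaler0, addr0);
  rewrite ?(expr0, expr1, scaleNr, scale1r, scalerN, opprK, scalerDr); zmod_eq.
- by rewrite mulr0 add0r.
- rewrite -!form_inv (br_skew hy hy') (br_skew hy hx') (br_skew hy' hx).
  rewrite !(formNl, formZl).
  case: a {e hx hy}; case: b {e' hx' hy'} => /=;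
  rewrite ?(expr0, expr1, scaleNr, scale1r, scalerN, opprK, scalerDr); zmod_eq.
Qed.

Definition tak_lie : lieSuper F :=
  @LieSuper F tak_space tak_br linl linr homog' skew' jacobi'.
End Takiff.


Section CartanData.
Variable F : numClosedFieldType.

Definition findim (V : lmodType F) : Prop :=
  exists (m : nat) (e : 'I_m -> V), forall v, exists c : 'I_m -> F,
    v = \sum_j c j *: e j.

Definition span_of (V : lmodType F) (S : set V) : set V :=
  [set x | exists (m : nat) (c : 'I_m -> F) (v : 'I_m -> V),
    (forall j, S (v j)) /\ x = \sum_j c j *: v j].

Record hmodule (h : lieSuper F) := HModule {
  hm_space :> superspace F;
  act : h -> hm_space -> hm_space;
  act_linl : forall c x y v, act (c *: x + y) v = c *: act x v + act y v;
  act_linr : forall c x v w, act x (c *: v + w) = c *: act x v + act x w;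
  act_homog : forall a b x v, homog a x -> homog b v -> homog (a (+) b) (act x v);
  act_br : forall a b x y v, homog a x -> homog b y ->
    act (br x y) v = act x (act y v) - (-1) ^+ (a && b) *: act y (act x v) }.

Definition submodule (h : lieSuper F) (M : hmodule h) (U : set M) : Prop :=
  graded_subspace U /\ forall (x : h) v, U v -> U (act x v).

Definition irreducible (h : lieSuper F) (M : hmodule h) : Prop :=
  (exists v : M, v != 0) /\
  forall U : set M, submodule U -> (exists2 v, U v & v != 0) -> U = setT.

(* omega_h^-1, where omega_h is -1 on h_0 and sqrt(-1) on h_1. *)
Definition omega_inv (h : lieSuper F) (x : h) : h :=
  - spr false x + ('i)^-1 *: spr true x.

(* [theta] is an (even) isomorphism of h-modules from V^vee onto W. *)
Definition vee_iso (h : lieSuper F) (V W : hmodule h) (theta : V -> W) : Prop :=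
  [/\ forall c v w, theta (c *: v + w) = c *: theta v + theta w,
      forall b v, theta (spr b v) = spr b (theta v),
      bijective theta
    & forall (x : h) v, theta (act (omega_inv x) v) = act x (theta v)].

Definition quasi_toral (h : lieSuper F) : Prop :=
  forall x y : h, homog false x -> br x y = 0.

(* [r] is the rank of the symmetric form (x, y) |-> lambda [x, y] on h_1. *)
Definition form_rank (h : lieSuper F) (lambda : h -> F) (r : nat) : Prop :=
  exists (m : nat) (e : 'I_m -> h),
    [/\ forall j, homog true (e j),
        forall x, homog true x -> exists c : 'I_m -> F, x = \sum_j c j *: e j,
        forall c : 'I_m -> F, \sum_j c j *: e j = 0 -> forall j, c j = 0
      & \rank (\matrix_(j, k) lambda (br (e j) (e k))) = r].

Section Data.
Variable n : nat.

(* The data from which contragredient superalgebras are built; the axioms of a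
   Cartan datum are in [cartan_datum]. Functionals on t = h_0 are extended by
   0 to h_1. [dmod false i] is g_{alpha_i} and [dmod true i] is g_{-alpha_i}. *)
Record datum := Datum {
  dh : lieSuper F;
  dalpha : 'I_n -> {scalar dh};
  dmod : bool -> 'I_n -> hmodule dh;
  dpair : forall i, dmod false i -> dmod true i -> dh }.

Record cartan_datum (D : datum) : Prop := CartanDatum {
  cd_findim : findim (dh D);
  cd_quasi_toral : quasi_toral (dh D);
  cd_alpha_odd : forall i (x : dh D), homog true x -> dalpha D i x = 0;
  cd_alpha_free : forall c : 'I_n -> F,
    (forall x, \sum_i c i * dalpha D i x = 0) -> forall i, c i = 0;
  cd_mod_findim : forall s i, findim (dmod D s i);
  cd_mod_weight : forall s i (x : dh D) (v : dmod D s i), homog false x ->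
    act x v = ((-1) ^+ s * dalpha D i x) *: v;
  cd_pair_linl : forall i c u u' (v : dmod D true i),
    dpair (c *: u + u') v = c *: dpair u v + dpair u' v;
  cd_pair_linr : forall i c (u : dmod D false i) v v',
    dpair u (c *: v + v') = c *: dpair u v + dpair u v';
  cd_pair_homog : forall i a b (u : dmod D false i) (v : dmod D true i),
    homog a u -> homog b v -> homog (a (+) b) (dpair u v);
  cd_pair_equiv : forall i a b (x : dh D) (u : dmod D false i) (v : dmod D true i),
    homog a x -> homog b u ->
    br x (dpair u v) = dpair (act x u) v + (-1) ^+ (a && b) *: dpair u (act x v);
  cd_pair_nondegl : forall i (U : set (dmod D false i)), submodule U ->
    (exists2 u, U u & u != 0) -> exists u v, U u /\ dpair u v != 0;
  cd_pair_nondegr : forall i (U : set (dmod D true i)), submodule U ->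
    (exists2 v, U v & v != 0) -> exists u v, U v /\ dpair u v != 0 }.

Section Contragredient.
Variable D : datum.

Definition dgen (a : option (bool * 'I_n)) : superspace F :=
  if a is Some (s, i) then dmod D s i else dh D.
Definition fr_h (x : dh D) : free_lie dgen := @free_gen F _ dgen None x.
Definition fr_root s i (v : dmod D s i) : free_lie dgen :=
  @free_gen F _ dgen (Some (s, i)) v.

Inductive contra_rel : free_lie dgen -> Prop :=
| contra_h x y : contra_rel (br (fr_h x) (fr_h y) - fr_h (br x y))
| contra_act s i x (v : dmod D s i) :
    contra_rel (br (fr_h x) (fr_root v) - fr_root (act x v))
| contra_pair i (u : dmod D false i) (v : dmod D true i) :
    contra_rel (br (fr_root u) (fr_root v) - fr_h (dpair u v))
| contra_neq i j (u : dmod D false i) (v : dmod D true j) :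
    i != j -> contra_rel (br (fr_root u) (fr_root v)).

Definition gtilde : lieSuper F := lie_quot contra_rel.
Definition gt_h (x : dh D) : gtilde := lie_pi contra_rel (fr_h x).

(* Union of the ideals meeting h trivially; the ideal it generates is their
   sum, the maximal ideal meeting h trivially. *)
Definition gt_max : set gtilde :=
  [set x | exists I : set gtilde,
    [/\ lie_ideal I, forall y, I (gt_h y) -> gt_h y = 0 & I x]].

Definition galg : lieSuper F := lie_quot gt_max.
Definition gh (x : dh D) : galg := lie_pi gt_max (gt_h x).
Definition groot s i (v : dmod D s i) : galg :=
  lie_pi gt_max (lie_pi contra_rel (fr_root v)).

(* The k-weight space, for the weight \sum_i k_i alpha_i, of a Lie superalgebra
   M in which t acts through tau : h -> M. *)
Definition weight_space (M : lieSuper F) (tau : dh D -> M) (k : 'I_n -> int) : set M :=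
  [set v | forall x, homog false x ->
    br (tau x) v = (\sum_i (k i)%:~R * dalpha D i x) *: v].

Definition h_alpha (i : 'I_n) : set (dh D) :=
  span_of [set x | exists (u : dmod D false i) (v : dmod D true i), x = dpair u v].

(* [h_{alpha_i}, g_{alpha_j}] = 0 *)
Definition h_kills (i j : 'I_n) : Prop :=
  forall x, h_alpha i x -> forall v : dmod D false j, act x v = 0.

Record qkm : Prop := QKM {
  km1 : forall s i s' j, exists N : nat, forall (xs : seq (dmod D s i)) (y : dmod D s' j),
    size xs = N -> foldr (fun x z => br (groot x) z) (groot y) xs = 0;
  km2 : forall i j, h_kills i j -> h_kills j i;
  km3 : forall i, form_rank (dalpha D i) 2;
  km4 : forall i, irreducible (dmod D false i) /\
    exists theta : dmod D false i -> dmod D true i, vee_iso theta;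
  km5 : forall i, ~ (h_alpha i `<=` span_of [set x | exists2 j, j != i & h_alpha j x]) }.

Definition indecomposable : Prop :=
  ~ exists P : {set 'I_n}, [/\ P != finset.set0, P != [set: 'I_n]%SET &
      forall i j, i \in P -> j \notin P -> h_kills i j /\ h_kills j i].

Definition JA : set galg :=
  gh @` [set x | forall i (v : dmod D false i), act x v = 0].

End Contragredient.
End Data.

Inductive tak_type := TakSl2 | TakOsp12 | TakSl11.

Definition gl_par (m k : nat) (i : 'I_(m + k)) : bool := (m <= i)%N.

Definition sl_lie (m k : nat) : lieSuper F :=
  lie_sub [set X : gl_lie F (@gl_par m k) | supertrace X = 0].

(* Gram matrix of an even supersymmetric form on F^(1|2). *)
Definition osp12_gram : 'M[F]_(1 + 2) :=
  \matrix_(i, j) (((i == 0 :> nat) && (j == 0 :> nat))%:R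
    + ((i == 1%N :> nat) && (j == 2%N :> nat))%:R
    - ((i == 2%N :> nat) && (j == 1%N :> nat))%:R).

(* (X v, w) + (-1)^(|X||v|) (v, X w) = 0 for the homogeneous parts of X. *)
Definition osp12_lie : lieSuper F :=
  lie_sub [set X : gl_lie F (@gl_par 1 2) | forall b i j,
    ((spr b X : 'M_(1 + 2))^T *m osp12_gram) i j
    + (-1) ^+ (b && gl_par i) * (osp12_gram *m (spr b X : 'M_(1 + 2))) i j = 0].

Definition tak_base (ty : tak_type) : lieSuper F :=
  match ty with
  | TakSl2 => sl_lie 2 0
  | TakOsp12 => osp12_lie
  | TakSl11 => sl_lie 1 1
  end.

Definition tak_base_form (ty : tak_type) : inv_form (tak_base ty) F^o :=
  match ty with
  | TakSl2 => sub_form _ (str_form F (@gl_par 2 0))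
  | TakOsp12 => sub_form _ (str_form F (@gl_par 1 2))
  | TakSl11 => sub_form _ (str_form F (@gl_par 1 1))
  end.

(* ts' = s' (x) F[xi] (+) F c, inside the Takiff superalgebra of s'. *)
Definition ts_lie (ty : tak_type) : lieSuper F :=
  lie_sub [set u : tak_lie (tak_base_form ty) |
    exists x y k, u = tak_elt x y 0 k 0].

Section Generators.
Variables (n : nat) (D : datum n).

Definition root_type (i : 'I_n) (ty : tak_type) : Prop :=
  exists phi : ts_lie ty -> galg D,
    [/\ lie_morph phi,
        range phi = subalg_gen (range (@groot _ D false i) `|` range (@groot _ D true i))
      & forall u, phi u = 0 -> exists k, lie_sub_val u = tak_elt 0 0 0 k 0].

Record generators := Generators {
  gen_e : forall i, dmod D false i;
  gen_E : forall i, dmod D false i;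
  gen_f : forall i, dmod D true i;
  gen_F : forall i, dmod D true i }.

(* The parity of e_i is odd unless alpha_i has type Tak(sl(2)), that of E_i is
   the opposite one; a factor sqrt(-1) occurs on the dual of the odd vector. *)
Definition std_generators (g : generators) : Prop :=
  forall i, exists (ty : tak_type) (theta : dmod D false i -> dmod D true i),
    let p := if ty is TakSl2 then false else true in
    [/\ root_type i ty, vee_iso theta,
        [/\ homog p (gen_e g i), homog (~~ p) (gen_E g i),
            gen_e g i != 0 & gen_E g i != 0],
        gen_f g i = 'i ^+ p *: theta (gen_e g i)
          /\ gen_F g i = 'i ^+ (~~ p) *: theta (gen_E g i)
      & match ty with
        | TakSl2 => dalpha D i (dpair (gen_e g i) (gen_f g i)) = 2
        | TakOsp12 => dalpha D i (dpair (gen_e g i) (gen_f g i)) = 1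
        | TakSl11 => True
        end].

Definition gen_h (g : generators) i : dh D := dpair (gen_e g i) (gen_f g i).
(* [E_i, f_i] = [e_i, F_i] by equivariance of the pairing. *)
Definition gen_H (g : generators) i : dh D := dpair (gen_E g i) (gen_f g i).

Definition cartan_mx (g : generators) : 'M[F]_n := \matrix_(i, j) dalpha D j (gen_h g i).

Definition X_matrix (g : generators) (X : 'M[F]_n) : Prop :=
  forall i j, act (gen_H g i) (gen_e g j) = X i j *: gen_E g j.
Definition Y_matrix (g : generators) (Y : 'M[F]_n) : Prop :=
  forall i j, act (gen_H g i) (gen_E g j) = Y i j *: gen_e g j.

Definition rescale (r : 'I_n -> F) (g : generators) : generators :=
  Generators (gen_e g) (fun i => r i *: gen_E g i) (gen_f g) (fun i => r i *: gen_F g i).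

End Generators.

Section KacMoody.
Variables (n : nat) (A : 'M[F]_n) (t : vectType F).
Variables (ta : 'I_n -> {scalar t}) (th : 'I_n -> t).

Definition min_realization : Prop :=
  [/\ forall c : 'I_n -> F, (forall x, \sum_i c i * ta i x = 0) -> forall i, c i = 0,
      forall c : 'I_n -> F, \sum_i c i *: th i = 0 -> forall i, c i = 0,
      forall i j, ta j (th i) = A i j
    & \dim (fullv : {vspace t}) = (n.*2 - \rank A)%N].

Definition even_space (V : lmodType F) : superspace F.
Proof.
exists V (fun b x => if b then 0 else x).
- by case=> *; rewrite ?scaler0 ?addr0.
- by case.
- by move=> x; rewrite addr0.
Defined.

Definition abelian_lie (V : lmodType F) : lieSuper F.
Proof.
by exists (even_space V) (fun _ _ => 0) => *; rewrite ?scaler0 ?oppr0 ?addr0 //; exact: homog0.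
Defined.

Definition line_space (p : bool) : superspace F.
Proof.
exists F^o (fun b x => if b == p then x else 0).
- by move=> b *; case: eqP; rewrite ?scaler0 ?addr0.
- by move=> b x; case: eqP.
- by case: p => x; rewrite /= ?addr0 ?add0r.
Defined.

(* The one-dimensional module of parity p on which t acts by +-ta i. *)
Definition line_mod (p s : bool) (i : 'I_n) : hmodule (abelian_lie t).
Proof.
exists (line_space p) (fun x v => ((-1) ^+ s * ta i x) *: v).
- by move=> c x y v /=; rewrite linearP mulrDr scalerDl mulrCA scalerA.
- by move=> c x v w /=; rewrite scalerDr !scalerA mulrC.
- move=> [] b x v hx hv /=.
    by rewrite -(hx : 0 = x) linear0 mulr0 scale0r; exact: homog0.
  exact: homogZ.
- move=> a b x y v hx hy /=; rewrite linear0 mulr0 scale0r !scalerA.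
  case: a hx => [/esym -> | _]; first by rewrite linear0 !(mulr0, mul0r, scale0r) subrr.
  by rewrite expr0 mul1r mulrC subrr.
Defined.

Definition km_datum : datum n := @Datum n (abelian_lie t) ta
  (fun s i => line_mod (A i i != 2) s i) (fun i u v => ((u : F) * (v : F)) *: th i).

End KacMoody.

Definition symmetrizable n (A : 'M[F]_n) : Prop :=
  exists d : 'I_n -> F, (forall i, d i != 0) /\
    forall i j, d i * A i j = d j * A j i.

Section TakiffSuperalgebra.
Variables (L : lieSuper F) (ob : option (inv_form L F^o)).
Definition tak_center : lmodType F := if ob is Some _ then F^o else 'rV[F]_0.
Definition tak_form : inv_form L tak_center :=
  match ob as o return inv_form L (if o is Some _ then F^o else 'rV[F]_0) with
  | Some B => B
  | None => zero_form L 'rV[F]_0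
  end.
(* T L, with the central element c omitted when no form is given. *)
Definition takiff : lieSuper F := tak_lie tak_form.
(* x (x) 1 + y (x) xi *)
Definition tak_tensor (x y : L) : takiff := tak_elt x y 0 0 0.
End TakiffSuperalgebra.

Section JS.
Variables (n : nat) (D : datum n) (ob : option (inv_form (galg D) F^o)).
Definition Js : set (takiff ob) :=
  [set u | forall k : 'I_n -> int, (exists i, k i != 0) ->
    forall x y, weight_space (@gh _ D) k x -> weight_space (@gh _ D) k y ->
    br u (tak_tensor ob x y) = 0].
End JS.

(* T s is built from a nondegenerate invariant form when A is symmetrizable,
   and without c otherwise. *)
Definition takiff_choice n (A : 'M[F]_n) (L : lieSuper F)
    (ob : option (inv_form L F^o)) : Prop :=
  if ob is Some B then symmetrizable A /\ nondegenerate B else ~ symmetrizable A.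

End CartanData.

Arguments JA {F n} D _.
Arguments Js {F n D} ob _.

(* Main.v *)
(* The odd part of h acts on the (1|1)-dimensional g_{alpha_i} by x e_i = eta_i(x) E_i,
   x E_i = phi_i(x) e_i.  Letting an odd x act on H_i = [E_i, f_i] gives
   x_ij phi_j = a_ij phi_i + alpha_j(c_i) eta_i, and when Y = 0 all alpha_j(c_i) vanish.
   So phi_i and phi_j are proportional along the edges of the Dynkin diagram; the diagram
   is connected, and rescaling the E_i makes all phi_i equal to one functional phi, whence
   X = A.

   The map e_i |-> e_i (x) 1, E_i |-> +- e_i (x) xi, f_i |-> f_i (x) 1, F_i |-> f_i (x) xi,
   x |-> sum_i alpha_i(x) b_i (x) 1 + sum_i eta_i(x) b_i (x) xi + phi(x) d/dxi, for b_i dual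
   to the simple roots of s, then respects all relations modulo J_s.  It kills the maximal
   ideal of g~ because s has no singular vectors in n_+ and n_-, its kernel in g is J_A
   because the kernel meets n_+ and n_- in ideals that avoid h, and it is onto the root
   spaces since it hits the generators of n_+ (x) C[xi] and n_- (x) C[xi].  Here one needs
   e_i <> 0 in s, which comes from [e_i, f_i] <> 0 in g, read off from the root types. *)
Require Import Defs.
From HB Require Import structures.
From mathcomp Require Import all_boot all_order all_algebra.
From mathcomp Require Import boolp classical_sets reals complex.
From mathcomp Require Import ring.

Set Implicit Arguments.
Unset Strict Implicit.
Unset Printing Implicit Defensive.

Import Order.TTheory GRing.Theory Num.Theory.
Local Open Scope ring_scope.
Local Open Scope classical_set_scope.

(** * Lie superalgebras, quotients and free objects *)

(** Heights replace root spaces for most of the argument: an even [r] with all [alpha_i(r) = 1] acts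
    by the height, and subspaces stable under h split along this grading. This is proved once, for
    generators satisfying a few axioms, because it is applied to g~ and to g, both for the given
    datum and for the datum of s.

    The odd part of h acts on g_alpha through a Clifford algebra, [xy + yx = alpha([x, y])]. Rank
    two and irreducibility force a basis e, E on which both off-diagonal matrix units occur as
    actions of odd elements, so identities in [eta_i] and [phi_i] can be tested separately.

    J_s refers to all root spaces, but annihilating the simple root vectors tensored with C[xi] is
    enough, since what a homogeneous element annihilates is closed under brackets. Hence J_s
    contains c, z and every toral x (x) 1 + y (x) xi such that all roots vanish on x and y. Each
    relation among toral elements becomes an equality of root values, and the c-terms drop out. *)

Section GradedSubspaces.
Variables (F : fieldType) (V : superspace F) (U : set V).
Hypothesis gU : graded_subspace U.

Lemma gsub0 : U 0. Proof. by case: gU. Qed.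
Lemma gsubD x y : U x -> U y -> U (x + y).
Proof. by case: gU => _ H _ ux uy; rewrite -[x]scale1r; apply: H. Qed.
Lemma gsubZ c x : U x -> U (c *: x).
Proof. by case: gU => u0 H _ ux; rewrite -[_ *: _]addr0; apply: H. Qed.
Lemma gsubN x : U x -> U (- x).
Proof. by rewrite -scaleN1r; apply: gsubZ. Qed.
Lemma gsub_spr b x : U x -> U (spr b x). Proof. by case: gU => _ _; apply. Qed.
Lemma gsub_sum (I : Type) (r : seq I) (P : pred I) (f : I -> V) :
  (forall i, P i -> U (f i)) -> U (\sum_(i <- r | P i) f i).
Proof. by move=> H; elim/big_rec: _ => [|i x Pi ux]; [exact: gsub0 | apply: gsubD; auto]. Qed.
End GradedSubspaces.

Section LieSuperLemmas.
Variables (F : fieldType) (L : lieSuper F).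
Implicit Types (x y z : L) (U I : set L).

Lemma br_sumr (I : Type) (r : seq I) (P : pred I) (f : I -> L) x :
  br x (\sum_(i <- r | P i) f i) = \sum_(i <- r | P i) br x (f i).
Proof. by elim/big_rec2: _ => [|i a b _ <-]; rewrite ?br0r ?brDr. Qed.
Lemma br_suml (I : Type) (r : seq I) (P : pred I) (f : I -> L) x :
  br (\sum_(i <- r | P i) f i) x = \sum_(i <- r | P i) br (f i) x.
Proof. by elim/big_rec2: _ => [|i a b _ <-]; rewrite ?br0l ?brDl. Qed.

Lemma ideal_br_l I x y : lie_ideal I -> I x -> I (br x y).
Proof.
move=> [gI idI] Ix; rewrite -[x]spr_sum brDl -[y]spr_sum !brDr.
have H a b : I (br (spr a x) (spr b y)).
  rewrite (br_skew (homog_spr a x) (homog_spr b y)).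
  by apply: gsubN => //; apply: gsubZ => //; apply: idI; apply: gsub_spr.
by do !apply: (gsubD gI).
Qed.

(** Thanks to this, stability of [U] under all brackets can be tested on generators. The stabilizer
    is graded because, for homogeneous [x], the bracket of a component of [y] with [x] is a
    component of [[y, x]]. *)
Lemma stabilizer_subalgebra U : graded_subspace U ->
  subalgebra [set y | forall x, U x -> U (br y x)].
Proof.
move=> gU; have spr_stab b y : (forall x, U x -> U (br y x)) ->
    forall x, U x -> U (br (spr b y) x).
  move=> H x ux; rewrite -[x]spr_sum brDr.
  have -> : br (spr b y) (spr false x) = spr b (br y (spr false x)).
    by rewrite spr_br !spr_spr; case: b => /=; rewrite ?br0r ?addr0 ?add0r.
  have -> : br (spr b y) (spr true x) = spr (~~ b) (br y (spr true x)).
    by rewrite spr_br !spr_spr; case: b => /=; rewrite ?br0r ?addr0 ?add0r.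
  by apply: gsubD => //; apply: gsub_spr => //; apply: H; apply: gsub_spr.
split=> /= [|x y Hx Hy z uz]; first split=> /=.
- by move=> x _; rewrite br0l; apply: gsub0.
- move=> c x y Hx Hy z uz; rewrite br_linl; apply: gsubD => //; last exact: Hy.
  by apply: gsubZ => //; apply: Hx.
- by move=> b y H; apply: spr_stab.
have J a b : U (br (br (spr a x) (spr b y)) z).
  have -> : br (br (spr a x) (spr b y)) z = br (spr a x) (br (spr b y) z)
      - (-1) ^+ (a && b) *: br (spr b y) (br (spr a x) z).
    by rewrite (br_jacobi z (homog_spr a x) (homog_spr b y)) addrK.
  apply: gsubD => //.
    by do 2!apply: (spr_stab) => //.
  apply: gsubN => //; apply: gsubZ => //; by do 2!apply: (spr_stab) => //.
rewrite -[x]spr_sum -[y]spr_sum !(brDl, brDr).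
by do !apply: (gsubD gU).
Qed.

Lemma spr_brl a c x y : spr c (br (spr a x) y) = br (spr a x) (spr (a (+) c) y).
Proof. by rewrite spr_br !spr_spr; case: a; case: c => /=; rewrite ?br0l ?addr0 ?add0r. Qed.

Lemma spr_brr a c x y : spr c (br x (spr a y)) = br (spr (a (+) c) x) (spr a y).
Proof. by rewrite spr_br !spr_spr; case: a; case: c => /=; rewrite ?br0r ?addr0 ?add0r. Qed.

(** The sign in skew-symmetry depends on both parities; as [y] is homogeneous, [[x, y] = 0] splits
    into the same equation for each component of [x]. *)
Lemma br_swap0 b x y : homog b y -> br x y = 0 -> br y x = 0.
Proof.
move=> hy e.
have H c : br (spr c x) y = 0.
  have := congr1 (spr (c (+) b)) e; rewrite spr_br spr0 -hy !spr_spr.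
  by case: c; case: b {hy} => /=; rewrite ?br0r ?addr0 ?add0r.
rewrite -[x]spr_sum brDr (br_skew hy (homog_spr _ x)) (br_skew hy (homog_spr true x)).
by rewrite !H !scaler0 !oppr0 addr0.
Qed.

End LieSuperLemmas.

Section Morphisms.
Variables (F : fieldType) (L M : lieSuper F) (f : L -> M).
Hypothesis mf : lie_morph f.
Lemma morph_lin c x y : f (c *: x + y) = c *: f x + f y. Proof. by case: mf. Qed.
Lemma morph_spr b x : f (spr b x) = spr b (f x). Proof. by case: mf. Qed.
Lemma morph_br x y : f (br x y) = br (f x) (f y). Proof. by case: mf. Qed.
Lemma morphD x y : f (x + y) = f x + f y.
Proof. by rewrite -[x in LHS]scale1r morph_lin scale1r. Qed.
Lemma morph0 : f 0 = 0.
Proof. by apply: (addrI (f 0)); rewrite -morphD !addr0. Qed.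
Lemma morphZ c x : f (c *: x) = c *: f x.
Proof. by rewrite -[c *: x]addr0 morph_lin morph0 addr0. Qed.
Lemma morphN x : f (- x) = - f x.
Proof. by rewrite -scaleN1r morphZ scaleN1r. Qed.
Lemma morphB x y : f (x - y) = f x - f y.
Proof. by rewrite morphD morphN. Qed.
Lemma morph_sum (I : Type) (r : seq I) (P : pred I) (g : I -> L) :
  f (\sum_(i <- r | P i) g i) = \sum_(i <- r | P i) f (g i).
Proof. by elim/big_rec2: _ => [|i a b _ <-]; rewrite ?morph0 ?morphD. Qed.

Lemma preim_ideal (I : set M) : lie_ideal I -> lie_ideal [set x | I (f x)].
Proof.
move=> [gI idI]; split=> /= [|x y]; last by rewrite morph_br; apply: idI.
split=> /= [|c x y ? ?|b x ?]; first by rewrite morph0; apply: gsub0.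
  by rewrite morph_lin; apply: gsubD => //; apply: gsubZ.
by rewrite morph_spr; apply: gsub_spr.
Qed.
Lemma preim_subalgebra (I : set M) : subalgebra I -> subalgebra [set x | I (f x)].
Proof.
move=> [gI idI]; split=> /= [|x y ? ?]; last by rewrite morph_br; apply: idI.
split=> /= [|c x y ? ?|b x ?]; first by rewrite morph0; apply: gsub0.
  by rewrite morph_lin; apply: gsubD => //; apply: gsubZ.
by rewrite morph_spr; apply: gsub_spr.
Qed.
Lemma zero_ideal : lie_ideal [set 0 : M].
Proof.
split=> /= [|x y ->]; last by rewrite br0r.
by split=> //= [c x y -> ->|b x ->]; rewrite ?scaler0 ?addr0 ?spr0.
Qed.
Lemma kernel_ideal : lie_ideal [set x | f x = 0].
Proof. exact: (preim_ideal zero_ideal). Qed.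
Lemma ideal_subalgebra (I : set L) : lie_ideal I -> subalgebra I.
Proof. by move=> [gI idI]; split=> // x y _; apply: idI. Qed.
End Morphisms.

Section QuotientLemmas.
Variables (F : fieldType) (L : lieSuper F) (S : set L).
Let P := lq_pre S.

Lemma lie_pi_surj (x : lie_quot S) : exists y, x = lie_pi S y.
Proof. by exists (pa_repr (P := P) x); rewrite /lie_pi (pa_piK (P := P)). Qed.

Lemma lie_pi_eq x y : lie_pi S x = lie_pi S y <-> ideal_gen S (x - y).
Proof. exact: (pa_piP (P := P)). Qed.

Lemma lie_pi_morph : lie_morph (lie_pi S).
Proof.
split.
- by move=> c x y; rewrite [LHS](pa_piD (P := P)) (pa_piZ (P := P)).
- move=> b x; apply/(pa_piP (P := P)); rewrite /= /lq_rel -sprB.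
  case: (ideal_genP S) => gI _; apply: (gsub_spr gI).
  by apply/lie_pi_eq; rewrite [RHS](pa_piK (P := P)).
- by move=> x y; rewrite [RHS](pqBE (P := P)).
Qed.

Lemma lie_pi_eq0 x : lie_pi S x = 0 <-> ideal_gen S x.
Proof. by rewrite -(morph0 lie_pi_morph) lie_pi_eq subr0. Qed.

Lemma ideal_gen_sub : S `<=` ideal_gen S.
Proof. by move=> x Sx I _; apply. Qed.

Lemma ideal_gen_id : lie_ideal S -> ideal_gen S = S.
Proof. by move=> idS; rewrite eqEsubset; split=> [x|]; [apply | exact: ideal_gen_sub]. Qed.

Lemma lie_quot_lift (M : lieSuper F) (f : L -> M) :
  lie_morph f -> (forall x, S x -> f x = 0) ->
  exists2 f' : lie_quot S -> M, lie_morph f' & forall x, f' (lie_pi S x) = f x.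
Proof.
move=> mf fS; pose f' (x : lie_quot S) := f (pa_repr (P := P) x).
have f'E x : f' (lie_pi S x) = f x.
  apply/eqP; rewrite -subr_eq0 -(morphB mf); apply/eqP.
  have : ideal_gen S (pa_repr (P := P) (lie_pi S x) - x) by exact: (pa_reprK (P := P)).
  by move=> /(_ _ (kernel_ideal mf) fS).
exists f' => //; split.
- move=> c x y; have [x' ->] := lie_pi_surj x; have [y' ->] := lie_pi_surj y.
  by rewrite -(morph_lin lie_pi_morph) !f'E (morph_lin mf).
- move=> b x; have [x' ->] := lie_pi_surj x.
  by rewrite -(morph_spr lie_pi_morph) !f'E (morph_spr mf).
- move=> x y; have [x' ->] := lie_pi_surj x; have [y' ->] := lie_pi_surj y.
  by rewrite -(morph_br lie_pi_morph) !f'E (morph_br mf).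
Qed.
End QuotientLemmas.

(** * Universal property of the free Lie superalgebra *)

Section FreeLift.
Variables (F : fieldType) (I : Type) (W : I -> superspace F).

Let P := free_pre W.
Let pi (t : lterm W) : free_lie W := pa_pi (P := P) t.

Lemma free_lie_ind (U : set (free_lie W)) : subalgebra U ->
  (forall i (w : W i), U (free_gen w)) -> forall x, U x.
Proof.
move=> [gU bU] H; elim/(@pa_W _ P); elim=> [i w||s IHs t IHt|c t IHt|s IHs t IHt].
- exact: H.
- by rewrite (pa_pi0 P); apply: (gsub0 gU).
- by rewrite (pa_piD (P := P)); apply: (gsubD gU).
- by rewrite (pa_piZ (P := P)); apply: (gsubZ gU).
- have -> : pa_pi (P := P) (TBr s t) = br (pi s) (pi t) by rewrite [RHS](pqBE (P := P)).
  exact: bU.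
Qed.

Lemma free_gen_lin i c (v w : W i) :
  free_gen (c *: v + w) = c *: free_gen v + free_gen w.
Proof.
rewrite /free_gen -(pa_piZ (P := P)) -(pa_piD (P := P)).
by apply/(pa_piP (P := P)); exact: teq_gen.
Qed.

Variables (M : lieSuper F) (f : forall i, W i -> M).
Hypothesis f_lin : forall i c (v w : W i), f (c *: v + w) = c *: f v + f w.
Hypothesis f_spr : forall i b (v : W i), f (spr b v) = spr b (f v).

Fixpoint tev (t : lterm W) : M :=
  match t with
  | TGen i w => f w
  | TZero => 0
  | TAdd s t => tev s + tev t
  | TScale c t => c *: tev t
  | TBr s t => br (tev s) (tev t)
  end.

Lemma tev_tpr b t : tev (tpr b t) = spr b (tev t).
Proof.
elim: t b => [i w||s IHs t IHt|c t IHt|s IHs t IHt] b /=.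
- exact: f_spr.
- by rewrite spr0.
- by rewrite IHs IHt sprD.
- by rewrite IHt sprZ.
- by rewrite !IHs !IHt spr_br.
Qed.

Lemma tev_teq s t : teq s t -> tev s = tev t.
Proof.
elim=> {s t} //=.
- by move=> s t u _ -> _ ->.
- by move=> s s' t t' _ -> _ ->.
- by move=> c s s' _ ->.
- by move=> s s' t t' _ -> _ ->.
- by move=> s t u; rewrite addrA.
- by move=> s t; rewrite addrC.
- by move=> t; rewrite add0r.
- by move=> t; rewrite scaleN1r addNr.
- by move=> a b t; rewrite scalerA.
- by move=> t; rewrite scale1r.
- by move=> a s t; rewrite scalerDr.
- by move=> a b t; rewrite scalerDl.
- by move=> c s t u; rewrite br_linl.
- by move=> c s t u; rewrite br_linr.
- move=> a b s t; rewrite !tev_tpr.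
  by rewrite (br_skew (homog_spr a _) (homog_spr b _)) scaleNr.
- by move=> a b s t u; rewrite !tev_tpr (br_jacobi _ (homog_spr a _) (homog_spr b _)).
Qed.

Lemma free_lift : exists2 f' : free_lie W -> M, lie_morph f' &
  forall i (w : W i), f' (free_gen w) = f w.
Proof.
pose f' (x : free_lie W) : M := tev (pa_repr (P := P) x).
have f'E t : f' (pi t) = tev t by apply/tev_teq/(pa_reprK (P := P)).
have piK (x : free_lie W) : x = pi (pa_repr (P := P) x) by rewrite /pi (pa_piK (P := P)).
exists f'; last by move=> i w; rewrite f'E.
split.
- move=> c x y; rewrite {1}(piK x) {1}(piK y).
  by rewrite /pi -(pa_piZ (P := P)) -(pa_piD (P := P)) [LHS]f'E.
- by move=> b x; rewrite [LHS]f'E tev_tpr.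
- by move=> x y; rewrite [LHS]f'E.
Qed.
End FreeLift.

(** * Triangular decomposition and contragredient algebras *)

Section JacobiLemmas.
Variables (F : fieldType) (L : lieSuper F).

Lemma jacobi_even (x y z : L) : homog false x ->
  br x (br y z) = br (br x y) z + br y (br x z).
Proof.
move=> hx; have J b : br x (br (spr b y) z) =
    br (br x (spr b y)) z + br (spr b y) (br x z).
  by rewrite (br_jacobi z hx (homog_spr b y)) scale1r.
by rewrite -[y]spr_sum !(brDl, brDr) !J addrACA.
Qed.

(** Membership in a subspace does not see signs, so the Jacobi identity can be used for
    inhomogeneous [x] and [y] once both terms are controlled for all their components. *)
Lemma jacobi_in (U : set L) (x y z : L) : graded_subspace U ->
  (forall a b, U (br (br (spr a x) (spr b y)) z)) ->
  (forall a b, U (br (spr b y) (br (spr a x) z))) -> U (br x (br y z)).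
Proof.
move=> gU H1 H2.
have H a b : U (br (spr a x) (br (spr b y) z)).
  rewrite (br_jacobi z (homog_spr a x) (homog_spr b y)).
  by apply: gsubD => //; apply: gsubZ.
rewrite -[x]spr_sum -[y]spr_sum !(brDl, brDr).
by do !apply: (gsubD gU).
Qed.
End JacobiLemmas.

(** * The grading by height of a contragredient algebra *)

Section ContragredientSystems.
Variables (F : numClosedFieldType) (n : nat) (D : datum F n).

(** These are the properties shared by a Cartan datum and by [km_datum] on which the triangular
    decomposition rests; [w_dual] is the form in which linear independence of the simple roots is
    used. *)
Record weighted : Prop := Weighted {
  w_toral : quasi_toral (dh D);
  w_mod : forall s i (x : dh D) (v : dmod D s i), homog false x ->
    act x v = ((-1) ^+ s * dalpha D i x) *: v;
  w_dual : forall c : 'I_n -> F,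
    exists2 x : dh D, homog false x & forall i, dalpha D i x = c i }.

(** Common interface of g~ and its quotient g. Neither map is required to be injective, and brackets
    of opposite root vectors are only required to fall into h. *)
Record contra_sys (G : lieSuper F) := ContraSys {
  cs_h : dh D -> G;
  cs_root : forall s i, dmod D s i -> G;
  cs_h_lin : forall c x y, cs_h (c *: x + y) = c *: cs_h x + cs_h y;
  cs_root_lin : forall s i c (v w : dmod D s i),
    cs_root (c *: v + w) = c *: cs_root v + cs_root w;
  cs_h_spr : forall b x, cs_h (spr b x) = spr b (cs_h x);
  cs_root_spr : forall s i b (v : dmod D s i), cs_root (spr b v) = spr b (cs_root v);
  cs_h_br : forall x y, br (cs_h x) (cs_h y) = cs_h (br x y);
  cs_act : forall s i x (v : dmod D s i), br (cs_h x) (cs_root v) = cs_root (act x v);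
  cs_opp : forall s s' i j (v : dmod D s i) (w : dmod D s' j), s != s' ->
    exists y, br (cs_root v) (cs_root w) = cs_h y;
  cs_gen : forall U : set G, subalgebra U -> (forall x, U (cs_h x)) ->
    (forall s i (v : dmod D s i), U (cs_root v)) -> forall x, U x }.

Section Theory.
Variables (G : lieSuper F) (cs : contra_sys G).
Hypothesis wD : weighted.
Notation ch := (cs_h cs).
Notation cr := (cs_root cs).

Lemma cs_h0 : ch 0 = 0.
Proof. by have := cs_h_lin cs (-1) 0 0; rewrite scaler0 addr0 scaleN1r addNr. Qed.
Lemma cs_root0 s i : cr (0 : dmod D s i) = 0.
Proof. by have := cs_root_lin cs (-1) (0 : dmod D s i) 0; rewrite scaler0 addr0 scaleN1r addNr. Qed.
Lemma cs_rootZ s i c (v : dmod D s i) : cr (c *: v) = c *: cr v.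
Proof. by rewrite -[c *: v]addr0 cs_root_lin cs_root0 addr0. Qed.
Lemma cs_rootD s i (v w : dmod D s i) : cr (v + w) = cr v + cr w.
Proof. by rewrite -[v in LHS]scale1r cs_root_lin scale1r. Qed.
Lemma cs_hZ c x : ch (c *: x) = c *: ch x.
Proof. by rewrite -[c *: x]addr0 cs_h_lin cs_h0 addr0. Qed.
Lemma cs_hD x y : ch (x + y) = ch x + ch y.
Proof. by rewrite -[x in LHS]scale1r cs_h_lin scale1r. Qed.
Lemma cs_h_homog b x : homog b x -> homog b (ch x).
Proof. by rewrite /homog -cs_h_spr => ->. Qed.
Lemma cs_root_homog s i b (v : dmod D s i) : homog b v -> homog b (cr v).
Proof. by rewrite /homog -cs_root_spr => ->. Qed.

Lemma range_h_sub : graded_subspace (range ch).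
Proof.
split.
- by exists 0 => //; apply: cs_h0.
- by move=> c _ _ [x _ <-] [y _ <-]; exists (c *: x + y) => //; apply: cs_h_lin.
- by move=> b _ [x _ <-]; exists (spr b x) => //; apply: cs_h_spr.
Qed.

Lemma cs_act_r s i x (v : dmod D s i) : exists w : dmod D s i, br (cr v) (ch x) = cr w.
Proof.
have R : graded_subspace (range (@cs_root G cs s i)).
  split.
  - by exists 0 => //; apply: cs_root0.
  - by move=> c _ _ [u _ <-] [w _ <-]; exists (c *: u + w) => //; apply: cs_root_lin.
  - by move=> b _ [w _ <-]; exists (spr b w) => //; apply: cs_root_spr.
suff [w _ <-] : range (@cs_root G cs s i) (br (cr v) (ch x)) by exists w.
have H a b : range (@cs_root G cs s i) (br (cr (spr a v)) (ch (spr b x))).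
  rewrite (br_skew (cs_root_homog (homog_spr a v)) (cs_h_homog (homog_spr b x))) cs_act.
  by apply: (gsubN R); apply: (gsubZ R); exists (act (spr b x) (spr a v)).
rewrite -[v]spr_sum -[x]spr_sum cs_rootD cs_hD !(brDl, brDr).
by do !apply: (gsubD R).
Qed.

(* [npart s p] is the part of height [p + 1] of n_+ (s = false) or n_- (s = true). *)
Inductive npart (s : bool) : nat -> G -> Prop :=
| np_gen i (v : dmod D s i) : npart s 0 (cr v)
| np_br p i (v : dmod D s i) x : npart s p x -> npart s p.+1 (br (cr v) x)
| np_zero p : npart s p 0
| np_lin p c x y : npart s p x -> npart s p y -> npart s p (c *: x + y).

Lemma npart_sub s p : graded_subspace (npart s p).
Proof.
split; [exact: np_zero | by move=> *; apply: np_lin |].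
move=> b x Hx; elim: Hx b => {x p}.
- by move=> i v b; rewrite -cs_root_spr; apply: np_gen.
- move=> p i v x _ IH b; rewrite spr_br -!cs_root_spr -[X in X + _]scale1r.
  by apply: np_lin; apply: np_br.
- by move=> p b; rewrite spr0; apply: np_zero.
- by move=> p c x y _ IHx _ IHy b; rewrite spr_lin; apply: np_lin.
Qed.

Lemma npart_h s p x y : npart s p x -> npart s p (br (ch y) x).
Proof.
move=> Hx; elim: Hx y => {x p}.
- by move=> i v y; rewrite cs_act; apply: np_gen.
- move=> p i v x Hx IH y; apply: jacobi_in; first exact: npart_sub.
    by move=> a b; rewrite -cs_h_spr -cs_root_spr cs_act; apply: np_br.
  by move=> a b; rewrite -cs_h_spr -cs_root_spr; apply: np_br.
- by move=> p y; rewrite br0r; apply: np_zero.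
- by move=> p c x z _ IHx _ IHz y; rewrite br_linr; apply: np_lin.
Qed.

(** As [npart s p] has height [p + 1], this is the part of height [p], which is h for [p = 0]: the
    target of [npart s p] under an opposite simple root vector. *)
Definition npred (s : bool) (p : nat) : set G :=
  if p is p'.+1 then npart s p' else range ch.

Lemma npred_sub s p : graded_subspace (npred s p).
Proof. by case: p => [|p]; [exact: range_h_sub | exact: npart_sub]. Qed.

Lemma npred_br s p i (v : dmod D s i) x : npred s p x -> npart s p (br (cr v) x).
Proof.
case: p => [[y _ <-]|p /=]; last exact: np_br.
by have [w ->] := cs_act_r y v; apply: np_gen.
Qed.

(** Moving the opposite root vector past a factor leaves a commutator in h, which preserves height,
    and a shorter instance of the same claim. *)
Lemma npart_opp s s' p j (w : dmod D s' j) x :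
  npart s p x -> s' != s -> npred s p (br (cr w) x).
Proof.
move=> Hx ss'; elim: Hx w => {x p}.
- by move=> i v w; have [y ->] := cs_opp cs w v ss'; exists y.
- move=> p i v x Hx IH w; apply: jacobi_in; first exact: npred_sub.
    move=> a b; rewrite -!cs_root_spr; have [y ->] := cs_opp cs (spr a w) (spr b v) ss'.
    exact: npart_h.
  by move=> a b; rewrite -!cs_root_spr; apply: npred_br.
- by move=> p w; rewrite br0r; apply: gsub0; apply: npred_sub.
- move=> p c x z _ IHx _ IHz w; rewrite br_linr; have gU := npred_sub s p.
  by apply: (gsubD gU); [apply: (gsubZ gU); apply: IHx | apply: IHz].
Qed.

Lemma npart0P s x : npart s 0 x -> exists u : forall i, dmod D s i, x = \sum_i cr (u i).
Proof.
suff H p : npart s p x -> p = 0%N -> exists u : forall i, dmod D s i, x = \sum_i cr (u i).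
  by move=> /H; apply.
elim=> {x p}.
- move=> i v _; exists (fun j => if pselect (i = j) is left e
      then eq_rect i (fun k => dmod D s k) v j e else 0).
  rewrite (bigD1 i) //= big1 ?addr0.
    by case: pselect => // e; rewrite (Prop_irrelevance e (erefl i)).
  move=> j ji; case: pselect => [e|_]; last exact: cs_root0.
  by rewrite e eqxx in ji.
- by [].
- by move=> p _; exists (fun i => 0); rewrite big1 // => i _; apply: cs_root0.
- move=> p c x y _ IHx _ IHy e; have [u ->] := IHx e; have [v ->] := IHy e.
  exists (fun i => c *: u i + v i); rewrite scaler_sumr -big_split /=.
  by apply: eq_bigr => i _; rewrite cs_root_lin.
Qed.

Lemma npart_ind_root (U : set G) s : graded_subspace U ->
  (forall i (v : dmod D s i), U (cr v)) ->
  (forall i (v : dmod D s i) x, U x -> U (br (cr v) x)) ->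
  forall p x, npart s p x -> U x.
Proof.
move=> gU U0 U1 p x; elim=> {p x} *; [exact: U0 | exact: U1 | exact: (gsub0 gU) |].
by apply: (gsubD gU) => //; apply: (gsubZ gU).
Qed.

(** The part of degree [k] of the grading by height; [Negz p] is [-(p + 1)], so both signs meet the
    shifted indexing of [npart]. *)
Definition zpart (k : int) : set G :=
  match k with
  | Posz 0 => range ch
  | Posz p.+1 => npart false p
  | Negz p => npart true p
  end.

Lemma zpart_sub k : graded_subspace (zpart k).
Proof. by case: k => [[|p]|p]; [exact: range_h_sub | exact: npart_sub | exact: npart_sub]. Qed.

Lemma zpart_h k x y : zpart k x -> zpart k (br (ch y) x).
Proof.
case: k => [[|p]|p] /=; try exact: npart_h.
by case=> z _ <-; rewrite cs_h_br; exists (br y z).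
Qed.

Lemma zpart_root s k i (v : dmod D s i) x : zpart k x ->
  zpart (if s then k - 1 else k + 1) (br (cr v) x).
Proof.
case: k => [[|p]|p] /=.
- case=> y _ <-; have [w ->] := cs_act_r y v.
  by case: s v w => v w; apply: np_gen.
- case: s v => v Hx.
    have -> : Posz p.+1 - 1 = p by rewrite -addn1 PoszD addrK.
    by have := npart_opp v Hx isT; case: p Hx => [|p].
  have -> : Posz p.+1 + 1 = p.+2 by rewrite -PoszD addn1.
  exact: np_br.
- case: s v => v Hx.
    have -> : Negz p - 1 = Negz p.+1 by rewrite !NegzE -opprD -PoszD addn1.
    exact: np_br.
  have := npart_opp v Hx isT; case: p Hx => [|p] Hx; first by [].
  have -> : Negz p.+1 + 1 = Negz p by rewrite !NegzE -[p.+2]addn1 PoszD opprD subrK.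
  by [].
Qed.

Definition zspan (K : pred int) : set G :=
  [set x | exists (c : int -> G) (s : seq int),
    [/\ uniq s, all K s, forall k, zpart k (c k) & x = \sum_(k <- s) c k]].

Lemma zspan_in (K : pred int) k x : K k -> zpart k x -> zspan K x.
Proof.
move=> Kk zx; exists (fun j => if j == k then x else 0), [:: k].
split=> //=; [by rewrite Kk | | by rewrite big_seq1 eqxx].
by move=> j; case: eqP => [-> //|_]; apply: gsub0; apply: zpart_sub.
Qed.

Lemma zspan_sub K : graded_subspace (zspan K).
Proof.
split.
- exists (fun=> 0), [::]; split; rewrite ?big_nil //.
  by move=> k; apply: gsub0; apply: zpart_sub.
- move=> a x y [c [s [us Ks zc ->]]] [d [t [ut Kt zd ->]]].
  exists (fun k => a *: (if k \in s then c k else 0) + (if k \in t then d k else 0)).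
  exists (undup (s ++ t)); split; first exact: undup_uniq.
  + by apply/allP => k; rewrite mem_undup mem_cat => /orP[/(allP Ks)|/(allP Kt)].
  + move=> k; have gU := zpart_sub k; apply: (gsubD gU); first apply: (gsubZ gU).
      by case: ifP => _ //; apply: (gsub0 gU).
    by case: ifP => _ //; apply: (gsub0 gU).
  + rewrite big_split /= -scaler_sumr -!big_mkcond /=; congr (_ *: _ + _).
      rewrite -[RHS]big_filter; apply: perm_big; apply: uniq_perm => //.
        by apply: filter_uniq; apply: undup_uniq.
      by move=> k; rewrite mem_filter mem_undup mem_cat; case: (k \in s).
    rewrite -[RHS]big_filter; apply: perm_big; apply: uniq_perm => //.
      by apply: filter_uniq; apply: undup_uniq.
    by move=> k; rewrite mem_filter mem_undup mem_cat; case: (k \in t); rewrite ?orbT.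
- move=> b x [c [s [us Ks zc ->]]]; exists (fun k => spr b (c k)), s; split=> //.
    by move=> k; apply: gsub_spr => //; apply: zpart_sub.
  by elim/big_rec2: _ => [|k y1 y2 _ <-]; rewrite ?spr0 ?sprD.
Qed.

Lemma zspan_lin_ind (K : pred int) (U : set G) : graded_subspace U ->
  (forall k x, K k -> zpart k x -> U x) -> zspan K `<=` U.
Proof.
move=> gU H x [c [s [us /allP Ks zc ->]]].
by rewrite big_seq; apply: gsub_sum => // k /Ks Kk; apply: (H k).
Qed.

Lemma zspan_br (K K' : pred int) y :
  (forall k x, K k -> zpart k x -> zspan K' (br y x)) ->
  forall x, zspan K x -> zspan K' (br y x).
Proof.
move=> H x [c [s [us /allP Ks zc ->]]]; rewrite br_sumr big_seq.
by apply: (gsub_sum (zspan_sub K')) => k /Ks Kk; apply: (H k).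
Qed.

(** The elements that are sums of graded pieces and also preserve such sums form a subalgebra. It
    contains the generators, hence everything. *)
Lemma zspan_all x : zspan predT x.
Proof.
have gZ := zspan_sub predT.
pose St := [set y | forall x, zspan predT x -> zspan predT (br y x)].
have bU : subalgebra (zspan predT `&` St).
  have [gS bS] := stabilizer_subalgebra gZ.
  split; last by move=> a b [za sa] [zb sb]; split; [apply: sa | apply: bS].
  split; first by split; [apply: (gsub0 gZ) | apply: (gsub0 gS)].
    move=> a u v [? ?] [? ?]; split.
      by apply: (gsubD gZ) => //; apply: (gsubZ gZ).
    by apply: (gsubD gS) => //; apply: (gsubZ gS).
  by move=> b u [? ?]; split; [apply: (gsub_spr gZ) | apply: (gsub_spr gS)].
suff [] : (zspan predT `&` St) x by [].
apply: (@cs_gen G cs _ bU) => [y|s i v].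
- split; first by apply: (@zspan_in _ 0) => //; exists y.
  apply: zspan_br => k z _ zz; exact/(zspan_in (k := k))/zpart_h.
- split; last first.
    by apply: zspan_br => k z _ zz; apply: zspan_in (zpart_root v zz).
  by case: s v => v; [apply: (@zspan_in _ (Negz 0)) | apply: (@zspan_in _ 1)] => //; apply: np_gen.
Qed.

Lemma npart_eig s p (r : dh D) x : homog false r -> (forall i, dalpha D i r = 1) ->
  npart s p x -> br (ch r) x = ((-1) ^+ s * p.+1%:R) *: x.
Proof.
move=> hr r1; elim=> {x p}.
- by move=> i v; rewrite cs_act (w_mod wD) // r1 cs_rootZ.
- move=> p i v x Hx IH; rewrite jacobi_even; last exact: cs_h_homog.
  rewrite cs_act (w_mod wD) // r1 cs_rootZ brZl IH brZr -scalerDl.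
  by rewrite -mulrDr addrC natr1.
- by move=> p; rewrite br0r scaler0.
- by move=> p c x y _ IHx _ IHy; rewrite br_linr IHx IHy scalerDr !scalerA mulrC.
Qed.

Lemma zpart_eig k (r : dh D) x : homog false r -> (forall i, dalpha D i r = 1) ->
  zpart k x -> br (ch r) x = k%:~R *: x.
Proof.
move=> hr r1; case: k => [[|p]|p] /=.
- by case=> y _ <-; rewrite cs_h_br (w_toral wD) // cs_h0 scale0r.
- by move=> /(npart_eig hr r1) ->; rewrite mul1r.
- by move=> /(npart_eig hr r1) ->; rewrite mulN1r NegzE mulrNz.
Qed.

Lemma eigen_components (U : set G) (r : dh D) (c : int -> G) s :
  graded_subspace U -> (forall x, U x -> U (br (ch r) x)) ->
  (forall k, br (ch r) (c k) = k%:~R *: c k) ->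
  uniq s -> U (\sum_(k <- s) c k) -> forall k, k \in s -> U (c k).
Proof.
move=> gU rU; elim: s c => [|k s IH] c ec //= /andP[ks us]; rewrite big_cons => Ux.
have Us j : j \in s -> U (c j).
  move=> js; have kj : (j%:~R - k%:~R : F) != 0.
    by rewrite subr_eq0 eqr_int; apply: contraNneq ks => <-.
  rewrite -[c j](scalerK kj); apply: (gsubZ gU).
  apply: (IH (fun j => (j%:~R - k%:~R) *: c j)) => //.
    by move=> i; rewrite brZr ec !scalerA mulrC.
  have -> : \sum_(i <- s) (i%:~R - k%:~R) *: c i =
     br (ch r) (c k + \sum_(j <- s) c j) - k%:~R *: (c k + \sum_(j <- s) c j).
    rewrite brDr br_sumr ec scalerDr opprD addrACA subrr add0r scaler_sumr -sumrB.
    by apply: eq_bigr => i _; rewrite ec scalerBl.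
  by apply: (gsubD gU); [apply: rU | apply: (gsubN gU); apply: (gsubZ gU)].
move=> j; rewrite inE => /orP[/eqP ->|]; last exact: Us.
rewrite -[c k](addrK (\sum_(j <- s) c j)); apply: (gsubD gU) => //.
by apply: (gsubN gU); rewrite big_seq; apply: (gsub_sum gU).
Qed.

Lemma zspan_components (U : set G) K x : graded_subspace U ->
  (forall y z, U z -> U (br (ch y) z)) -> zspan K x -> U x ->
  exists (c : int -> G) s, [/\ uniq s, all K s, forall k, zpart k (c k),
    x = \sum_(k <- s) c k & forall k, k \in s -> U (c k)].
Proof.
move=> gU hU [c [s [us Ks zc ex]]] Ux; exists c, s; split=> //.
have [r hr r1] := w_dual wD (fun=> 1); apply: (@eigen_components U r) => //.
- exact: hU.
- by move=> k; apply: zpart_eig.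
- by rewrite -ex.
Qed.

(** This is the directness h and n_- + n_+ intersecting in 0, deduced from eigenvalues of the height
    element. *)
Lemma zspan_neq0_h x y : zspan [pred k | k != 0] x -> x = ch y -> x = 0.
Proof.
move=> [c [s [us Ks zc ex]]] ey.
have [r hr r1] := w_dual wD (fun=> 1).
(* Putting [- x] in degree 0 turns the two expressions of [x] into a decomposition of 0, whose
   components must all vanish. *)
pose d (k : int) := if k == 0 then - x else c k.
have s0 : 0 \notin s by apply/negP => /(allP Ks).
have sE : \sum_(k <- s) d k = x.
  rewrite ex; apply: eq_big_seq => k ks; rewrite /d; case: eqP => // k0.
  by rewrite -k0 ks in s0.
have d0 : d 0 = - x by rewrite /d eqxx.
apply: oppr_inj; rewrite oppr0 -d0.
apply: (@eigen_components [set 0] r d (0 :: s) (proj1 (zero_ideal G))).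
- by move=> _ ->; rewrite /= br0r.
- move=> k; rewrite /d; case: eqP => [->|_]; last exact: zpart_eig.
  by rewrite ey brNr cs_h_br (w_toral wD) // cs_h0 oppr0 scale0r.
- by rewrite /= s0.
- by rewrite big_cons d0 sE /= addNr.
- by rewrite inE eqxx.
Qed.

Lemma ideal_of_gens (U : set G) : graded_subspace U ->
  (forall y x, U x -> U (br (ch y) x)) ->
  (forall s i (v : dmod D s i) x, U x -> U (br (cr v) x)) -> lie_ideal U.
Proof.
move=> gU hU rU; split=> // x y Uy.
exact: (@cs_gen G cs _ (stabilizer_subalgebra gU) hU rU).
Qed.

End Theory.
End ContragredientSystems.

Section FreeParity.
Variables (F : fieldType) (I : Type) (W : I -> superspace F).
Let P := free_pre W.
Let q (t : lterm W) : free_lie W := pa_pi (P := P) t.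
Let qD s t : q (TAdd s t) = q s + q t. Proof. exact: (pa_piD (P := P)). Qed.
Let qZ c t : q (TScale c t) = c *: q t. Proof. exact: (pa_piZ (P := P)). Qed.
Let qB s t : q (TBr s t) = br (q s) (q t). Proof. by rewrite [RHS](pqBE (P := P)). Qed.
Let qP s t : teq s t -> q s = q t. Proof. by move=> /(pa_piP (P := P)). Qed.
Let qL i c (v w : W i) : q (TGen (c *: v + w)) = c *: q (TGen v) + q (TGen w).
Proof. exact: free_gen_lin. Qed.
Let q0 i : q (TGen (0 : W i)) = 0.
Proof. by have := qL (-1) (0 : W i) 0; rewrite scaler0 addr0 scaleN1r addNr. Qed.

Let q_tpr_tpr a b t : q (tpr a (tpr b t)) = if a == b then q (tpr a t) else 0.
Proof.
elim: t a b => [i w||s IHs t IHt|c t IHt|s IHs t IHt] a b /=.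
- by rewrite spr_spr; case: eqP => // _; rewrite q0.
- by case: eqP.
- by rewrite !qD IHs IHt; case: eqP; rewrite ?addr0.
- by rewrite !qZ IHt; case: eqP; rewrite ?scaler0.
- rewrite !(qD, qB) !IHs !IHt.
  by case: a; case: b; rewrite /= ?pqB0l ?pqB0r ?addr0 ?add0r.
Qed.

Let q_tpr b s t : teq s t -> q (tpr b s) = q (tpr b t).
Proof.
move=> e; elim: e b => {s t} //=.
- by move=> s t u _ IH1 _ IH2 b; rewrite IH1.
- by move=> s s' t t' _ IHs _ IHt b; rewrite !qD IHs IHt.
- by move=> c s s' _ IH b; rewrite !qZ IH.
- by move=> s s' t t' _ IHs _ IHt b; rewrite !(qD, qB) !IHs !IHt.
- by move=> s t u b; rewrite !qD addrA.
- by move=> s t b; rewrite !qD addrC.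
- by move=> t b; rewrite !qD add0r.
- by move=> t b; rewrite qD qZ scaleN1r addNr.
- by move=> a c t b; rewrite !qZ scalerA.
- by move=> t b; rewrite !qZ scale1r.
- by move=> a s t b; rewrite !(qD, qZ) scalerDr.
- by move=> a c t b; rewrite !(qD, qZ) scalerDl.
- by move=> c s t u b; rewrite !(qD, qZ, qB) !br_linl scalerDr addrACA.
- by move=> c s t u b; rewrite !(qD, qZ, qB) !br_linr scalerDr addrACA.
- by move=> i c v w b; rewrite !(qD, qZ) spr_lin qL.
- move=> a c s t b; rewrite !(qD, qZ, qB) !q_tpr_tpr.
  have := qP (teq_skew a c s t); rewrite qZ !qB.
  by case: a; case: c; case: b; rewrite /= ?pqB0l ?pqB0r ?addr0 ?add0r ?scaler0.
- move=> a c s t u b; rewrite !(qD, qZ, qB) !(brDl, brDr) !q_tpr_tpr.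
  have := qP (teq_jacobi a c s t (tpr b u)); have := qP (teq_jacobi a c s t (tpr (~~ b) u)).
  rewrite !(qD, qZ, qB).
  by case: a; case: c; case: b => /= J1 J2;
    do !rewrite ?pqB0l ?pqB0r ?addr0 ?add0r ?scaler0.
Qed.

(** The projection on the quotient is [tpr] applied to a chosen representative, so the point is that
    [tpr] respects [teq]. *)
Lemma free_gen_spr i b (w : W i) : free_gen (spr b w) = spr b (free_gen w).
Proof.
have e : teq (pa_repr (P := P) (free_gen w)) (TGen w) by exact: (pa_reprK (P := P)).
by rewrite -[RHS]/(q (tpr b (pa_repr (P := P) (free_gen w)))) (q_tpr b e).
Qed.
End FreeParity.

Lemma br_swap_in (F : fieldType) (L : lieSuper F) (U : set L) x y : graded_subspace U ->
  (forall a b, U (br (spr a x) (spr b y))) -> U (br y x).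
Proof.
move=> gU H; rewrite -[x]spr_sum -[y]spr_sum !(brDl, brDr).
have H' a b : U (br (spr b y) (spr a x)).
  by rewrite (br_skew (homog_spr b y) (homog_spr a x)); apply: (gsubN gU); apply: (gsubZ gU).
by do !apply: (gsubD gU).
Qed.

(** * The maximal ideal meeting h trivially *)

Section Contragredient.
Variables (F : numClosedFieldType) (n : nat) (D : datum F n).

Definition gt_root s i (v : dmod D s i) : gtilde D := lie_pi (@contra_rel F n D) (fr_root v).

Let mpi := lie_pi_morph (@contra_rel F n D).

Let rel0 x : @contra_rel F n D x -> lie_pi (@contra_rel F n D) x = 0.
Proof. by move=> ?; apply/lie_pi_eq0; apply: ideal_gen_sub. Qed.

Lemma gt_act s i x (v : dmod D s i) : br (gt_h x) (gt_root v) = gt_root (act x v).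
Proof. by have := rel0 (contra_act x v); rewrite (morphB mpi) (morph_br mpi) => /subr0_eq. Qed.
Lemma gt_pair i (u : dmod D false i) (v : dmod D true i) :
  br (gt_root u) (gt_root v) = gt_h (dpair u v).
Proof. by have := rel0 (contra_pair u v); rewrite (morphB mpi) (morph_br mpi) => /subr0_eq. Qed.
Lemma gt_neq i j (u : dmod D false i) (v : dmod D true j) : i != j ->
  br (gt_root u) (gt_root v) = 0.
Proof. by move=> ij; have := rel0 (Defs.contra_neq u v ij); rewrite (morph_br mpi). Qed.

Let gt_h_lin c x y : gt_h (c *: x + y) = c *: gt_h x + gt_h y :> gtilde D.
Proof. by rewrite /gt_h /fr_h free_gen_lin (morph_lin mpi). Qed.
Let gt_h_spr b x : gt_h (spr b x) = spr b (gt_h x) :> gtilde D.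
Proof. by rewrite /gt_h /fr_h free_gen_spr (morph_spr mpi). Qed.
Let gt_root_lin s i c (v w : dmod D s i) :
  gt_root (c *: v + w) = c *: gt_root v + gt_root w.
Proof. by rewrite /gt_root /fr_root free_gen_lin (morph_lin mpi). Qed.
Let gt_root_spr s i b (v : dmod D s i) : gt_root (spr b v) = spr b (gt_root v).
Proof. by rewrite /gt_root /fr_root free_gen_spr (morph_spr mpi). Qed.

Let gt_opp s s' i j (v : dmod D s i) (w : dmod D s' j) : s != s' ->
  exists y, br (gt_root v) (gt_root w) = gt_h y.
Proof.
have gU : graded_subspace (range (@gt_h F n D)).
  have e0 : gt_h 0 = 0 :> gtilde D.
    by have := gt_h_lin (-1) 0 0; rewrite scaler0 addr0 scaleN1r addNr.
  split=> [|c _ _ [x _ <-] [y _ <-]|b _ [x _ <-]].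
  - by exists 0.
  - by exists (c *: x + y).
  - by exists (spr b x).
have H k l (u : dmod D false k) (u' : dmod D true l) :
    range (@gt_h F n D) (br (gt_root u) (gt_root u')).
  have [kl|kl] := eqVneq k l; last by rewrite gt_neq //; apply: (gsub0 gU).
  by case: l / kl u' => u'; rewrite gt_pair; exists (dpair u u').
suff : s != s' -> range (@gt_h F n D) (br (gt_root v) (gt_root w)).
  by move=> S /S[y _ <-]; exists y.
case: s v; case: s' w => // w v _.
by apply: br_swap_in => // a b; rewrite -!gt_root_spr.
Qed.

Definition gt_sys : contra_sys D (gtilde D).
Proof.
exists (@gt_h F n D) gt_root => //.
- by move=> x y; have := rel0 (contra_h x y); rewrite (morphB mpi) (morph_br mpi) => /subr0_eq.
- exact: gt_act.
- move=> U bU Uh Ur x; have [x' ->] := lie_pi_surj x.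
  by apply: (free_lie_ind (preim_subalgebra mpi bU)) => -[[s i]|] w; [apply: Ur | apply: Uh].
Defined.

Lemma gtilde_lift (M : lieSuper F) (fh : dh D -> M) (fr : forall s i, dmod D s i -> M) :
  (forall c x y, fh (c *: x + y) = c *: fh x + fh y) ->
  (forall b x, fh (spr b x) = spr b (fh x)) ->
  (forall s i c (v w : dmod D s i), fr s i (c *: v + w) = c *: fr s i v + fr s i w) ->
  (forall s i b (v : dmod D s i), fr s i (spr b v) = spr b (fr s i v)) ->
  (forall x y, br (fh x) (fh y) = fh (br x y)) ->
  (forall s i x (v : dmod D s i), br (fh x) (fr s i v) = fr s i (act x v)) ->
  (forall i (u : dmod D false i) (v : dmod D true i),
     br (fr _ i u) (fr _ i v) = fh (dpair u v)) ->
  (forall i j (u : dmod D false i) (v : dmod D true j), i != j ->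
     br (fr _ i u) (fr _ j v) = 0) ->
  exists f : gtilde D -> M, [/\ lie_morph f, forall x, f (gt_h x) = fh x
    & forall s i (v : dmod D s i), f (gt_root v) = fr s i v].
Proof.
move=> hl hs rl rs hh hr rr rn.
pose f0 (a : option (bool * 'I_n)) : dgen D a -> M :=
  match a with Some (s, i) => fr s i | None => fh end.
have [||f1 m1 e1] := @free_lift F _ (dgen D) M f0.
- by case=> [[s i]|]; [exact: rl | exact: hl].
- by case=> [[s i]|]; [exact: rs | exact: hs].
have eh x : f1 (fr_h x) = fh x by rewrite /fr_h e1.
have er s i (v : dmod D s i) : f1 (fr_root v) = fr s i v by rewrite /fr_root e1.
have [//||f m e] := @lie_quot_lift F _ (@contra_rel F n D) M f1.
  move=> x [] *; rewrite ?(morphB m1) (morph_br m1) ?eh ?er ?hh ?hr ?rr ?rn ?subrr //.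
by exists f; split=> // *; rewrite e.
Qed.

Hypothesis wD : weighted D.

Lemma sum_ideal (L : lieSuper F) (I J : set L) : lie_ideal I -> lie_ideal J ->
  lie_ideal [set x | exists y z, [/\ I y, J z & x = y + z]].
Proof.
move=> [gI bI] [gJ bJ]; split; first split.
- by exists 0, 0; rewrite addr0; split=> //; apply: gsub0.
- move=> c _ _ [y [z [Iy Jz ->]]] [y' [z' [Iy' Jz' ->]]].
  exists (c *: y + y'), (c *: z + z'); split; rewrite ?scalerDr 1?addrACA //.
    by apply: (gsubD gI) => //; apply: (gsubZ gI).
  by apply: (gsubD gJ) => //; apply: (gsubZ gJ).
- move=> b _ [y [z [Iy Jz ->]]]; exists (spr b y), (spr b z); rewrite sprD.
  by split=> //; [apply: (gsub_spr gI) | apply: (gsub_spr gJ)].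
- move=> x _ [y [z [Iy Jz ->]]]; exists (br x y), (br x z); rewrite brDr.
  by split=> //; [apply: bI | apply: bJ].
Qed.

(** An ideal contains the components of its elements, and those of degree 0 lie in h, where the
    ideal is trivial. *)
Lemma gt_ideal_zspan (I : set (gtilde D)) : lie_ideal I ->
  (forall y, I (gt_h y) -> gt_h y = 0) -> I `<=` zspan gt_sys [pred k | k != 0].
Proof.
move=> [gI bI] I0 x Ix.
have [|c [s [us _ zc -> Ic]]] := zspan_components (cs := gt_sys) wD gI _ (zspan_all _ x) Ix.
  by move=> y z; apply: bI.
rewrite big_seq; apply: (gsub_sum (zspan_sub gt_sys _)) => k /Ic Ik.
have [k0|k0] := eqVneq k 0; last by apply: (zspan_in (k := k)) => //=.
move: (zc k) Ik; rewrite k0 => -[y _ <-] /I0 /= ->.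
exact: gsub0 (zspan_sub _ _).
Qed.

Lemma zspan_gt_h y : zspan gt_sys [pred k | k != 0] (gt_h y) -> gt_h y = 0.
Proof. by move=> z; apply: (zspan_neq0_h (cs := gt_sys) wD z (y := y)). Qed.

(** Two ideals avoiding h both lie in n_- + n_+, hence so does their sum, which therefore avoids h
    as well. The union is thus closed under addition, and generating an ideal from it adds
    nothing. *)
Lemma gt_max_ideal : lie_ideal (@Defs.gt_max F n D).
Proof.
split; first split.
- exists [set 0]; split=> //; exact: zero_ideal.
- move=> c x y [I [idI I0 Ix]] [J [idJ J0 Jy]].
  exists [set x | exists y z, [/\ I y, J z & x = y + z]]; split.
  + exact: sum_ideal.
  + move=> z [u [v [Iu Jv e]]]; apply: zspan_gt_h; rewrite e.
    apply: (gsubD (zspan_sub _ _)); first exact: gt_ideal_zspan I0 _ _.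
    exact: gt_ideal_zspan J0 _ _.
  + by exists (c *: x), y; split=> //; apply: gsubZ => //; case: idI.
- by move=> b x [I [idI I0 Ix]]; exists I; split=> //; apply: gsub_spr => //; case: idI.
- by move=> x y [I [idI I0 Iy]]; exists I; split=> //; case: idI => _; apply.
Qed.

Let mq := lie_pi_morph (@Defs.gt_max F n D).

Lemma galg_pi_eq0 x : lie_pi (@Defs.gt_max F n D) x = 0 <-> Defs.gt_max x.
Proof. by rewrite lie_pi_eq0 ideal_gen_id //; apply: gt_max_ideal. Qed.

Lemma gh_eq0 (x : dh D) : gh x = 0 -> gt_h x = 0.
Proof. by move=> /galg_pi_eq0[I [_ I0 Ix]]; apply: I0. Qed.

Definition galg_sys : contra_sys D (galg D).
Proof.
exists (@gh F n D) (@groot F n D).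
- by move=> c x y; rewrite /gh gt_h_lin (morph_lin mq).
- by move=> s i c v w; rewrite -(morph_lin mq) -gt_root_lin.
- by move=> b x; rewrite /gh gt_h_spr (morph_spr mq).
- by move=> s i b v; rewrite -(morph_spr mq) -gt_root_spr.
- by move=> x y; rewrite /gh -(morph_br mq) [br _ _](cs_h_br gt_sys).
- by move=> s i x v; rewrite /gh /groot -(morph_br mq) [br _ _](cs_act gt_sys).
- move=> s s' i j v w ss'; have [y e] := cs_opp gt_sys v w ss'.
  by exists y; rewrite /groot -(morph_br mq) [br _ _]e.
- move=> U bU Uh Ur x; have [x' ->] := lie_pi_surj x.
  by apply: (@cs_gen _ _ _ _ gt_sys _ (preim_subalgebra mq bU)).
Defined.

(** The preimage in g~ meets h trivially, so it lies in the maximal ideal that was divided out. *)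
Lemma galg_ideal0 (I : set (galg D)) : lie_ideal I ->
  I `<=` zspan galg_sys [pred k | k != 0] -> forall x, I x -> x = 0.
Proof.
move=> idI Iz x; have [y ->] := lie_pi_surj x => Iy; apply/galg_pi_eq0.
exists [set z | I (lie_pi (@Defs.gt_max F n D) z)]; split=> //; first exact: preim_ideal.
move=> z /Iz /= H; apply: gh_eq0.
exact: (zspan_neq0_h (cs := galg_sys) wD H (y := z)).
Qed.

(** * Singular vectors *)

Section Singular.
Variable s : bool.

Definition singular (x : galg D) : Prop := exists2 p, npart galg_sys s p x &
  forall j (w : dmod D (~~ s) j), br (groot w) x = 0.

Inductive sing_gen : galg D -> Prop :=
| sg_in x : singular x -> sing_gen x
| sg_zero : sing_gen 0
| sg_lin c x y : sing_gen x -> sing_gen y -> sing_gen (c *: x + y)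
| sg_br i (v : dmod D s i) x : sing_gen x -> sing_gen (br (groot v) x).

Lemma singular_spr b x : singular x -> singular (spr b x).
Proof.
move=> [p px H]; exists p; first exact: gsub_spr (npart_sub _ _ _) _ _ px.
move=> j w; rewrite -[w]spr_sum [groot _](cs_rootD galg_sys) brDl.
have E a : br (groot (spr a w)) (spr b x) = 0.
  have -> : b = a (+) (a (+) b) by rewrite addbA addbb.
  by rewrite [groot _](cs_root_spr galg_sys) -spr_brl -(cs_root_spr galg_sys) [br _ _]H spr0.
by rewrite !E addr0.
Qed.

Lemma singular_h y x : singular x -> singular (br (gh y) x).
Proof.
move=> [p px H]; exists p; first exact: (npart_h (cs := galg_sys)).
move=> j w; apply: (jacobi_in (U := [set 0]) (proj1 (zero_ideal _))) => a b.
  rewrite -(cs_root_spr galg_sys) -(cs_h_spr galg_sys).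
  by have [w' ->] := cs_act_r galg_sys (spr b y) (spr a w); apply: H.
by rewrite -(cs_root_spr galg_sys) [br (cs_root _ _) _]H br0r.
Qed.

Lemma sing_gen_sub : graded_subspace sing_gen.
Proof.
split; [exact: sg_zero | by move=> *; apply: sg_lin |].
move=> b x Hx; elim: Hx b => {x}.
- by move=> x Hx b; apply/sg_in/singular_spr.
- by move=> b; rewrite spr0; apply: sg_zero.
- by move=> c x y _ IHx _ IHy b; rewrite spr_lin; apply: sg_lin.
- move=> i v x _ IH b; rewrite spr_br -!(cs_root_spr galg_sys) -[X in X + _]scale1r.
  by apply: sg_lin; apply: sg_br.
Qed.

Lemma sing_gen_h y x : sing_gen x -> sing_gen (br (gh y) x).
Proof.
move=> Hx; elim: Hx y => {x}.
- by move=> x Hx y; apply/sg_in/singular_h.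
- by move=> y; rewrite br0r; apply: sg_zero.
- by move=> c x z _ IHx _ IHz y; rewrite br_linr; apply: sg_lin.
- move=> i v x Hx IH y; apply: jacobi_in; first exact: sing_gen_sub.
    move=> a b; rewrite -(cs_h_spr galg_sys) -(cs_root_spr galg_sys) (cs_act galg_sys).
    exact: sg_br.
  by move=> a b; rewrite -(cs_h_spr galg_sys) -(cs_root_spr galg_sys); apply/sg_br/IH.
Qed.

Lemma sing_gen_opp j (w : dmod D (~~ s) j) x : sing_gen x -> sing_gen (br (groot w) x).
Proof.
move=> Hx; elim: Hx j w => {x}.
- by move=> x [p _ H] j w; rewrite H; apply: sg_zero.
- by move=> j w; rewrite br0r; apply: sg_zero.
- by move=> c x z _ IHx _ IHz j w; rewrite br_linr; apply: sg_lin.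
- move=> i v x Hx IH j w; apply: jacobi_in; first exact: sing_gen_sub.
    move=> a b; rewrite -!(cs_root_spr galg_sys).
    have ss : ~~ s != s by case: s.
    by have [y ->] := cs_opp galg_sys (spr a w) (spr b v) ss; apply: sing_gen_h.
  by move=> a b; rewrite -!(cs_root_spr galg_sys); apply/sg_br/IH.
Qed.

(** Brackets of n_s with singular vectors already form an ideal: an opposite root vector moves
    inward, leaving commutators in h, which preserve singular vectors, until it reaches a singular
    vector and kills it. This ideal stays on one side of h, so it is zero in g. *)
Lemma singular0 x : singular x -> x = 0.
Proof.
move=> sx; apply: (@galg_ideal0 sing_gen); last exact: sg_in.
  apply: (ideal_of_gens (cs := galg_sys)); first exact: sing_gen_sub.
    by move=> y z; apply: sing_gen_h.
  move=> s' i v z Hz; have [e|e] := eqVneq s' s.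
    by subst s'; apply: sg_br.
  have {e} e : s' = ~~ s by case: s s' e {v Hz sx} => [] [].
  by subst s'; apply: sing_gen_opp.
pose K : pred int := fun k => if s then k < 0 else 0 < k.
suff H : sing_gen `<=` zspan galg_sys K.
  move=> y /H; apply: (zspan_lin_ind (zspan_sub _ _)) => k z Kk zz.
  by apply: (zspan_in (k := k)) => //; move: Kk; rewrite /K /= neq_lt; case: s => ->; rewrite ?orbT.
have gZ := zspan_sub galg_sys K.
move=> y; elim=> {y}.
- move=> y [p py _]; apply: (zspan_in (k := if s then Negz p else Posz p.+1)).
    by rewrite /K; case: s.
  by case: s py.
- exact: gsub0 gZ.
- by move=> c y z _ Iy _ Iz; apply: (gsubD gZ) => //; apply: (gsubZ gZ).
- move=> i v y _; apply: zspan_br => k z Kk zz; apply: zspan_in (zpart_root v zz).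
  move: Kk; rewrite /K; case: s => Kk.
    by apply: lt_trans Kk; rewrite ltrBlDr ltrDl.
  by apply: lt_trans Kk _; rewrite ltrDl.
Qed.
End Singular.
End Contragredient.

(** * The modules g_alpha and the coupling matrices *)

Section ModuleLemmas.
Variables (F : numClosedFieldType) (h : lieSuper F) (M : hmodule h).
Implicit Types (x y : h) (v w : M).
Lemma actDl x y v : act (x + y) v = act x v + act y v.
Proof. by rewrite -[x in LHS]scale1r act_linl scale1r. Qed.
Lemma actDr x v w : act x (v + w) = act x v + act x w.
Proof. by rewrite -[v in LHS]scale1r act_linr scale1r. Qed.
Lemma act0l v : act (0 : h) v = 0.
Proof. by apply: (addrI (act 0 v)); rewrite -actDl !addr0. Qed.
Lemma act0r x : act x (0 : M) = 0.
Proof. by apply: (addrI (act x 0)); rewrite -actDr !addr0. Qed.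
Lemma actZl c x v : act (c *: x) v = c *: act x v.
Proof. by rewrite -[c *: x]addr0 act_linl act0l addr0. Qed.
Lemma actZr c x v : act x (c *: v) = c *: act x v.
Proof. by rewrite -[c *: v]addr0 act_linr act0r addr0. Qed.
Lemma actNl x v : act (- x) v = - act x v.
Proof. by rewrite -scaleN1r actZl scaleN1r. Qed.
Lemma act_suml (I : Type) (r : seq I) (P : pred I) (f : I -> h) v :
  act (\sum_(i <- r | P i) f i) v = \sum_(i <- r | P i) act (f i) v.
Proof. by elim/big_rec2: _ => [|i a b _ <-]; rewrite ?act0l ?actDl. Qed.
Lemma spr_act b x v :
  spr b (act x v) = act (spr false x) (spr b v) + act (spr true x) (spr (~~ b) v).
Proof.
have H a c d : spr a (act (spr c x) (spr d v)) =
    if a == c (+) d then act (spr c x) (spr d v) else 0.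
  have := act_homog (homog_spr c x) (homog_spr d v).
  case: eqP => [->//|/eqP e /homog_oppo].
  by rewrite (_ : ~~ (c (+) d) = a) //; case: a c d e => [] [] [].
rewrite -{1}[x]spr_sum actDl sprD -{1 2}[v]spr_sum !actDr !sprD !H.
by case: b => /=; rewrite ?addr0 ?add0r.
Qed.
End ModuleLemmas.

(** * Symmetric forms of rank two on the odd part *)

Section RankTwo.
Variables (F : numClosedFieldType) (h : lieSuper F) (al : {scalar h}).

(** A basis of the odd part modulo the radical. The Gram matrix factors as [Q = C *m Rm] through
    dimension two; the rows of a left inverse [C'] of [C] give [a1] and [a2], and [c *m C] gives the
    coordinates of [ev c] modulo the radical. *)
Lemma rank2_frame : form_rank al 2 -> exists a1 a2 : h,
  [/\ homog true a1, homog true a2,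
      forall x, homog true x -> exists s1 s2, forall y, homog true y ->
        al (br (x - (s1 *: a1 + s2 *: a2)) y) = 0
    & forall s1 s2, (forall y, homog true y -> al (br (s1 *: a1 + s2 *: a2) y) = 0) ->
        s1 = 0 /\ s2 = 0].
Proof.
case=> m [e [he se fe]]; set Q := \matrix_(j, k) _ => rQ.
have [C [Rm [QE /row_fullP[C' CC]]]] :
    exists (C : 'M_(m, 2)) (Rm : 'M_(2, m)), Q = C *m Rm /\ row_full C.
  rewrite -rQ; exists (col_base Q), (row_base Q).
  by rewrite mulmx_base col_base_full.
have Rfree : row_free Rm.
  by rewrite -row_leq_rank; apply: leq_trans (mxrankM_maxr C Rm); rewrite -QE rQ.
pose ev (c : 'rV[F]_m) := \sum_j c 0 j *: e j.
have evD c d : ev (c + d) = ev c + ev d.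
  by rewrite /ev -big_split /=; apply: eq_bigr => j _; rewrite mxE scalerDl.
have evZ k c : ev (k *: c) = k *: ev c.
  by rewrite /ev scaler_sumr; apply: eq_bigr => j _; rewrite mxE scalerA.
have hev c : homog true (ev c).
  rewrite /ev; elim/big_rec: _ => [|j x _ hx]; first exact: homog0.
  by apply: homogD => //; apply: homogZ.
have evP x : homog true x -> exists c, x = ev c.
  move=> /se[c ->]; exists (\row_j c j); rewrite /ev.
  by apply: eq_bigr => j _; rewrite mxE.
have alQ c k : al (br (ev c) (e k)) = (c *m Q) 0 k.
  rewrite /ev br_suml linear_sum mxE; apply: eq_bigr => j _.
  by rewrite brZl linearZ mxE.
have alQ0 c : c *m Q = 0 -> forall y, homog true y -> al (br (ev c) y) = 0.
  move=> cQ y /se[d ->]; rewrite br_sumr linear_sum big1 // => k _.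
  by rewrite brZr linearZ /= alQ cQ mxE mulr0.
exists (ev (row 0 C')), (ev (row 1 C')); split=> //.
  move=> x /evP[c ->]; exists ((c *m C) 0 0), ((c *m C) 0 1).
  rewrite -!evZ -evD -[- _]scaleN1r -evZ -evD; apply: alQ0.
  have -> : (c *m C) 0 0 *: row 0 C' + (c *m C) 0 1 *: row 1 C' = c *m C *m C'.
    apply/rowP => j; rewrite [RHS]mxE big_ord_recl big_ord1 !mxE.
    by rewrite (_ : lift ord0 ord0 = 1) //; apply: val_inj.
  by rewrite scaleN1r mulmxBl QE !mulmxA -[c *m C *m C' *m C]mulmxA CC mulmx1 subrr.
move=> s1 s2 H; pose s : 'rV[F]_2 := \row_k (if k == 0 then s1 else s2).
have sE : s1 *: ev (row 0 C') + s2 *: ev (row 1 C') = ev (s *m C').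
  rewrite -!evZ -evD; congr ev; apply/rowP => j.
  rewrite [RHS]mxE big_ord_recl big_ord1 !mxE /=.
  by rewrite (_ : lift ord0 ord0 = 1) //; apply: val_inj.
suff s0 : s = 0.
  have := congr1 (fun u : 'rV[F]_2 => u 0 0) s0; have := congr1 (fun u : 'rV[F]_2 => u 0 1) s0.
  by rewrite !mxE /=.
have: s *m C' *m Q = 0.
  by apply/rowP => k; rewrite -alQ -sE mxE; apply: H.
rewrite QE mulmxA -[s *m C' *m C]mulmxA CC mulmx1.
by move=> sR; apply: (row_free_inj Rfree); rewrite mul0mx.
Qed.

(** Over an algebraically closed field a form in two variables has an isotropic vector [a]. Modulo
    the radical its orthogonal is the line through [a], so any [b] not orthogonal to [a] completes a
    basis. *)
Lemma isotropic_pair : (forall x, homog true x -> al x = 0) -> form_rank al 2 ->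
  exists a b : h, [/\ homog true a, homog true b, al (br a a) = 0, al (br a b) != 0
    & forall x, homog true x -> exists p q, forall y, homog true y ->
        al (br (x - (p *: a + q *: b)) y) = 0].
Proof.
move=> al1 /rank2_frame[a1 [a2 [h1 h2 sp nd]]].
have Qs x y : homog true x -> homog true y -> al (br x y) = al (br y x).
  by move=> hx hy; rewrite (br_skew hx hy) scaleN1r opprK.
have QD x y z : al (br (x + y) z) = al (br x z) + al (br y z) by rewrite brDl linearD.
have QZ c x z : al (br (c *: x) z) = c * al (br x z) by rewrite brZl linearZ.
have QDr x y z : al (br z (x + y)) = al (br z x) + al (br z y) by rewrite brDr linearD.
have QZr c x z : al (br z (c *: x)) = c * al (br z x) by rewrite brZr linearZ.
have [s1 [s2 [sn0 iso]]] : exists s1 s2, (s1 != 0) || (s2 != 0) /\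
    al (br (s1 *: a1 + s2 *: a2) (s1 *: a1 + s2 *: a2)) = 0.
  set q11 := al (br a1 a1); set q12 := al (br a1 a2); set q22 := al (br a2 a2).
  have [q0|q0] := eqVneq q11 0.
    exists 1, 0; rewrite oner_neq0; split=> //.
    by rewrite scale1r scale0r addr0.
  (* A root of [q11 X^2 + 2 q12 X + q22], the value of the form at [X a1 + a2]. *)
  exists ((- q12 + sqrtC (q12 ^+ 2 - q11 * q22)) / q11), 1.
  rewrite oner_neq0 orbT; split=> //.
  rewrite !(QD, QZ, QDr, QZr) !mul1r (Qs a2 a1) // -/q11 -/q12 -/q22.
  set r := sqrtC _; have rr : r * r = q12 ^+ 2 - q11 * q22 by rewrite -expr2 sqrtCK.
  suff -> : q22 = (q12 ^+ 2 - r * r) / q11 by field.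
  by rewrite rr; field.
set a := s1 *: a1 + s2 *: a2 in iso.
have ha : homog true a by apply: homogD; apply: homogZ.
have [b hb ab] : exists2 b, homog true b & al (br a b) != 0.
  apply: contrapT => nb; have [|z1 z2] := nd s1 s2.
    move=> y hy; apply/eqP; apply: contrapT => /negP ab; apply: nb; by exists y.
  by rewrite z1 z2 eqxx in sn0.
exists a, b; split=> // x hx.
(* The coefficient is chosen to make [y] orthogonal to [a], so that [y] is a multiple of [a] modulo
   the radical. *)
pose q := al (br a x) / al (br a b); pose y := x - q *: b.
have hy : homog true y by apply: homogD => //; apply: homogN; apply: homogZ.
have ay : al (br a y) = 0.
  by rewrite /y QDr -scaleNr QZr mulNr divfK // subrr.
have [y1 [y2 Hy]] := sp y hy.
pose l1 := al (br a a1); pose l2 := al (br a a2).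
have sl : s1 * l1 + s2 * l2 = 0 by rewrite -iso {2}/a QDr !QZr.
have yl : y1 * l1 + y2 * l2 = 0.
  have := Hy a ha; rewrite Qs //; last first.
    by apply: homogD => //; apply: homogN; apply: homogD; apply: homogZ.
  rewrite QDr ay add0r -scaleN1r QZr QDr !QZr mulN1r => /eqP.
  by rewrite oppr_eq0 => /eqP.
have ln0 : (l1 != 0) || (l2 != 0).
  apply: contraNT ab; rewrite negb_or !negbK => /andP[/eqP l10 /eqP l20].
  have [t1 [t2 /(_ a ha)]] := sp b hb; rewrite Qs //; last first.
    by apply: homogD => //; apply: homogN; apply: homogD; apply: homogZ.
  rewrite QDr -scaleN1r QZr QDr !QZr -/l1 -/l2 l10 l20 !mulr0 addr0 mulr0 addr0.
  by move=> ->.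
(* Both coordinate vectors are orthogonal to the nonzero vector [(l1, l2)] of the plane, hence
   proportional. *)
have sy : s1 * y2 = s2 * y1.
  apply/eqP; rewrite -subr_eq0; case/orP: ln0 => ln0; rewrite -(mulrI_eq0 _ (mulfI ln0)).
    apply/eqP; transitivity ((s1 * l1 + s2 * l2) * y2 - (y1 * l1 + y2 * l2) * s2); first by ring.
    by rewrite sl yl !mul0r subrr.
  apply/eqP; transitivity ((y1 * l1 + y2 * l2) * s1 - (s1 * l1 + s2 * l2) * y1); first by ring.
  by rewrite sl yl !mul0r subrr.
have [p [e1 e2]] : exists p, y1 = p * s1 /\ y2 = p * s2.
  have [s10|s10] := eqVneq s1 0.
    have s20 : s2 != 0 by move: sn0; rewrite s10 eqxx.
    exists (y2 / s2); rewrite divfK // s10 mulr0; split=> //.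
    move: sy; rewrite s10 mul0r => /esym/eqP; rewrite mulf_eq0 (negPf s20) /=.
    by move/eqP.
  exists (y1 / s1); rewrite divfK //; split=> //.
  by apply: (mulfI s10); rewrite sy; field.
exists p, q => z hz.
have -> : x - (p *: a + q *: b) = y - (y1 *: a1 + y2 *: a2).
  by rewrite /y /a e1 e2 scalerDr !scalerA opprD addrA addrAC.
exact: Hy.
Qed.
End RankTwo.

(** * Irreducible modules over the Clifford algebra of a rank-two form *)

Section IrreducibleModule.
Variables (F : numClosedFieldType) (h : lieSuper F) (M : hmodule h) (al : {scalar h}).
Hypothesis irrM : irreducible M.
Hypothesis al1 : forall x, homog true x -> al x = 0.
Hypothesis wM : forall x (v : M), homog false x -> act x v = al x *: v.

Lemma act_anticomm x y (v : M) : homog true x -> homog true y ->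
  act x (act y v) = al (br x y) *: v - act y (act x v).
Proof.
move=> hx hy; have := act_br v hx hy; rewrite (wM v (br_homog hx hy)) => ->.
by rewrite scaleN1r opprK addrK.
Qed.

(** An element of the radical squares to zero and anticommutes with the odd part, so its image is a
    submodule. Were it nonzero it would be the whole module, contradicting that the square is
    zero. *)
Lemma radical_act z (v : M) : homog true z ->
  (forall y, homog true y -> al (br z y) = 0) -> act z v = 0.
Proof.
move=> hz zr.
have zz (w : M) : act z (act z w) = 0.
  have := act_anticomm w hz hz; rewrite zr // scale0r sub0r => /eqP.
  by rewrite -addr_eq0 -mulr2n -scaler_nat scaler_eq0 pnatr_eq0 => /eqP.
apply: contrapT => /eqP zv.
have [_ irr] := irrM.
have E : range (@act _ _ M z) = setT.
  apply: irr; last by exists (act z v) => //; exists v.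
  split; first split.
  + by exists 0 => //; apply: act0r.
  + by move=> c _ _ [u _ <-] [w _ <-]; exists (c *: u + w) => //; apply: act_linr.
  + move=> b _ [u _ <-]; exists (spr (~~ b) u) => //.
    by rewrite spr_act (homog_oppo hz) act0l add0r (hz : spr true z = z).
  + move=> x _ [u _ <-]; have H c : range (@act _ _ M z) (act (spr c x) (act z u)).
      case: c; last first.
        rewrite (wM _ (homog_spr false x)); exists (al (spr false x) *: u) => //.
        exact: actZr.
      rewrite act_anticomm //; last exact: homog_spr.
      rewrite (br_skew (homog_spr true x) hz) linearN linearZ /= zr; last exact: homog_spr.
      rewrite mulr0 oppr0 scale0r sub0r -scaleN1r -actZr; by exists (-1 *: act (spr true x) u).
    rewrite -[x]spr_sum actDl; have [u1 _ <-] := H false; have [u2 _ <-] := H true.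
    by exists (u1 + u2) => //; apply: actDr.
have [w _ e1] : range (@act _ _ M z) v by rewrite E.
by rewrite -e1 zz eqxx in zv.
Qed.

(** In the basis [e], [E] the two odd elements act as the off-diagonal matrix units. *)
Definition clifford_pair (e E : M) : Prop :=
  (forall v, exists s t, v = s *: e + t *: E) /\
  exists x y, [/\ homog true x, homog true y,
    act x e = 0 /\ act x E = e & act y e = E /\ act y E = 0].

Lemma clifford_pair_sym e E : clifford_pair e E -> clifford_pair E e.
Proof.
move=> [sp [x [y [hx hy [xe xE] [ye yE]]]]]; split; last by exists y, x.
by move=> v; have [s [t ->]] := sp v; exists t, s; rewrite addrC.
Qed.

(** Modulo the radical, which acts by zero, the odd part is spanned by the isotropic pair [a], [b].
    If [a] kills [v0], then [v0] and [b v0] span a submodule, hence the whole module. *)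
Lemma irreducible_clifford_pair p (e E : M) : form_rank al 2 ->
  homog p e -> homog (~~ p) E -> e != 0 -> E != 0 -> clifford_pair e E.
Proof.
move=> rk he hE e0 E0.
have [a [b [ha hb aa ab sp]]] := isotropic_pair al1 rk.
have actab x (v : M) : homog true x ->
    exists p q, forall v : M, act x v = p *: act a v + q *: act b v.
  move=> hx; have [s [t H]] := sp x hx; exists s, t => w.
  rewrite -!actZl -actDl; apply/eqP; rewrite -subr_eq0 -actNl -actDl; apply/eqP.
  apply: radical_act => //; apply: homogD => //; apply: homogN.
  by apply: homogD; apply: homogZ.
have a2 (v : M) : act a (act a v) = 0.
  have := act_anticomm v ha ha; rewrite aa scale0r sub0r => /eqP.
  by rewrite -addr_eq0 -mulr2n -scaler_nat scaler_eq0 pnatr_eq0 => /eqP.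
have b2 (v : M) : act b (act b v) = (al (br b b) / 2) *: v.
  apply: (scalerI (_ : 2 != 0 :> F)); first by rewrite pnatr_eq0.
  rewrite scalerA mulrCA divff ?pnatr_eq0 // mulr1 scaler_nat mulr2n.
  by rewrite {1}(act_anticomm v hb hb) subrK.
(* As [a] squares to zero, either [e] or [a e] is a vector killed by [a]; in the second case its
   parity is that of [E], and the two basis vectors exchange their roles. *)
suff main c (v0 e' E' : M) : homog c v0 -> v0 != 0 -> act a v0 = 0 ->
    homog c e' -> homog (~~ c) E' -> e' != 0 -> E' != 0 -> clifford_pair e' E'.
  have [ae|ae] := eqVneq (act a e) 0; first exact: (main p e).
  apply: clifford_pair_sym; apply: (main (~~ p) (act a e)) => //.
    exact: (act_homog ha he).
  by rewrite negbK.
move=> hv v0n av he' hE' e'0 E'0.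
have abv : act a (act b v0) = al (br a b) *: v0.
  by rewrite act_anticomm // av act0r subr0.
have hbv : homog (~~ c) (act b v0) by have := act_homog hb hv.
pose U := [set w | exists s t, w = s *: v0 + t *: act b v0].
have UT : U = setT.
  have [_] := irrM; apply; last first.
    by exists v0 => //; exists 1, 0; rewrite scale1r scale0r addr0.
  split; first split.
  - by exists 0, 0; rewrite !scale0r addr0.
  - move=> k _ _ [s [t ->]] [s' [t' ->]]; exists (k * s + s'), (k * t + t').
    by rewrite !scalerDl scalerDr !scalerA addrACA.
  - move=> d _ [s [t ->]]; rewrite sprD !sprZ.
    have [ed|ed] := eqVneq d c.
      exists s, 0; rewrite ed (hv : spr c v0 = v0); congr (_ + _).
      by have := homog_oppo hbv; rewrite negbK => ->; rewrite scaler0 scale0r.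
    have {ed} -> : d = ~~ c by case: d c ed {hv he' hE' hbv} => [] [].
    exists 0, t; rewrite (hbv : spr _ _ = act b v0) (homog_oppo hv).
    by rewrite scaler0 scale0r.
  - move=> x _ [s [t ->]]; rewrite -[x]spr_sum actDl.
    rewrite (wM _ (homog_spr false x)); have [k [l ->]] := actab _ v0 (homog_spr true x).
    rewrite !actDr !actZr av abv b2.
    exists (al (spr false x) * s + k * t * al (br a b) + l * t * (al (br b b) / 2)).
    exists (al (spr false x) * t + l * s).
    by rewrite !scaler0 add0r !scalerDr !scalerDl !scalerA !mulrA; zmod_eq.
have sp0 w : exists s t, w = s *: v0 + t *: act b v0 by have : U w by rewrite UT.
have [s es] : exists s, e' = s *: v0.
  have [s [t est]] := sp0 e'; exists s; rewrite -(he' : spr c e' = e') est sprD !sprZ.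
  have := homog_oppo hbv; rewrite negbK => ->; rewrite scaler0 addr0.
  by rewrite (hv : spr c v0 = v0).
have [t et] : exists t, E' = t *: act b v0.
  have [s' [t est]] := sp0 E'; exists t; rewrite -(hE' : spr _ E' = E') est sprD !sprZ.
  by rewrite (homog_oppo hv) scaler0 add0r (hbv : spr _ _ = act b v0).
have s0 : s != 0 by apply: contraNneq e'0 => z; rewrite es z scale0r.
have t0 : t != 0 by apply: contraNneq E'0 => z; rewrite et z scale0r.
split.
  move=> w; have [s' [t' ->]] := sp0 w; exists (s' / s), (t' / t).
  by rewrite es et !scalerA !divfK.
pose Q := al (br a b); pose be := al (br b b) / 2.
(* Since [e' = s v0], [E' = t b v0], [a b v0 = Q v0] and [b] squares to [be], subtracting [be / Q]
   times [a] from [b] gives an operator killing [b v0]; the prefactors normalize the remaining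
   entries to 1. *)
exists ((s / (t * Q)) *: a), ((t / s) *: (b - (be / Q) *: a)); split.
- exact: homogZ.
- by apply: homogZ; apply: homogD => //; apply: homogN; apply: homogZ.
- rewrite !actZl es et !actZr av abv !scaler0 !scalerA; split=> //.
  by congr (_ *: _); field; rewrite ab t0.
- rewrite !actZl !actDl !actNl !actZl es et !actZr av abv b2 !scaler0 subr0 !scalerA -/Q -/be.
  split; first by congr (_ *: _); field.
  rewrite -scalerBl scalerA (_ : _ * _ = 0) ?scale0r //; field.
  by rewrite ab.
Qed.
End IrreducibleModule.

(** * Matrix entries of the action on simple root spaces *)

Section Frames.
Variables (F : numClosedFieldType) (n : nat) (D : datum F n).
Hypothesis hD : cartan_datum D.
Implicit Types (g : generators D) (x y : dh D).

(* [eta i] and [phi i] are the matrix entries of the action on g_{alpha_i} in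
   the basis (e_i, E_i). *)
Record frame g (p : 'I_n -> bool) (eta phi : 'I_n -> dh D -> F) : Prop := Frame {
  fr_he : forall i, homog (p i) (gen_e g i);
  fr_hE : forall i, homog (~~ p i) (gen_E g i);
  fr_hf : forall i, homog (p i) (gen_f g i);
  fr_hF : forall i, homog (~~ p i) (gen_F g i);
  fr_e0 : forall i, gen_e g i != 0;
  fr_E0 : forall i, gen_E g i != 0;
  fr_f0 : forall i, gen_f g i != 0;
  fr_F0 : forall i, gen_F g i != 0;
  fr_span : forall i (v : dmod D false i), exists s t, v = s *: gen_e g i + t *: gen_E g i;
  fr_spanN : forall i (v : dmod D true i), exists s t, v = s *: gen_f g i + t *: gen_F g i;
  fr_ae : forall i x, act x (gen_e g i) = dalpha D i x *: gen_e g i + eta i x *: gen_E g i;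
  fr_aE : forall i x, act x (gen_E g i) = dalpha D i x *: gen_E g i + phi i x *: gen_e g i;
  fr_af : forall i x, act x (gen_f g i) =
    - dalpha D i x *: gen_f g i - ((-1) ^+ p i * eta i x) *: gen_F g i;
  fr_aF : forall i x, act x (gen_F g i) =
    - dalpha D i x *: gen_F g i + ((-1) ^+ p i * phi i x) *: gen_f g i;
  fr_eta_lin : forall i c x y, eta i (c *: x + y) = c * eta i x + eta i y;
  fr_phi_lin : forall i c x y, phi i (c *: x + y) = c * phi i x + phi i y;
  fr_eta_even : forall i x, homog false x -> eta i x = 0;
  fr_phi_even : forall i x, homog false x -> phi i x = 0;
  fr_dual : forall i, exists a b, [/\ homog true a, homog true b,
    eta i a = 0 /\ phi i a = 1 & eta i b = 1 /\ phi i b = 0] }.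

Lemma homog_indep (V : superspace F) q (e E : V) (s t s' t' : F) :
  homog q e -> homog (~~ q) E -> e != 0 -> E != 0 ->
  s *: e + t *: E = s' *: e + t' *: E -> s = s' /\ t = t'.
Proof.
move=> he hE e0 E0 H.
have e1 : spr q E = 0 by have := homog_oppo hE; rewrite negbK.
have := congr1 (spr q) H; have := congr1 (spr (~~ q)) H.
rewrite !sprD !sprZ (homog_oppo he) e1 (he : spr q e = e) (hE : spr _ E = E).
rewrite !scaler0 !add0r !addr0 => /eqP; rewrite -subr_eq0 -scalerBl scaler_eq0 (negPf E0).
rewrite orbF subr_eq0 => /eqP -> /eqP; rewrite -subr_eq0 -scalerBl scaler_eq0 (negPf e0).
by rewrite orbF subr_eq0 => /eqP ->.
Qed.

(** Even elements act by the weight, and odd ones exchange the two parities, which gives [eta] and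
    [phi]. On the dual, [omega_inv] negates the weight and divides [eta] and [phi] by ['i]; with the
    factors ['i] in the definition of f_i and F_i this yields the signs [(-1) ^+ p i]. The elements
    of [fr_dual] are those of the Clifford pair. *)
Lemma frame_exists g : qkm D -> std_generators g ->
  exists p eta phi, frame g p eta phi.
Proof.
move=> hQ hg.
have /choice[p Hp] : forall i, exists p : bool,
    [/\ homog p (gen_e g i), homog (~~ p) (gen_E g i), gen_e g i != 0, gen_E g i != 0
      & exists theta : dmod D false i -> dmod D true i, [/\ vee_iso theta,
         gen_f g i = 'i ^+ p *: theta (gen_e g i)
         & gen_F g i = 'i ^+ (~~ p) *: theta (gen_E g i)]].
  move=> i; have [ty [theta [_ vi [he hE e0 E0] [ef eF] _]]] := hg i.
  by exists (if ty is TakSl2 then false else true); split=> //; exists theta.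
have cl i : clifford_pair (gen_e g i) (gen_E g i).
  have [he hE e0 E0 _] := Hp i.
  apply: (@irreducible_clifford_pair _ _ _ (dalpha D i)) he hE e0 E0.
  - by case: (km4 hQ i).
  - exact: (cd_alpha_odd hD).
  - by move=> x v hx; rewrite (cd_mod_weight hD) // mul1r.
  - exact: (km3 hQ).
have al_odd i x : dalpha D i x = dalpha D i (spr false x).
  by rewrite -{1}[x]spr_sum linearD /= (cd_alpha_odd hD i (homog_spr true x)) addr0.
have /choice[m Hm] : forall ix : 'I_n * dh D, exists m : F * F,
    act ix.2 (gen_e g ix.1) = dalpha D ix.1 ix.2 *: gen_e g ix.1 + m.1 *: gen_E g ix.1 /\
    act ix.2 (gen_E g ix.1) = dalpha D ix.1 ix.2 *: gen_E g ix.1 + m.2 *: gen_e g ix.1.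
  move=> [i x] /=; have [he hE e0 E0 _] := Hp i; have [sp _] := cl i.
  have [s [t est]] := sp (act (spr true x) (gen_e g i)).
  have [s' [t' est']] := sp (act (spr true x) (gen_E g i)).
  have e1 : spr (p i) (gen_E g i) = 0 by have := homog_oppo hE; rewrite negbK.
  exists (t, s') => /=; rewrite -{1 3}[x]spr_sum !actDl.
  rewrite !(cd_mod_weight hD _ (homog_spr false x)) !mul1r [dalpha D i x]al_odd.
  split; congr (_ + _).
    have := act_homog (homog_spr true x) he; rewrite addTb => h1.
    rewrite -(h1 : spr _ _ = _) est sprD !sprZ (homog_oppo he) scaler0 add0r.
    by rewrite (hE : spr _ _ = gen_E g i).
  have := act_homog (homog_spr true x) hE; rewrite addTb negbK => h1.
  rewrite -(h1 : spr _ _ = _) est' sprD !sprZ e1 scaler0 addr0.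
  by rewrite (he : spr _ _ = gen_e g i).
pose eta i x := (m (i, x)).1; pose phi i x := (m (i, x)).2.
have ae i x : act x (gen_e g i) = dalpha D i x *: gen_e g i + eta i x *: gen_E g i.
  by have [/= -> _] := Hm (i, x).
have aE i x : act x (gen_E g i) = dalpha D i x *: gen_E g i + phi i x *: gen_e g i.
  by have [/= _ ->] := Hm (i, x).
have eta_eq i x k : act x (gen_e g i) = dalpha D i x *: gen_e g i + k *: gen_E g i -> eta i x = k.
  have [he hE e0 E0 _] := Hp i.
  by rewrite ae => /(homog_indep he hE e0 E0)[].
have phi_eq i x k : act x (gen_E g i) = dalpha D i x *: gen_E g i + k *: gen_e g i -> phi i x = k.
  have [he hE e0 E0 _] := Hp i; have he' := he; rewrite -[p i]negbK in he'.
  by rewrite aE => /(homog_indep hE he' E0 e0)[].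
have eta_lin i c x y : eta i (c *: x + y) = c * eta i x + eta i y.
  apply: eta_eq; rewrite act_linl !ae linearP /= scalerDr !scalerDl !scalerA.
  by rewrite addrACA.
have phi_lin i c x y : phi i (c *: x + y) = c * phi i x + phi i y.
  apply: phi_eq; rewrite act_linl !aE linearP /= scalerDr !scalerDl !scalerA.
  by rewrite addrACA.
have eta_even i x : homog false x -> eta i x = 0.
  by move=> hx; apply: eta_eq; rewrite (cd_mod_weight hD) // mul1r scale0r addr0.
have phi_even i x : homog false x -> phi i x = 0.
  by move=> hx; apply: phi_eq; rewrite (cd_mod_weight hD) // mul1r scale0r addr0.
have om_al i x : dalpha D i (omega_inv x) = - dalpha D i x.
  rewrite /omega_inv linearD linearN linearZ /= (cd_alpha_odd hD i (homog_spr true x)).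
  by rewrite mulr0 addr0 -al_odd.
have om_eta i x : eta i (omega_inv x) = 'i^-1 * eta i x.
  rewrite /omega_inv addrC eta_lin -scaleN1r -[_ *: _]addr0 eta_lin.
  rewrite (eta_even i _ (homog_spr false x)) (eta_even _ _ (homog0 _ _)) mulr0 !addr0.
  rewrite -{2}[x]spr_sum -[spr false x]scale1r eta_lin.
  by rewrite (eta_even i _ (homog_spr false x)) mulr0 add0r.
have om_phi i x : phi i (omega_inv x) = 'i^-1 * phi i x.
  rewrite /omega_inv addrC phi_lin -scaleN1r -[_ *: _]addr0 phi_lin.
  rewrite (phi_even i _ (homog_spr false x)) (phi_even _ _ (homog0 _ _)) mulr0 !addr0.
  rewrite -{2}[x]spr_sum -[spr false x]scale1r phi_lin.
  by rewrite (phi_even i _ (homog_spr false x)) mulr0 add0r.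
have i0 : 'i != 0 :> F := neq0Ci _.
have ii : 'i * 'i = -1 :> F by rewrite -expr2 sqrCi.
have iV : 'i^-1 = - 'i :> F by apply: (mulfI i0); rewrite divff // mulrN ii opprK.
have iiE (z : F) : 'i * (- 'i * z) = z by rewrite mulrA mulrN ii opprK mul1r.
exists p, eta, phi; split=> //.
- by move=> i; have [] := Hp i.
- by move=> i; have [] := Hp i.
- move=> i; have [he _ _ _ [theta [[_ ths _ _] -> _]]] := Hp i.
  by apply: homogZ; rewrite /homog -ths (he : spr _ _ = _).
- move=> i; have [_ hE _ _ [theta [[_ ths _ _] _ ->]]] := Hp i.
  by apply: homogZ; rewrite /homog -ths (hE : spr _ _ = _).
- by move=> i; have [] := Hp i.
- by move=> i; have [] := Hp i.
- move=> i; have [_ _ e0 _ [theta [[thl _ thb _] -> _]]] := Hp i.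
  rewrite scaler_eq0 expf_eq0 (negPf i0) andbF /=.
  have th0 : theta 0 = 0 by have := thl (-1) 0 0; rewrite scaler0 addr0 scaleN1r addNr.
  by apply: contraNneq e0 => te; apply/eqP; apply: (bij_inj thb); rewrite th0.
- move=> i; have [_ _ _ E0 [theta [[thl _ thb _] _ ->]]] := Hp i.
  rewrite scaler_eq0 expf_eq0 (negPf i0) andbF /=.
  have th0 : theta 0 = 0 by have := thl (-1) 0 0; rewrite scaler0 addr0 scaleN1r addNr.
  by apply: contraNneq E0 => te; apply/eqP; apply: (bij_inj thb); rewrite th0.
- by move=> i v; have [sp _] := cl i.
- move=> i v; have [_ _ _ _ [theta [[thl _ [th' K1 K2] _] -> ->]]] := Hp i.
  have [sp _] := cl i; have [s [t e]] := sp (th' v).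
  have th0 : theta 0 = 0 by have := thl (-1) 0 0; rewrite scaler0 addr0 scaleN1r addNr.
  exists (s / 'i ^+ p i), (t / 'i ^+ (~~ p i)).
  rewrite !scalerA !divfK ?expf_neq0 // -[v]K2 e thl.
  by rewrite -[t *: gen_E g i]addr0 thl th0 addr0.
- move=> i x; have [_ _ _ _ [theta [[thl _ _ tha] -> ->]]] := Hp i.
  have th0 : theta 0 = 0 by have := thl (-1) 0 0; rewrite scaler0 addr0 scaleN1r addNr.
  rewrite actZr -tha ae om_al om_eta thl -[_ *: gen_E g i]addr0 thl th0 addr0.
  rewrite scalerDr !scalerA -scaleNr; congr (_ *: _ + _ *: _); first by rewrite mulrC.
  rewrite iV; case: (p i) => /=; rewrite ?expr0 ?expr1.
    by rewrite iiE; ring.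
  by ring.
- move=> i x; have [_ _ _ _ [theta [[thl _ _ tha] -> ->]]] := Hp i.
  have th0 : theta 0 = 0 by have := thl (-1) 0 0; rewrite scaler0 addr0 scaleN1r addNr.
  rewrite actZr -tha aE om_al om_phi thl -[_ *: gen_e g i]addr0 thl th0 addr0.
  rewrite scalerDr !scalerA; congr (_ *: _ + _ *: _); first by rewrite mulrC.
  rewrite iV; case: (p i) => /=; rewrite ?expr0 ?expr1.
    by ring.
  by rewrite iiE; ring.
- move=> i; have [_ [x [y [hx hy [xe xE] [ye yE]]]]] := cl i.
  exists x, y; split=> //; split.
  + by apply: eta_eq; rewrite xe (cd_alpha_odd hD) // !scale0r addr0.
  + by apply: phi_eq; rewrite xE (cd_alpha_odd hD) // scale0r add0r scale1r.
  + by apply: eta_eq; rewrite ye (cd_alpha_odd hD) // scale0r add0r scale1r.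
  + by apply: phi_eq; rewrite yE (cd_alpha_odd hD) // !scale0r addr0.
Qed.
End Frames.

(** * Coupling relations between simple roots *)

Section Coupling.
Variables (F : numClosedFieldType) (n : nat) (D : datum F n) (g : generators D).
Variables (p : 'I_n -> bool) (eta phi : 'I_n -> dh D -> F).
Hypothesis hD : cartan_datum D.
Hypothesis hf : frame g p eta phi.

Definition gen_c i : dh D := dpair (gen_E g i) (gen_F g i).

Lemma gen_h_even i : homog false (gen_h g i).
Proof. by have := cd_pair_homog hD (fr_he hf i) (fr_hf hf i); rewrite addbb. Qed.
Lemma gen_c_even i : homog false (gen_c i).
Proof. by have := cd_pair_homog hD (fr_hE hf i) (fr_hF hf i); rewrite addbb. Qed.
Lemma gen_H_odd i : homog true (gen_H g i).
Proof. by have := cd_pair_homog hD (fr_hE hf i) (fr_hf hf i); rewrite addNb addbb. Qed.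

Lemma pairZl i c (u : dmod D false i) v : dpair (c *: u) v = c *: dpair u v.
Proof.
have e0 : dpair (0 : dmod D false i) v = 0.
  by have := cd_pair_linl hD (-1) (0 : dmod D false i) 0 v; rewrite scaler0 addr0 scaleN1r addNr.
by rewrite -[c *: u]addr0 (cd_pair_linl hD) e0 addr0.
Qed.
Lemma pairZr i c (u : dmod D false i) (v : dmod D true i) : dpair u (c *: v) = c *: dpair u v.
Proof.
have e0 : dpair u (0 : dmod D true i) = 0.
  by have := cd_pair_linr hD (-1) u (0 : dmod D true i) 0; rewrite scaler0 addr0 scaleN1r addNr.
by rewrite -[c *: v]addr0 (cd_pair_linr hD) e0 addr0.
Qed.

Lemma br_odd_gen_H i x : homog true x ->
  br x (gen_H g i) = phi i x *: gen_h g i + eta i x *: gen_c i.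
Proof.
move=> hx; rewrite /gen_H (cd_pair_equiv hD _ hx (fr_hE hf i)) (fr_aE hf) (fr_af hf).
rewrite (cd_alpha_odd hD) // scale0r add0r oppr0 scale0r add0r -scaleNr pairZl pairZr.
by rewrite scalerA; congr (_ + _ *: _); case: (p i); rewrite /=; ring.
Qed.

(** Take an odd [b] sending e_i to E_i and f_i to a multiple of F_i. It commutes with the even
    element h_i, so equivariance of the pairing makes the two resulting brackets cancel. *)
Lemma pair_eF i : dpair (gen_e g i) (gen_F g i) = gen_H g i.
Proof.
have [_ [b [_ hb _ [b1 b2]]]] := fr_dual hf i.
have : br b (gen_h g i) = 0.
  by rewrite (br_skew hb (gen_h_even i)) (cd_quasi_toral hD) ?scaler0 ?oppr0 //; apply: gen_h_even.
rewrite /gen_h (cd_pair_equiv hD _ hb (fr_he hf i)) (fr_ae hf) (fr_af hf).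
rewrite (cd_alpha_odd hD) // scale0r add0r oppr0 scale0r add0r -scaleNr pairZl pairZr b1.
rewrite scale1r scalerA => /eqP; rewrite addr_eq0 => /eqP; rewrite /gen_H => ->.
by rewrite -scaleNr -[LHS]scale1r; congr (_ *: _); case: (p i); rewrite /=; ring.
Qed.

Hypothesis hY : Y_matrix g 0.

Lemma phi_gen_H i j : phi j (gen_H g i) = 0.
Proof.
have := hY i j; rewrite mxE scale0r (fr_aE hf) (cd_alpha_odd hD); last exact: gen_H_odd.
rewrite scale0r add0r => /eqP; rewrite scaler_eq0 (negPf (fr_e0 hf j)) orbF.
by move/eqP.
Qed.

(** Here [eta j (gen_H g i)] is the entry x_ij. The even element [[x, H_i]] acts on e_j by its
    weight and also as [x H_i + H_i x], whose second term vanishes because [Y = 0] makes H_i kill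
    E_j. *)
Lemma coupling i j x : homog true x ->
  eta j (gen_H g i) * phi j x = phi i x * cartan_mx g i j + eta i x * dalpha D j (gen_c i).
Proof.
move=> hx; have hH := gen_H_odd i.
have hb : homog false (br x (gen_H g i)) := br_homog hx hH.
have : dalpha D j (br x (gen_H g i)) *: gen_e g j =
    (eta j (gen_H g i) * phi j x) *: gen_e g j.
  have := cd_mod_weight hD (gen_e g j) hb; rewrite mul1r => <-.
  rewrite (act_br _ hx hH) scaleN1r opprK !(fr_ae hf) !(cd_alpha_odd hD j hH).
  rewrite !(cd_alpha_odd hD j hx) !scale0r !add0r !actZr !(fr_aE hf) phi_gen_H.
  rewrite (cd_alpha_odd hD j hH) (cd_alpha_odd hD j hx) !scale0r !addr0 scaler0 addr0.
  by rewrite add0r scalerA.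
rewrite br_odd_gen_H // linearD !linearZ /= => /eqP; rewrite -subr_eq0 -scalerBl.
by rewrite scaler_eq0 (negPf (fr_e0 hf j)) orbF subr_eq0 => /eqP <-; rewrite mxE.
Qed.

(** The space h_{alpha_i} is spanned by h_i, H_i and c_i, and the three hypotheses are the entries
    through which these act on g_{alpha_j}. *)
Lemma h_kills_span i j : cartan_mx g i j = 0 -> eta j (gen_H g i) = 0 ->
  dalpha D j (gen_c i) = 0 -> h_kills D i j.
Proof.
move=> A0 e0 c0 x [m [c [v [vP ->]]]] w; rewrite act_suml big1 // => k _.
rewrite actZl; have [u1 [u2 ->]] := vP k.
suff E (y : dh D) : y = gen_h g i \/ y = gen_H g i \/ y = gen_c i -> act y w = 0.
  have [s [t ->]] := fr_span hf u1; have [s' [t' ->]] := fr_spanN hf u2.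
  rewrite (cd_pair_linl hD) pairZl !(cd_pair_linr hD) !pairZr pair_eF.
  rewrite -/(gen_h g i) -/(gen_H g i) -/(gen_c i) !(actDl, actZl).
  have Eh := E _ (or_introl erefl); have EH := E _ (or_intror (or_introl erefl)).
  by rewrite Eh EH (E _ (or_intror (or_intror erefl))) !(scaler0, addr0).
have [s [t ->]] := fr_span hf w; rewrite actDr !actZr (fr_ae hf) (fr_aE hf).
case=> [->|[->|->]].
- rewrite (fr_eta_even hf) ?(fr_phi_even hf) //; try exact: gen_h_even.
  by move: A0; rewrite mxE => ->; rewrite !scale0r !addr0 !scaler0 addr0.
- rewrite e0 phi_gen_H (cd_alpha_odd hD); last exact: gen_H_odd.
  by rewrite !scale0r !addr0 !scaler0 addr0.
- rewrite (fr_eta_even hf) ?(fr_phi_even hf) //; try exact: gen_c_even.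
  by rewrite c0 !scale0r !addr0 !scaler0 addr0.
Qed.

Lemma h_kills_c i j : h_kills D i j -> dalpha D j (gen_c i) = 0.
Proof.
move=> /(_ (gen_c i)) H; apply/eqP; have := fr_e0 hf j; apply: contraNT => a0.
have /H/(_ (gen_e g j)) : h_alpha i (gen_c i).
  exists 1%N, (fun=> 1), (fun=> gen_c i); split; last by rewrite big_ord1 scale1r.
  by move=> _; exists (gen_E g i), (gen_F g i).
rewrite (cd_mod_weight hD); last exact: gen_c_even.
by move=> /eqP; rewrite mul1r scaler_eq0 (negPf a0).
Qed.

Hypothesis hQ : qkm D.

(** If some x_ki is nonzero, evaluate the coupling relation at H_k, where all [phi] vanish. If none
    is, the relation for the pair (j, i), tested on [fr_dual], gives a_ji = 0 and alpha_i(c_j) = 0;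
    then h_{alpha_j} kills g_{alpha_i}, and (KM2) reverses the roles. *)
Lemma alpha_gen_c i j : dalpha D j (gen_c i) = 0.
Proof.
have [[k ek]|nk] := pselect (exists k, eta i (gen_H g k) != 0).
  have := coupling i j (gen_H_odd k).
  rewrite !phi_gen_H mulr0 mul0r add0r => /esym/eqP.
  by rewrite mulf_eq0 (negPf ek) => /eqP.
apply/h_kills_c/(km2 hQ)/h_kills_span.
- have [a [b [ha hb [a1 a2] [b1 b2]]]] := fr_dual hf j.
  have := coupling j i ha; rewrite a1 a2 mul1r mul0r addr0 => <-.
  apply/eqP; rewrite mulf_eq0; apply/orP; left; apply/negPn/negP => e; apply: nk; by exists j.
- by apply/eqP/negPn/negP => e; apply: nk; exists j.
- have [a [b [ha hb [a1 a2] [b1 b2]]]] := fr_dual hf j.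
  have := coupling j i hb; rewrite b1 b2 mul1r mul0r add0r => <-.
  apply/eqP; rewrite mulf_eq0; apply/orP; left; apply/negPn/negP => e; apply: nk; by exists j.
Qed.

Lemma coupling0 i j x : homog true x ->
  eta j (gen_H g i) * phi j x = phi i x * cartan_mx g i j.
Proof. by move=> hx; rewrite coupling // alpha_gen_c mulr0 addr0. Qed.

Hypothesis hind : indecomposable D.

Lemma phi_odd i x : phi i x = phi i (spr true x).
Proof.
rewrite -{1}[x]spr_sum -[spr false x]scale1r (fr_phi_lin hf).
by rewrite (fr_phi_even hf) ?mulr0 ?add0r //; apply: homog_spr.
Qed.

(* The relation x_ij phi_j = a_ij phi_i makes phi_i and phi_j proportional as soon
   as i and j are linked in the Dynkin diagram, which is connected. *)
Lemma common_phi : exists (r : 'I_n -> F) (ph : dh D -> F),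
  (forall i, r i != 0) /\ forall i x, r i * phi i x = ph x.
Proof.
have [[i0 _]|ne] := pselect (exists i0 : 'I_n, True); last first.
  exists (fun=> 1), (fun=> 0); split=> [i|i x]; first exact: oner_neq0.
  by exfalso; apply: ne; exists i.
pose P := [set i | `[< exists c, forall x, phi i x = c * phi i0 x >]]%SET.
have PE i : (i \in P) = `[< exists c, forall x, phi i x = c * phi i0 x >].
  by rewrite /P finset.in_set.
have PT : P = [set: 'I_n]%SET.
  apply/eqP/negPn/negP => PT; apply: hind; exists P; split=> //.
    apply/set0Pn; exists i0; rewrite PE; apply/asboolP; exists 1 => x.
    by rewrite mul1r.
  move=> i j; rewrite !PE => /asboolP[c Hc] /asboolP nj.
  suff K : h_kills D i j by exact: (conj K (km2 hQ K)).
  have A0 : cartan_mx g i j = 0.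
    apply/eqP/negPn/negP => A0; have [a [_ [ha _ [_ a2] _]]] := fr_dual hf i.
    have e0 : eta j (gen_H g i) != 0.
      apply: contraNneq A0 => e0; have := coupling0 i j ha.
      by rewrite e0 a2 mul0r mul1r => <-.
    apply: nj; exists (cartan_mx g i j / eta j (gen_H g i) * c) => x.
    rewrite -mulrA -Hc (phi_odd i) (phi_odd j).
    apply: (mulfI e0); rewrite coupling0; last exact: homog_spr.
    by field.
  apply: h_kills_span => //; last exact: alpha_gen_c.
  have [a [_ [ha _ [_ a2] _]]] := fr_dual hf j.
  by have := coupling0 i j ha; rewrite a2 A0 mulr0 mulr1.
have /choice[s Hs] : forall i, exists c, forall x, phi i x = c * phi i0 x.
  by move=> i; apply/asboolP; rewrite -PE PT finset.in_setT.
have s0 i : s i != 0.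
  have [a [_ [_ _ [_ a2] _]]] := fr_dual hf i.
  apply/eqP => s0; have := Hs i a; rewrite a2 s0 mul0r => /eqP.
  by rewrite oner_eq0.
exists (fun i => (s i)^-1), (phi i0); split=> [i|i x]; first by rewrite invr_eq0.
by rewrite Hs mulKf.
Qed.

(** Rescaling replaces x_ij by r_i x_ij / r_j. At an odd [a] with [phi j a = 1] the coupling
    relation reads x_ij = a_ij phi_i(a), while r_i phi_i(a) = r_j. *)
Lemma coupled_X_matrix (r : 'I_n -> F) (ph : dh D -> F) :
  (forall i, r i != 0) -> (forall i x, r i * phi i x = ph x) ->
  X_matrix (rescale r g) (cartan_mx g).
Proof.
move=> r0 rph i j; rewrite /gen_H /= pairZl actZl (fr_ae hf) -/(gen_H g i).
rewrite (cd_alpha_odd hD); last exact: gen_H_odd.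
rewrite scale0r add0r !scalerA; congr (_ *: _).
have [a [_ [ha _ [_ a2] _]]] := fr_dual hf j.
have := coupling0 i j ha; rewrite a2 mulr1 => ->.
by rewrite mulrA rph -(rph j) a2 mulr1 mulrC.
Qed.
End Coupling.

(** * Root types *)

Section SubalgebraLemmas.
Variables (F : fieldType) (L : lieSuper F) (S : set L).
Lemma lie_sub_valP (u : lie_sub S) : subalg_gen S (lie_sub_val u).
Proof. by apply/asboolP; apply: (valP (u : sub_car S)). Qed.
Lemma lie_sub_val_inj : injective (@lie_sub_val F L S).
Proof. exact: val_inj. Qed.
Lemma lie_sub_val_morph : lie_morph (@lie_sub_val F L S).
Proof. by split. Qed.
Lemma subalg_gen_sub : S `<=` subalg_gen S.
Proof. by move=> x Sx U _; apply. Qed.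
Lemma lie_sub_mk x : subalg_gen S x -> exists u : lie_sub S, lie_sub_val u = x.
Proof.
move=> Sx; have Px : x \in sub_pred S by apply/asboolP.
by exists (Sub x Px : sub_car S).
Qed.
End SubalgebraLemmas.

(** * Two-step nilpotency of sl(1|1) and of its Takiff superalgebra *)

Section Sl11.
Variable F : numClosedFieldType.
Notation gl11 := (gl_lie F (@gl_par 1 1)).
Notation sl11 := (sl_lie F 1 1).

(** For size 1|1 the supertrace is the difference of the diagonal entries, so this is sl(1|1) as an
    explicit subset, which is needed because [lie_sub] is a generated subalgebra. *)
Definition eq_diag : set gl11 := [set X | (X : 'M[F]_(1 + 1)) 0 0 = (X : 'M[F]_(1 + 1)) 1 1].

Lemma ord2P (P : 'I_(1 + 1) -> Prop) : P 0 -> P 1 -> forall i, P i.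
Proof.
move=> P0 P1 [[|[|m]] Hm] //.
- by rewrite (_ : Ordinal Hm = 0) //; apply: val_inj.
- by rewrite (_ : Ordinal Hm = 1) //; apply: val_inj.
Qed.

Lemma gl11_br (X Y : gl11) : eq_diag X -> eq_diag Y ->
  br X Y = ((X : 'M[F]_(1 + 1)) 0 1 * (Y : 'M[F]_(1 + 1)) 1 0
          + (X : 'M[F]_(1 + 1)) 1 0 * (Y : 'M[F]_(1 + 1)) 0 1)%:M :> 'M[F]_(1 + 1).
Proof.
rewrite /eq_diag /= => dX dY.
have e1 : lift ord0 ord0 = 1 :> 'I_(1 + 1) by apply: val_inj.
apply/matrixP; elim/ord2P; elim/ord2P;
  rewrite /= /gl_br !big_bool /= !mxE !big_ord_recl !big_ord0 !mxE /= ?e1 /gl_par /= ?dX ?dY; ring.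
Qed.

Lemma supertrace11 (X : gl11) :
  supertrace X = (X : 'M[F]_(1 + 1)) 0 0 - (X : 'M[F]_(1 + 1)) 1 1.
Proof.
have e1 : lift ord0 ord0 = 1 :> 'I_(1 + 1) by apply: val_inj.
rewrite /supertrace !big_ord_recl big_ord0 ?e1 /gl_par /= expr0 expr1.
by rewrite mul1r mulN1r addr0.
Qed.

Lemma eq_diag_subalgebra : subalgebra eq_diag.
Proof.
split=> [|X Y dX dY]; last by have := gl11_br dX dY; rewrite /eq_diag /= => ->; rewrite !mxE.
split=> [|c X Y|b X]; rewrite /eq_diag /=.
- by rewrite !mxE.
- by rewrite !mxE => -> ->.
- by rewrite !mxE /gl_par /= => ->.
Qed.

Lemma sl11_diag (x : sl11) : eq_diag (lie_sub_val x).
Proof.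
apply: (lie_sub_valP x eq_diag_subalgebra) => X /=; rewrite supertrace11.
exact: subr0_eq.
Qed.

(** The line of the identity matrix: it contains all brackets, is central, and lies in the radical
    of the supertrace form. *)
Definition scalar11 (x : sl11) : Prop :=
  exists s : F, lie_sub_val x = s%:M :> 'M[F]_(1 + 1).

Lemma scalar11_sub : graded_subspace scalar11.
Proof.
split.
- by exists 0; rewrite (morph0 (lie_sub_val_morph _)) -scalemx1 scale0r.
- move=> c x y [s ex] [t ey]; exists (c * s + t).
  by rewrite (morph_lin (lie_sub_val_morph _)) ex ey scale_scalar_mx -raddfD.
- move=> b x [s ex]; exists (if b then 0 else s); rewrite (morph_spr (lie_sub_val_morph _)) ex.
  by apply/matrixP; elim/ord2P; elim/ord2P; rewrite !mxE /gl_par /=; case: b.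
Qed.

Lemma scalar11_br (x y : sl11) : scalar11 (br x y).
Proof.
by eexists; rewrite (morph_br (lie_sub_val_morph _)) (gl11_br (sl11_diag x) (sl11_diag y)).
Qed.

Lemma scalar11_brr (x z : sl11) : scalar11 z -> br x z = 0.
Proof.
move=> [s es]; apply: lie_sub_val_inj; rewrite (morph_br (lie_sub_val_morph _)).
rewrite (morph0 (lie_sub_val_morph _)) [LHS](gl11_br (sl11_diag x) (sl11_diag z)) es !mxE /=.
by rewrite !mulr0n !mulr0 addr0 -scalemx1 scale0r.
Qed.

Lemma scalar11_brl (x z : sl11) : scalar11 z -> br z x = 0.
Proof.
move=> [s es]; apply: lie_sub_val_inj; rewrite (morph_br (lie_sub_val_morph _)).
rewrite (morph0 (lie_sub_val_morph _)) [LHS](gl11_br (sl11_diag z) (sl11_diag x)) es !mxE /=.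
by rewrite !mulr0n !mul0r addr0 -scalemx1 scale0r.
Qed.

Lemma scalar11_form (x z : sl11) : scalar11 z -> tak_base_form F TakSl11 x z = 0.
Proof.
move=> [s es]; rewrite /= /str_prod es supertrace11 mul_mx_scalar !mxE.
by have := sl11_diag x; rewrite /eq_diag /= => ->; rewrite subrr.
Qed.

Lemma scalar11_formr (x z : sl11) : scalar11 z -> tak_base_form F TakSl11 z x = 0.
Proof.
move=> [s es]; rewrite /= /str_prod es supertrace11 mul_scalar_mx !mxE.
by have := sl11_diag x; rewrite /eq_diag /= => ->; rewrite subrr.
Qed.
End Sl11.

Section TakiffSl11.
Variable F : numClosedFieldType.

Lemma ts_form ty (u : ts_lie F ty) : exists x y k, lie_sub_val u = tak_elt x y 0 k 0.
Proof.
apply: (lie_sub_valP u (U := [set u | exists x y k, u = tak_elt x y 0 k 0])) => //.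
split; first split.
- by exists 0, 0, 0.
- move=> c _ _ [x [y [k ->]]] [x' [y' [k' ->]]].
  exists (c *: x + x'), (c *: y + y'), (c *: k + k').
  by rewrite -[LHS]/(tak_elt _ _ (c * 0 + 0) _ (c * 0 + 0)) mulr0 addr0.
- move=> b _ [x [y [k ->]]]; exists (spr b x), (spr (~~ b) y), (if b then 0 else k).
  by case: b.
- move=> _ _ [x [y [k ->]]] [x' [y' [k' ->]]].
  exists (br x x' + 0 *: stw y' + 0 *: y), (br x y' + br y (stw x')).
  exists (tak_base_form F ty y (stw y')).
  by rewrite -[LHS]/(tak_elt _ _ 0 _ (0 * 0)) mulr0.
Qed.

Lemma ts_mk ty x y k : exists u : ts_lie F ty, lie_sub_val u = tak_elt x y 0 k 0.
Proof. by apply: lie_sub_mk; apply: subalg_gen_sub; exists x, y, k. Qed.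

Notation ts := (ts_lie F TakSl11).

(** The scalars tensored with C[xi], together with c. This subspace is central and contains the
    derived algebra; for the c-component this uses that scalars are in the radical of the form. *)
Definition scalar_ts (u : ts) : Prop := exists x y k,
  [/\ lie_sub_val u = tak_elt x y 0 k 0, scalar11 x & scalar11 y].

Lemma scalar_ts_sub : graded_subspace scalar_ts.
Proof.
have gS := scalar11_sub F; split.
- exists 0, 0, 0; split=> //; exact: gsub0.
- move=> c u v [x [y [k [eu sx sy]]]] [x' [y' [k' [ev sx' sy']]]].
  exists (c *: x + x'), (c *: y + y'), (c *: k + k'); split.
  + rewrite (morph_lin (lie_sub_val_morph _)) eu ev.
    by rewrite -[LHS]/(tak_elt _ _ (c * 0 + 0) _ (c * 0 + 0)) mulr0 addr0.
  + by apply: (gsubD gS) => //; apply: (gsubZ gS).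
  + by apply: (gsubD gS) => //; apply: (gsubZ gS).
- move=> b u [x [y [k [eu sx sy]]]].
  exists (spr b x), (spr (~~ b) y), (if b then 0 else k); split; last 2 first.
  + exact: (gsub_spr gS).
  + exact: (gsub_spr gS).
  + by rewrite (morph_spr (lie_sub_val_morph _)) eu; case: b.
Qed.

Lemma stw_scalar11 z : scalar11 z -> scalar11 (stw z : sl_lie F 1 1).
Proof.
move=> sz; have gS := scalar11_sub F.
by apply: (gsubD gS); [|apply: (gsubN gS)]; apply: (gsub_spr gS).
Qed.

Lemma ts_br_scalar (u v : ts) : scalar_ts (br u v).
Proof.
have gS := scalar11_sub F.
have [x [y [k eu]]] := ts_form u; have [x' [y' [k' ev]]] := ts_form v.
exists (br x x' + 0 *: stw y' + 0 *: y), (br x y' + br y (stw x')).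
exists (tak_base_form F TakSl11 y (stw y')); split.
- rewrite (morph_br (lie_sub_val_morph _)) eu ev.
  by rewrite -[LHS]/(tak_elt _ _ 0 _ (0 * 0)) mulr0.
- by rewrite !scale0r !addr0; apply: scalar11_br.
- by apply: (gsubD gS); apply: scalar11_br.
Qed.

Lemma scalar_ts_brr (u w : ts) : scalar_ts w -> br u w = 0.
Proof.
move=> [x' [y' [k' [ew sx sy]]]]; have [x [y [k eu]]] := ts_form u.
apply: lie_sub_val_inj.
rewrite (morph_br (lie_sub_val_morph _)) eu ew (morph0 (lie_sub_val_morph _)).
rewrite -[LHS]/(tak_elt (br x x' + 0 *: stw y' + 0 *: y) (br x y' + br y (stw x')) 0
  (tak_base_form F TakSl11 y (stw y')) (0 * 0)).
rewrite !scale0r !scalar11_brr ?scalar11_form ?mulr0 ?addr0 //; exact: stw_scalar11.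
Qed.

Lemma scalar_ts_brl (u w : ts) : scalar_ts w -> br w u = 0.
Proof.
move=> [x' [y' [k' [ew sx sy]]]]; have [x [y [k eu]]] := ts_form u.
apply: lie_sub_val_inj.
rewrite (morph_br (lie_sub_val_morph _)) eu ew (morph0 (lie_sub_val_morph _)).
rewrite -[LHS]/(tak_elt (br x' x + 0 *: stw y + 0 *: y') (br x' y + br y' (stw x)) 0
  (tak_base_form F TakSl11 y' (stw y)) (0 * 0)).
by rewrite !scale0r !scalar11_brl ?scalar11_formr ?mulr0 ?addr0.
Qed.

(** The two off-diagonal matrix units, tensored with 1. Their bracket is the identity matrix, which
    survives in every quotient by a subspace of the line of c. *)
Lemma sl11_odd_pair : exists X1 X2 : ts, [/\ homog true X1, homog true X2,
  br X1 X1 = 0, br X2 X2 = 0 & forall k, lie_sub_val (br X1 X2) <> tak_elt 0 0 0 k 0].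
Proof.
have mk i j : (i : 'I_(1 + 1)) != j ->
    exists x : sl_lie F 1 1, lie_sub_val x = delta_mx i j :> 'M[F]_(1 + 1).
  move=> ij; apply: lie_sub_mk; apply: subalg_gen_sub => /=; rewrite supertrace11 !mxE.
  by move: i j ij; elim/ord2P; elim/ord2P; rewrite //= ?andbF ?subrr.
have [x1 e1] := mk 0 1 isT; have [x2 e2] := mk 1 0 isT.
have [X1 E1] := ts_mk (ty := TakSl11) x1 0 0; have [X2 E2] := ts_mk (ty := TakSl11) x2 0 0.
have h1 : homog true x1.
  apply: lie_sub_val_inj; rewrite (morph_spr (lie_sub_val_morph _)) e1.
  by apply/matrixP; elim/ord2P; elim/ord2P; rewrite !mxE.
have h2 : homog true x2.
  apply: lie_sub_val_inj; rewrite (morph_spr (lie_sub_val_morph _)) e2.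
  by apply/matrixP; elim/ord2P; elim/ord2P; rewrite !mxE.
have brE (X Y : ts) x y : lie_sub_val X = tak_elt x 0 0 0 0 -> lie_sub_val Y = tak_elt y 0 0 0 0 ->
    lie_sub_val (br X Y) = tak_elt (br x y) 0 0 0 0.
  move=> eX eY; rewrite (morph_br (lie_sub_val_morph _)) eX eY.
  rewrite -[LHS]/(tak_elt (br x y + 0 *: stw 0 + 0 *: 0) (br x 0 + br 0 (stw y)) 0
    (tak_base_form F TakSl11 0 (stw 0)) (0 * 0)).
  by rewrite !scale0r br0r br0l Defs.form0l mulr0 !addr0.
exists X1, X2; split.
- apply: lie_sub_val_inj; rewrite (morph_spr (lie_sub_val_morph _)) E1.
  by rewrite -[LHS]/(tak_elt (spr true x1) (spr false 0) 0 0 0) h1 spr0.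
- apply: lie_sub_val_inj; rewrite (morph_spr (lie_sub_val_morph _)) E2.
  by rewrite -[LHS]/(tak_elt (spr true x2) (spr false 0) 0 0 0) h2 spr0.
- apply: lie_sub_val_inj; rewrite (brE _ _ x1 x1) // (morph0 (lie_sub_val_morph _)).
  suff -> : br x1 x1 = 0 by [].
  apply: lie_sub_val_inj; rewrite (morph_br (lie_sub_val_morph _)).
  rewrite [LHS](gl11_br (sl11_diag x1) (sl11_diag x1)).
  by rewrite e1 !mxE /= mulr0 mul0r addr0 -scalemx1 scale0r.
- apply: lie_sub_val_inj; rewrite (brE _ _ x2 x2) // (morph0 (lie_sub_val_morph _)).
  suff -> : br x2 x2 = 0 by [].
  apply: lie_sub_val_inj; rewrite (morph_br (lie_sub_val_morph _)).
  rewrite [LHS](gl11_br (sl11_diag x2) (sl11_diag x2)).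
  by rewrite e2 !mxE /= mulr0 mul0r addr0 -scalemx1 scale0r.
- move=> k; rewrite (brE _ _ x1 x2) // => H.
  have {H} : br x1 x2 = 0 := congr1 (fun u => u.1.1.1.1) H.
  move=> /(congr1 (@lie_sub_val _ _ _)).
  rewrite (morph_br (lie_sub_val_morph _)) (morph0 (lie_sub_val_morph _)).
  rewrite [LHS](gl11_br (sl11_diag x1) (sl11_diag x2)) e1 e2.
  move/matrixP => /(_ 0 0); rewrite !mxE /= mulr1 mulr0 addr0 => /eqP.
  by rewrite oner_eq0.
Qed.

Lemma tak_base_neq0 ty : exists x : tak_base F ty, x != 0.
Proof.
have nz (L : lieSuper F) (S : set L) (X : L) : S X -> X != 0 -> exists x : lie_sub S, x != 0.
  move=> SX X0; have [x ex] := lie_sub_mk (subalg_gen_sub SX).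
  by exists x; apply: contraNneq X0 => x0; rewrite -ex x0 (morph0 (lie_sub_val_morph _)).
case: ty => /=.
- apply: (@nz (gl_lie F (@gl_par 2 0)) [set X | supertrace X = 0]
    (delta_mx 0 1 : 'M[F]_(2 + 0))) => /=.
    rewrite /supertrace big1 // => i _; rewrite mxE.
    by case: i => -[|[|[|//]]] Hi; rewrite /= ?mulr0n ?mulr0.
  by apply/eqP => /matrixP/(_ 0 1); rewrite !mxE /= => /eqP; rewrite oner_eq0.
- apply: (@nz (gl_lie F (@gl_par 1 2)) _
    (\matrix_(i, j) (((i == 1%N :> nat) && (j == 1%N :> nat))%:R
      - ((i == 2%N :> nat) && (j == 2%N :> nat))%:R) : 'M[F]_(1 + 2))) => /=.
    move=> b i j; rewrite !mxE !big_ord_recl !big_ord0 !mxE /gl_par.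
    case: b; case: i => -[|[|[|//]]] Hi; case: j => -[|[|[|//]]] Hj; rewrite /=; ring.
  by apply/eqP => /matrixP/(_ 1 1); rewrite !mxE /= subr0 => /eqP; rewrite oner_eq0.
- apply: (@nz (gl_lie F (@gl_par 1 1)) [set X | supertrace X = 0]
    (delta_mx 0 1 : 'M[F]_(1 + 1))) => /=.
    by rewrite supertrace11 !mxE /= subrr.
  by apply/eqP => /matrixP/(_ 0 1); rewrite !mxE /= => /eqP; rewrite oner_eq0.
Qed.
End TakiffSl11.

(** Separates eigenvectors for the eigenvalues 2 and -2: twice the first equation plus the second is
    [4 s x = 0]. *)
Lemma opposite_eigen (F : numFieldType) (V : lmodType F) (x y : V) (s t : F) :
  s *: x + t *: y = 0 -> (s * (1 + 1)) *: x + (t * (-1 + -1)) *: y = 0 -> s *: x = 0.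
Proof.
move=> E E'; have : (4 * s) *: x = 0.
  have <- : 2 *: (s *: x + t *: y) + ((s * (1 + 1)) *: x + (t * (-1 + -1)) *: y) = (4 * s) *: x.
    rewrite scalerDr !scalerA addrACA -!scalerDl [X in _ + X *: _](_ : _ = 0); last by ring.
    by rewrite scale0r addr0; congr (_ *: _); ring.
  by rewrite E E' scaler0 addr0.
by rewrite -scalerA => /eqP; rewrite scaler_eq0 pnatr_eq0 /= => /eqP.
Qed.

(** * Coroots for the three root types *)

Section RootTypes.
Variables (F : numClosedFieldType) (n : nat) (D : datum F n) (g : generators D).
Variables (p : 'I_n -> bool) (eta phi : 'I_n -> dh D -> F).
Hypothesis hD : cartan_datum D.
Hypothesis wD : weighted D.
Hypothesis hf : frame g p eta phi.
Variable i : 'I_n.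

Local Notation R := (range (@groot F n D false i) `|` range (@groot F n D true i)).
Local Notation e := (groot (gen_e g i)).
Local Notation f := (groot (gen_f g i)).

Lemma galg_pair (u : dmod D false i) (v : dmod D true i) :
  br (groot u) (groot v) = gh (dpair u v).
Proof.
rewrite /groot -(morph_br (lie_pi_morph _)) -/(gt_root u) -/(gt_root v).
by rewrite gt_pair.
Qed.

Lemma galg_act s j x (v : dmod D s j) : br (gh x) (groot v) = groot (act x v).
Proof. exact: (cs_act (galg_sys D)). Qed.

(** If all root vectors vanished, g<alpha_i> would be zero and the whole of ts' would lie in the
    line of c. *)
Lemma root_type_neq0 ty : root_type D i ty ->
  exists s (v : dmod D s i), groot v != 0.
Proof.
case=> ph [mph rph kph]; apply: contrapT => nv.
have v0 s (v : dmod D s i) : groot v = 0.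
  by apply/eqP/negPn/negP => e0; apply: nv; exists s, v.
have [x /eqP x0] := tak_base_neq0 F ty; apply: x0.
have [u eu] := ts_mk (ty := ty) x 0 0.
have : range ph (ph u) by exists u.
rewrite rph => /(_ [set 0] (ideal_subalgebra (zero_ideal _))) H.
have /kph[k] : ph u = 0 by apply: H => _ [] [v _ <-] /=.
by rewrite eu => E; exact: (congr1 (fun u => u.1.1.1.1) E).
Qed.

Lemma weight_gen_h_neq0 ty : root_type D i ty ->
  dalpha D i (gen_h g i) != 0 -> gh (gen_h g i) != 0.
Proof.
move=> /root_type_neq0[s [v v0]]; apply: contraNneq => h0.
have := galg_act (gen_h g i) v; rewrite h0 br0l (cd_mod_weight hD) //; last first.
  exact: (gen_h_even hD hf).
rewrite [groot _](cs_rootZ (galg_sys D)) => /esym/eqP; rewrite scaler_eq0.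
by rewrite [X in _ || X](negPf v0) orbF mulf_eq0 signr_eq0.
Qed.

Section Sl11Root.
Hypothesis pi1 : p i = true.
Variable ph : ts_lie F TakSl11 -> galg D.
Hypothesis mph : lie_morph ph.
Hypothesis rph : range ph = subalg_gen R.
Hypothesis kph : forall u, ph u = 0 -> exists k, lie_sub_val u = tak_elt 0 0 0 k 0.

Lemma root_in_range s (v : dmod D s i) : exists t, groot v = ph t.
Proof.
suff [t _ <-] : range ph (groot v) by exists t.
by rewrite rph; apply: subalg_gen_sub; case: s v => v; [right | left]; exists v.
Qed.

(* Modulo the center of g<alpha_i>, which contains its derived algebra, g<alpha_i>
   is spanned by the root vectors. *)
Lemma range_ph u : exists (v : dmod D false i) (w : dmod D true i) t,
  scalar_ts t /\ ph u = groot v + groot w + ph t.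
Proof.
pose U := [set x | exists (v : dmod D false i) (w : dmod D true i) t,
  scalar_ts t /\ x = groot v + groot w + ph t].
have gS := scalar_ts_sub F.
have r0 s : groot (0 : dmod D s i) = 0 := cs_root0 (galg_sys D) _ _.
have H : subalg_gen R (ph u) by rewrite -rph; exists u.
apply: (H U) => [|x].
  - split; first split.
    + exists 0, 0, 0; split; first exact: (gsub0 gS).
      by rewrite !r0 (morph0 mph) !addr0.
    + move=> c _ _ [v [w [t [st ->]]]] [v' [w' [t' [st' ->]]]].
      exists (c *: v + v'), (c *: w + w'), (c *: t + t'); split.
        by apply: (gsubD gS) => //; apply: (gsubZ gS).
      rewrite ![groot (_ + _)](cs_root_lin (galg_sys D)) (morph_lin mph) !scalerDr.
      by rewrite /=; zmod_eq.
    + move=> b _ [v [w [t [st ->]]]]; exists (spr b v), (spr b w), (spr b t); split.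
        exact: (gsub_spr gS).
      by rewrite !sprD ![groot (spr _ _)](cs_root_spr (galg_sys D)) (morph_spr mph).
    + have inph x : U x -> exists t, x = ph t.
        move=> [v [w [t [_ ->]]]]; have [t1 ->] := root_in_range v.
        by have [t2 ->] := root_in_range w; exists (t1 + t2 + t); rewrite !(morphD mph).
      move=> _ _ /inph[t ->] /inph[t' ->]; exists 0, 0, (br t t'); split.
        exact: ts_br_scalar.
      by rewrite (morph_br mph) !r0 !add0r.
  - move=> [] [v _ <-]; [exists v, 0, 0 | exists 0, v, 0]; rewrite !r0 (morph0 mph) !(addr0, add0r);
    by split=> //; apply: (gsub0 gS).
Qed.

Lemma odd_root_e (v : dmod D false i) : exists a, groot (spr true v) = a *: e.
Proof.
have [s [t ->]] := fr_span hf v; exists s; rewrite sprD !sprZ.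
have := fr_he hf i; rewrite pi1 => ->; have := fr_hE hf i; rewrite pi1 => /homog_oppo /= ->.
by rewrite scaler0 addr0 [LHS](cs_rootZ (galg_sys D)).
Qed.
Lemma odd_root_f (v : dmod D true i) : exists a, groot (spr true v) = a *: f.
Proof.
have [s [t ->]] := fr_spanN hf v; exists s; rewrite sprD !sprZ.
have := fr_hf hf i; rewrite pi1 => ->; have := fr_hF hf i; rewrite pi1 => /homog_oppo /= ->.
by rewrite scaler0 addr0 [LHS](cs_rootZ (galg_sys D)).
Qed.

Lemma odd_ph u : homog true u -> exists a b t,
  scalar_ts t /\ ph u = a *: e + b *: f + ph t.
Proof.
move=> hu; have [v [w [t [st E]]]] := range_ph u.
have [a ea] := odd_root_e v; have [b eb] := odd_root_f w.
exists a, b, (spr true t); split; first exact: (gsub_spr (scalar_ts_sub F)).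
rewrite -(hu : spr true u = u) (morph_spr mph) E !sprD (morph_spr mph) -ea -eb.
by rewrite ![groot (spr _ _)](cs_root_spr (galg_sys D)).
Qed.

(** Suppose [[e, f] = 0]. Modulo central terms the images of the odd pair are a_k e + c_k f. Their
    squares vanish, and comparing heights gives a_k^2 [e, e] = 0 and c_k^2 [f, f] = 0 separately.
    Then a_1 a_2 [e, e] + c_1 c_2 [f, f] is zero, so the bracket of the pair is in the kernel, which
    [sl11_odd_pair] excludes. *)
Lemma sl11_gen_h_neq0 : gh (gen_h g i) != 0.
Proof.
apply/eqP => h0.
have he : homog true e by apply: (cs_root_homog (galg_sys D)); have := fr_he hf i; rewrite pi1.
have hf' : homog true f by apply: (cs_root_homog (galg_sys D)); have := fr_hf hf i; rewrite pi1.
have ef : br e f = 0 := etrans (galg_pair _ _) h0.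
have fe : br f e = 0 by rewrite (br_skew hf' he) ef scaler0 oppr0.
have cen x y t t' : scalar_ts t -> scalar_ts t' -> (exists u, x = ph u) -> (exists u, y = ph u) ->
    br (x + ph t) (y + ph t') = br x y.
  move=> st st' [u ->] [u' ->]; rewrite -!(morphD mph) -!(morph_br mph) brDl !brDr.
  by rewrite !(scalar_ts_brl _ st) (scalar_ts_brr _ st') !addr0.
have inph a b : exists u, a *: e + b *: f = ph u.
  have [t1 ->] := root_in_range (gen_e g i); have [t2 ->] := root_in_range (gen_f g i).
  by exists (a *: t1 + b *: t2); rewrite (morph_lin mph) (morphZ mph).
have expand a b a' b' : br (a *: e + b *: f) (a' *: e + b' *: f) =
    (a * a') *: br e e + (b * b') *: br f f.
  by rewrite !(brDl, brDr) !(brZl, brZr) ef fe !scaler0 addr0 add0r !scalerA.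
have sep s t : s *: br e e + t *: br f f = 0 -> s *: br e e = 0 /\ t *: br f f = 0.
  move=> E; have [r hr r1] := w_dual wD (fun=> 1).
  have E' : br (gh r) (s *: br e e + t *: br f f) = 0 by rewrite E br0r.
  move: E'; have hhr : homog false (gh r) := cs_h_homog (galg_sys D) hr.
  rewrite brDr !brZr !(jacobi_even _ _ hhr) !galg_act !(w_mod wD) // !r1.
  rewrite ![groot (_ *: _)](cs_rootZ (galg_sys D)) !(brZl, brZr) -!scalerDl !mulr1.
  rewrite expr0 expr1 !scalerA => E'.
  have E1 : s *: br e e = 0 := opposite_eigen E E'.
  by split=> //; move: E; rewrite E1 add0r.
have [X1 [X2 [h1 h2 b1 b2 b12]]] := sl11_odd_pair F.
have [a1 [c1 [t1 [st1 E1]]]] := odd_ph h1; have [a2 [c2 [t2 [st2 E2]]]] := odd_ph h2.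
have : ph (br X1 X1) = 0 by rewrite b1 (morph0 mph).
rewrite (morph_br mph) E1 cen // expand => /sep[aa1 cc1].
have : ph (br X2 X2) = 0 by rewrite b2 (morph0 mph).
rewrite (morph_br mph) E2 cen // expand => /sep[aa2 cc2].
suff /kph[k] : ph (br X1 X2) = 0 by move/b12.
rewrite (morph_br mph) E1 E2 cen // expand.
have half a a' (y : galg D) : (a * a) *: y = 0 -> (a * a') *: y = 0.
  move=> /eqP; rewrite scaler_eq0 mulf_eq0 orbb => /orP[] /eqP ->.
    by rewrite mul0r scale0r.
  by rewrite scaler0.
by rewrite (half _ _ _ aa1) (half _ _ _ cc1) addr0.
Qed.

(** Brackets in g<alpha_i> are central, so [[h_i, e_i] = 0]; a nonzero value of alpha_i(h_i) would
    force e_i = 0 in g and hence h_i = 0. *)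
Lemma sl11_alpha_h : dalpha D i (gen_h g i) = 0.
Proof.
apply/eqP/negPn/negP => a0; have /negP := sl11_gen_h_neq0; apply.
have : br (gh (gen_h g i)) e = 0.
  rewrite -galg_pair; have [t1 ->] := root_in_range (gen_e g i).
  have [t2 ->] := root_in_range (gen_f g i).
  by rewrite -!(morph_br mph) scalar_ts_brl ?(morph0 mph) //; apply: ts_br_scalar.
rewrite galg_act (cd_mod_weight hD) ?mul1r; last exact: (gen_h_even hD hf).
rewrite [groot _](cs_rootZ (galg_sys D)) => /eqP; rewrite scaler_eq0 (negPf a0) => /eqP e0.
by rewrite -galg_pair [groot _]e0 br0l.
Qed.
End Sl11Root.

(** The diagonal entry is 2, 1 or 0 according to the type, so the parity of e_i agrees with the
    parity that [km_datum] gives to the i-th Chevalley generator. *)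
Lemma std_gen_h : std_generators g ->
  gh (gen_h g i) != 0 /\ p i = (cartan_mx g i i != 2).
Proof.
move=> /(_ i)[ty [theta [rt _ [he hE e0 E0] _ nrm]]].
have pE : p i = if ty is TakSl2 then false else true.
  set q := (if ty is TakSl2 then _ else _) in he *.
  apply/eqP/negPn/negP => pq; have {pq} pq : p i = ~~ q by case: (p i) q pq {he hE nrm} => [] [].
  have h1 := fr_he hf i; rewrite pq in h1; have := homog_oppo he.
  by rewrite (h1 : spr _ _ = _) => /eqP; rewrite (negPf e0).
rewrite mxE pE; case: ty rt nrm pE {he hE} => rt nrm pE; rewrite /gen_h.
- rewrite nrm eqxx; split=> //; apply: (weight_gen_h_neq0 rt).
  by rewrite /gen_h nrm pnatr_eq0.
- rewrite nrm; split; last by rewrite -subr_eq0 (_ : 1 - 2 = -1) ?oppr_eq0 ?oner_eq0 //; ring.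
  by apply: (weight_gen_h_neq0 rt); rewrite /gen_h nrm oner_eq0.
- case: rt => ph [mph rph kph]; split; first exact: (sl11_gen_h_neq0 pE mph rph kph).
  by have := sl11_alpha_h pE mph rph kph; rewrite /gen_h => ->; rewrite eq_sym pnatr_eq0.
Qed.
End RootTypes.

(** * Realizations and coroots *)

(** Evaluated on a finite spanning family, independent functionals give a matrix with independent
    rows; a right inverse of it solves the interpolation problem. *)
Lemma dual_exists (F : numClosedFieldType) (V : lmodType F) n (al : 'I_n -> {scalar V}) :
  findim V -> (forall c : 'I_n -> F, (forall x, \sum_i c i * al i x = 0) -> forall i, c i = 0) ->
  forall c : 'I_n -> F, exists x, forall i, al i x = c i.
Proof.
move=> [m [e se]] fr c; pose M : 'M[F]_(n, m) := \matrix_(i, j) al i (e j).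
have /row_freeP[N MN] : row_free M.
  apply: inj_row_free => v vM; apply/rowP => i; rewrite [RHS]mxE.
  apply: (fr (fun i => v 0 i)) => x; have [d ->] := se x.
  under eq_bigr do rewrite linear_sum mulr_sumr.
  rewrite exchange_big big1 // => j _ /=.
  transitivity (d j * (v *m M) 0 j); last by rewrite vM mxE mulr0.
  rewrite mxE mulr_sumr; apply: eq_bigr => k _.
  by rewrite linearZ /= mxE mulrCA.
exists (\sum_j (N *m (\col_i c i)) j 0 *: e j) => i.
have := congr1 (fun u : 'cV[F]_n => u i 0) (congr1 (mulmx^~ (\col_i c i)) MN).
rewrite mul1mx -mulmxA [RHS]mxE => <-; rewrite linear_sum mxE.
by apply: eq_bigr => j _; rewrite linearZ /= !mxE mulrC.
Qed.

Lemma weighted_cartan (F : numClosedFieldType) n (D : datum F n) : cartan_datum D -> weighted D.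
Proof.
move=> hD; split; [exact: (cd_quasi_toral hD) | exact: (cd_mod_weight hD) |].
move=> c; have [x xc] := dual_exists (cd_findim hD) (cd_alpha_free hD) c.
exists (spr false x); first exact: homog_spr.
move=> i; rewrite -xc -[in RHS](spr_sum x) linearD /=.
by rewrite (cd_alpha_odd hD i (homog_spr true x)) addr0.
Qed.

Section Realization.
Variables (F : numClosedFieldType) (n : nat) (A : 'M[F]_n) (t : vectType F).
Variables (ta : 'I_n -> {scalar t}) (th : 'I_n -> t).
Hypothesis mr : min_realization A ta th.
Local Notation Ds := (km_datum A ta th).

Lemma weighted_km : weighted Ds.
Proof.
case: mr => fr _ _ _; split=> //; move=> c.
have [|x xc] := @dual_exists _ t n ta _ fr c; last by exists x.
exists (\dim (fullv : {vspace t})), (fun j => (vbasis fullv)`_j) => v.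
by exists (fun j => coord (vbasis fullv) j v); apply: coord_vbasis; apply: memvf.
Qed.

Section Coroots.
Variables (D : datum F n) (g : generators D).
Variables (p : 'I_n -> bool) (eta phi : 'I_n -> dh D -> F).
Hypothesis hD : cartan_datum D.
Hypothesis hf : frame g p eta phi.
Hypothesis hA : A = cartan_mx g.
Hypothesis hp : forall i, p i = (A i i != 2).

(** A map built from a dual basis has the right root values but may miss the h_i. The errors [d i]
    are invisible to all roots, because the coroots have the same root values a_ij as the h_i; as
    the coroots are independent, the errors can be added back along their coordinates. *)
Lemma torus_lift : exists a : t -> dh D, [/\ forall c x y, a (c *: x + y) = c *: a x + a y,
  forall x, homog false (a x), forall j x, dalpha D j (a x) = ta j x
  & forall i, a (th i) = gen_h g i].
Proof.
have [fta fth eA _] := mr.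
have /choice[b Hb] : forall j : 'I_n, exists x : dh D,
    homog false x /\ forall i, dalpha D i x = (i == j)%:R.
  by move=> j; have [x hx xj] := w_dual (weighted_cartan hD) (fun i => (i == j)%:R); exists x.
pose X := [tuple th i | i < n].
have fX : free X.
  apply/freeP => k Hk i; apply: fth => //.
  by rewrite -[RHS]Hk; apply: eq_bigr => j _; rewrite -tnth_nth tnth_mktuple.
pose a0 x : dh D := \sum_j ta j x *: b j.
have al0 j x : dalpha D j (a0 x) = ta j x.
  rewrite /a0 linear_sum (bigD1 j) //= linearZ /= (Hb j).2 eqxx mulr1 big1 ?addr0 // => k kj.
  by rewrite linearZ /= (Hb k).2 eq_sym (negPf kj) mulr0.
have a0_lin c x y : a0 (c *: x + y) = c *: a0 x + a0 y.
  rewrite /a0 scaler_sumr -big_split; apply: eq_bigr => j _ /=.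
  by rewrite linearP scalerDl scalerA.
have h0 x : homog false (a0 x).
  rewrite /a0; elim/big_rec: _ => [|j y _ hy]; first exact: homog0.
  by apply: homogD => //; apply: homogZ; case: (Hb j).
pose d i := gen_h g i - a0 (th i).
exists (fun x => a0 x + \sum_i coord X i x *: d i); split.
- move=> c x y; rewrite a0_lin scalerDr addrACA; congr (_ + _).
  rewrite scaler_sumr -big_split; apply: eq_bigr => j _ /=.
  by rewrite linearP scalerDl scalerA.
- move=> x; apply: homogD => //; elim/big_rec: _ => [|j y _ hy]; first exact: homog0.
  apply: homogD => //; apply: homogZ; apply: homogD; first exact: (gen_h_even hD hf).
  exact: homogN.
- move=> j x; rewrite linearD /= al0 linear_sum big1 ?addr0 // => i _.
  rewrite linearZ /= linearB /= al0 eA hA mxE subrr mulr0 //.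
- move=> i; rewrite (bigD1 i) //= big1 => [|j ji].
    have := coord_free i i fX; rewrite -tnth_nth tnth_mktuple eqxx => ->.
    by rewrite addr0 scale1r addrC subrK.
  have := coord_free i j fX; rewrite -tnth_nth tnth_mktuple eq_sym (negPf ji) => ->.
  by rewrite scale0r.
Qed.

(** The Chevalley generators can be sent to e_i, f_i, which gives a homomorphism from g~ of the
    datum of s to g mapping the coroot to h_i. A coroot vanishing in s already vanishes in g~, since
    h is not affected by the maximal ideal. *)
Lemma km_coroot_neq0 i : gh (gen_h g i) != 0 -> gh (th i : dh Ds) != 0.
Proof.
have [a [a_lin ha aal ath]] := torus_lift.
pose fh (x : dh Ds) : galg D := gh (a x).
pose rt s i : galg D := if s then groot (gen_f g i) else groot (gen_e g i).
pose fr s i (v : dmod Ds s i) : galg D := (v : F) *: rt s i.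
have hrt s j : homog (A j j != 2) (rt s j).
  rewrite -hp; case: s; apply: (cs_root_homog (galg_sys D)).
    exact: (fr_hf hf).
  exact: (fr_he hf).
have wD := weighted_cartan hD.
have art s x j : br (fh x) (rt s j) = ((-1) ^+ s * ta j x) *: rt s j.
  by case: s; rewrite /fh galg_act (w_mod wD) ?aal // [LHS](cs_rootZ (galg_sys D)).
have [|||||||| f [mf fhE _]] := @gtilde_lift F n Ds (galg D) fh fr.
- by move=> c x y; rewrite /fh a_lin [LHS](cs_h_lin (galg_sys D)).
- case=> x; rewrite /fh; last exact/esym/(cs_h_homog (galg_sys D) (ha x)).
  have -> : a (spr true x) = 0 by have := a_lin (-1) 0 0; rewrite scaler0 addr0 scaleN1r addNr.
  by rewrite [LHS](cs_h0 (galg_sys D)) [RHS](homog_oppo (cs_h_homog (galg_sys D) (ha x))).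
- by move=> s j c v w; rewrite /fr scalerDl scalerA.
- move=> s j b v; rewrite /fr sprZ.
  have -> : (spr b v : F) = if b == (A j j != 2) then v : F else 0 by [].
  case: eqP => [->|/eqP bn].
    by rewrite (hrt s j : spr _ _ = _).
  have -> : b = ~~ (A j j != 2) by case: b (A j j != 2) bn => [] [].
  by rewrite (homog_oppo (hrt s j)) scaler0 scale0r.
- move=> x y; rewrite /fh [LHS](cs_h_br (galg_sys D)) (w_toral wD) //=.
  have -> : a 0 = 0 by have := a_lin (-1) 0 0; rewrite scaler0 addr0 scaleN1r addNr.
  by [].
- by move=> s j x v; rewrite /fr brZr art scalerA /= mulrC.
- move=> j u v; rewrite /fr brZl brZr scalerA /rt galg_pair /fh /=.
  have -> : a (((u : F) * (v : F)) *: th j) = ((u : F) * (v : F)) *: gen_h g j.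
    have a0 : a 0 = 0 by have := a_lin (-1) 0 0; rewrite scaler0 addr0 scaleN1r addNr.
    by rewrite -[_ *: th j]addr0 a_lin a0 addr0 ath.
  by rewrite [RHS](cs_hZ (galg_sys D)).
- move=> j k u v jk; rewrite /fr brZl brZr /rt /groot -(morph_br (lie_pi_morph _)).
  rewrite -/(gt_root _) -/(gt_root (gen_f g k)) gt_neq // (morph0 (lie_pi_morph _)).
  by rewrite !scaler0.
apply: contraNneq => /(gh_eq0 weighted_km) e0.
by have := fhE (th i); rewrite e0 (morph0 mf) /fh ath => <-.
Qed.
End Coroots.
End Realization.

(** * The Takiff superalgebra modulo J_s *)

Lemma ann_br (F : fieldType) (L : lieSuper F) a (u v w : L) :
  homog a u -> br u v = 0 -> br u w = 0 -> br u (br v w) = 0.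
Proof.
move=> hu uv uw; have H b : br u (br (spr b v) w) = 0.
  rewrite (br_jacobi w hu (homog_spr b v)) uw br0r scaler0 addr0 -(hu : spr a u = u).
  have -> : b = a (+) (a (+) b) by rewrite addbA addbb.
  by rewrite -spr_brl (hu : spr a u = u) uv spr0 br0l.
by rewrite -[v]spr_sum brDl brDr !H addr0.
Qed.

Section TakiffOfKM.
Variables (F : numClosedFieldType) (n : nat) (A : 'M[F]_n) (t : vectType F).
Variables (ta : 'I_n -> {scalar t}) (th : 'I_n -> t).
Hypothesis mr : min_realization A ta th.
Local Notation Ds := (km_datum A ta th).
Local Notation gs := (galg Ds).
Local Notation sys := (galg_sys Ds).
Variable ob : option (inv_form gs F^o).
Local Notation T := (takiff ob).
Local Notation B := (tak_form ob).
Local Notation telt x y d k z := (@tak_elt F gs (tak_center ob) x y d k z : T).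
Local Notation ghs := (@gh F n Ds).

Let wDs : weighted Ds := weighted_km mr.

Definition rt s i : gs := @groot F n Ds s i (1 : F).

Lemma grootE s i (v : dmod Ds s i) : groot v = (v : F) *: rt s i.
Proof. by rewrite -[RHS](cs_rootZ sys); congr (groot _); rewrite -[RHS]/(_ * _) mulr1. Qed.

Lemma rt_homog s i : homog (A i i != 2) (rt s i).
Proof. by apply: (cs_root_homog sys); rewrite /homog /= eqxx. Qed.

Lemma gh_rt x s i : br (ghs x) (rt s i) = ((-1) ^+ s * ta i x) *: rt s i.
Proof.
rewrite [LHS](cs_act sys) [LHS]grootE; congr (_ *: _).
exact: (mulr1 ((-1) ^+ s * ta i x)).
Qed.

Lemma gh_gh x y : br (ghs x) (ghs y) = 0.
Proof. by rewrite [LHS](cs_h_br sys) [LHS](cs_h0 sys). Qed.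

Lemma rt_pair i : br (rt false i) (rt true i) = ghs (th i).
Proof. by rewrite /rt galg_pair /= mulr1 scale1r. Qed.

Lemma rt_neq i j : i != j -> br (rt false i) (rt true j) = 0.
Proof.
move=> ij; rewrite /rt /groot -(morph_br (lie_pi_morph _)).
by rewrite -/(gt_root _) -/(@gt_root _ _ Ds true j 1) gt_neq // (morph0 (lie_pi_morph _)).
Qed.

Lemma gh_even x : homog false (ghs x).
Proof. exact: (cs_h_homog sys). Qed.

Lemma npart_rt_ind (U : set gs) s : graded_subspace U ->
  (forall i, U (rt s i)) -> (forall i x, U x -> U (br (rt s i) x)) ->
  forall p x, npart sys s p x -> U x.
Proof.
move=> gU U0 U1; apply: npart_ind_root => // [i v|i v x Ux].
  by rewrite [cs_root _ _]grootE; apply: (gsubZ gU).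
by rewrite [cs_root _ _]grootE brZl; apply: (gsubZ gU); apply: U1.
Qed.

(** The torus is abelian, so bracketing with one of its elements removes the component of degree 0
    and only n_- and n_+ matter. *)
Lemma torus_bracket_in (U : set gs) y : graded_subspace U ->
  (forall s p x, npart sys s p x -> U x) -> forall x, U (br (ghs y) x).
Proof.
move=> gU H x; have := zspan_all sys x.
apply: (@zspan_lin_ind _ _ _ _ sys predT [set x | U (br (ghs y) x)]).
  split=> [|c z w|b z]; rewrite /mkset.
  - by rewrite br0r; apply: (gsub0 gU).
  - by move=> Uz Uw; rewrite br_linr; apply: (gsubD gU) => //; apply: (gsubZ gU).
  - move=> Uz; rewrite -(gh_even y : spr false _ = _) -(spr_brl false b).
    by rewrite (gh_even y : spr false _ = _); apply: (gsub_spr gU).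
rewrite /mkset => -[[|q]|q] z _; last 2 first.
- by move=> zq; apply: (H false q); apply: (npart_h (cs := sys)).
- by move=> zq; apply: (H true q); apply: (npart_h (cs := sys)).
by case=> w _ <-; rewrite [br _ _]gh_gh; apply: (gsub0 gU).
Qed.

Lemma tak_brE x y d k z x' y' d' k' z' :
  br (telt x y d k z) (telt x' y' d' k' z') =
  telt (br x x' + d *: stw y' + d' *: y) (br x y' + br y (stw x')) 0 (B y (stw y')) (d * d').
Proof. by []. Qed.

Lemma stw_rt s i : stw (rt s i) = (-1) ^+ (A i i != 2) *: rt s i.
Proof. exact: stw_homog (rt_homog s i). Qed.

Lemma stw0 (V : superspace F) : stw (0 : V) = 0.
Proof. by rewrite /stw !spr0 subr0. Qed.

Definition kills (u : T) (y : gs) : Prop :=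
  br u (telt y 0 0 0 0) = 0 /\ br u (telt 0 y 0 0 0) = 0.

(** J_s as tested on simple root vectors of both signs only; [JsE] shows that this is the same
    set. *)
Definition JsG (u : T) : Prop := forall s i, kills u (rt s i).

Lemma teltD x y d k z x' y' d' k' z' : telt x y d k z + telt x' y' d' k' z' =
  telt (x + x') (y + y') (d + d') (k + k') (z + z').
Proof. by []. Qed.
Lemma teltZ c x y d k z : c *: telt x y d k z = telt (c *: x) (c *: y) (c * d) (c *: k) (c * z).
Proof. by []. Qed.
Lemma spr_telt b x y d k z : spr b (telt x y d k z) =
  telt (spr b x) (spr (~~ b) y) (if b then d else 0) (if b then 0 else k) (if b then 0 else z).
Proof. by []. Qed.

Lemma br_central (u : T) k z : br u (telt 0 0 0 k z) = 0.
Proof.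
case: u => [[[[x y] d] k1] z1]; rewrite -/(telt x y d k1 z1) tak_brE stw0.
by rewrite !br0r Defs.form0r scaler0 scale0r mulr0 !addr0.
Qed.

Lemma kills_sub a u : homog a u -> graded_subspace (kills u).
Proof.
move=> hu; split.
- by split; apply: br_central.
- move=> c x y [x1 x2] [y1 y2]; split.
    have -> : telt (c *: x + y) 0 0 0 0 = c *: telt x 0 0 0 0 + telt y 0 0 0 0.
      by rewrite teltZ teltD !(scaler0, mulr0, addr0).
    by rewrite br_linr x1 y1 scaler0 addr0.
  have -> : telt 0 (c *: x + y) 0 0 0 = c *: telt 0 x 0 0 0 + telt 0 y 0 0 0.
    by rewrite teltZ teltD !(scaler0, mulr0, addr0).
  by rewrite br_linr x2 y2 scaler0 addr0.
- have H b (w : T) : br u w = 0 -> br u (spr b w) = 0.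
    move=> uw; rewrite -(hu : spr a u = u).
    have -> : b = a (+) (a (+) b) by rewrite addbA addbb.
    by rewrite -spr_brl (hu : spr a u = u) uw spr0.
  move=> b x [x1 x2]; split.
    by move: (H b _ x1); rewrite spr_telt spr0; case: b.
  by move: (H (~~ b) _ x2); rewrite spr_telt spr0 negbK; case: b.
Qed.

Lemma kills_br a u x y : homog a u -> kills u x -> kills u y -> kills u (br x y).
Proof.
move=> hu [x1 x2] [y1 y2]; split.
  have -> : telt (br x y) 0 0 0 0 = br (telt x 0 0 0 0) (telt y 0 0 0 0).
    by rewrite tak_brE stw0 !scale0r br0r br0l Defs.form0l mulr0 !addr0.
  exact: ann_br hu _ _.
have -> : telt 0 (br x y) 0 0 0 = br (telt x 0 0 0 0) (telt 0 y 0 0 0).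
  by rewrite tak_brE stw0 !scale0r br0r br0l Defs.form0l mulr0 !addr0.
exact: ann_br hu _ _.
Qed.

Lemma rt_telt_homog s i : homog (A i i != 2) (telt (rt s i) 0 0 0 0)
  /\ homog (~~ (A i i != 2)) (telt 0 (rt s i) 0 0 0).
Proof.
have h := rt_homog s i; split; rewrite /homog spr_telt spr0.
  by rewrite (h : spr _ _ = _); case: (_ != _).
by rewrite negbK (h : spr _ _ = _); case: (_ != _).
Qed.

Lemma JsG_sub : graded_subspace JsG.
Proof.
split.
- by move=> s i; split; rewrite br0l.
- by move=> c u v Ju Jv s i; have [u1 u2] := Ju s i; have [v1 v2] := Jv s i;
    split; rewrite br_linl ?u1 ?v1 ?u2 ?v2 scaler0 addr0.
- move=> b u Ju s i; have [u1 u2] := Ju s i; have [h1 h2] := rt_telt_homog s i.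
  have H a (w : T) : homog a w -> br u w = 0 -> br (spr b u) w = 0.
    move=> hw uw; rewrite -(hw : spr a w = w).
    have -> : b = a (+) (a (+) b) by rewrite addbA addbb.
    by rewrite -spr_brr (hw : spr a w = w) uw spr0.
  by split; [apply: (H _ _ h1) | apply: (H _ _ h2)].
Qed.

Lemma JsG_npart a u : homog a u -> JsG u -> forall s p x, npart sys s p x -> kills u x.
Proof.
move=> hu Ju s; apply: npart_rt_ind; first exact: (kills_sub hu).
  by move=> i; apply: Ju.
by move=> i x kx; apply: (kills_br hu) => //; apply: Ju.
Qed.

Lemma rt_weight (s : bool) (i : 'I_n) :
  weight_space ghs (fun j => if j == i then (-1) ^+ s else 0) (rt s i).
Proof.
move=> x _; have -> : \sum_j (if j == i then (-1) ^+ s else 0 : int)%:~R * dalpha Ds j x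
    = (-1) ^+ s * ta i x.
  rewrite (bigD1 i) //= eqxx big1 => [|j /negPf ->]; last by rewrite mul0r.
  by rewrite addr0; congr (_ * _); case: s.
exact: gh_rt.
Qed.

Lemma weight0 k : weight_space ghs k 0.
Proof. by move=> x _; rewrite br0r scaler0. Qed.

Lemma weight_elt (k : 'I_n -> int) : (exists i, k i != 0) ->
  exists x : t, \sum_i (k i)%:~R * ta i x = 1.
Proof.
case=> i ki; have [x _ xc] := w_dual wDs (fun j => if j == i then (k i)%:~R^-1 else 0).
exists x; rewrite (bigD1 i) //= big1 => [|j /negPf ji].
  by rewrite [ta i x]xc eqxx addr0 divff // intr_eq0.
by rewrite [ta j x]xc ji mulr0.
Qed.

(** A vector of nonzero weight is its own bracket with a suitable toral element, so it lies in n_- +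
    n_+. That space is generated by simple root vectors, and what a homogeneous [u] annihilates is
    closed under brackets. *)
Lemma JsE : Js ob = JsG.
Proof.
rewrite predeqE => u; split=> [Ju s i|Ju].
  have k0 : exists j, (if j == i then (-1) ^+ s else 0 : int) != 0.
    by exists i; rewrite eqxx signr_eq0.
  by split; apply: (Ju _ k0); try exact: weight0; apply: rt_weight.
move=> k k0 x y wx wy; have [x0 e0] := weight_elt k0.
suff H b : br (spr b u) (tak_tensor ob x y) = 0 by rewrite -[u]spr_sum brDl !H addr0.
have hu := homog_spr b u; have Jb := gsub_spr JsG_sub b Ju.
have K z : weight_space ghs k z -> kills (spr b u) z.
  move=> wz; have <- : br (ghs x0) z = z by rewrite (wz x0) // e0 scale1r.
  by apply: torus_bracket_in; [exact: (kills_sub hu) | exact: (JsG_npart hu)].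
have -> : tak_tensor ob x y = telt x 0 0 0 0 + telt 0 y 0 0 0 by rewrite teltD !addr0 add0r.
by rewrite brDr (K x wx).1 (K y wy).2 addr0.
Qed.

Lemma kills_s_rt a u : homog a u -> JsG u -> forall x s i, kills u (br x (rt s i)).
Proof.
move=> hu Ju x s i; have gK := kills_sub hu; have := zspan_all sys x.
apply: (@zspan_lin_ind _ _ _ _ sys predT [set x | kills u (br x (rt s i))]).
  split=> [|c z w|b z]; rewrite /mkset.
  - by rewrite br0l; apply: (gsub0 gK).
  - by move=> Uz Uw; rewrite br_linl; apply: (gsubD gK) => //; apply: (gsubZ gK).
  - move=> Uz; have hw := rt_homog s i; set q := (A i i != 2) in hw.
    rewrite -(hw : spr q _ = _); have -> : b = q (+) (q (+) b) by rewrite addbA addbb.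
    by rewrite -spr_brr (hw : spr q _ = _); apply: (gsub_spr gK).
rewrite /mkset => -[[|q]|q] z _; last 2 first.
- by move=> zq; apply: (kills_br hu); [apply: (JsG_npart hu Ju zq) | apply: Ju].
- by move=> zq; apply: (kills_br hu); [apply: (JsG_npart hu Ju zq) | apply: Ju].
by case=> w _ <-; rewrite [br _ _]gh_rt; apply: (gsubZ gK); apply: Ju.
Qed.

(** For a root vector w, [[[v, u], w]] is, up to sign, [[u, [v, w]]]. The bracket [[v, w]] consists
    of brackets of elements of s with simple root vectors, of multiples of w (x) 1 coming from the
    derivation, and of central terms; [u] annihilates each of these. *)
Lemma JsG_ideal : lie_ideal JsG.
Proof.
split; first exact: JsG_sub.
move=> v u Ju; have gJ := JsG_sub.
suff H a b : JsG (br (spr b v) (spr a u)).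
  by rewrite -[v]spr_sum -[u]spr_sum !(brDl, brDr); do !apply: (gsubD gJ).
have hu := homog_spr a u; have hv := homog_spr b v.
move: (spr a u) (spr b v) hu hv (gsub_spr gJ a Ju) => {Ju}u {}v hu hv Ju s i.
have N (w : T) : br u w = 0 -> br u (br v w) = 0 -> br (br v u) w = 0.
  move=> uw uvw; have := br_jacobi w hv hu; rewrite uw br0r uvw scaler0 addr0.
  by move->.
have [k1 k2] := Ju s i; have gK := kills_sub hu.
case: v hv N => [[[[x y] d] k] z]; rewrite -/(telt x y d k z) => hv N.
split; apply: N => //; rewrite tak_brE !stw0.
- have -> : telt (br x (rt s i) + d *: 0 + 0 *: y) (br x 0 + br y (stw (rt s i))) 0 (B y 0) (d * 0)
     = telt (br x (rt s i)) 0 0 0 0 + telt 0 (br y (stw (rt s i))) 0 0 0.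
    by rewrite teltD br0r Defs.form0r scaler0 scale0r mulr0 !addr0 !add0r.
  rewrite brDr (kills_s_rt hu Ju x s i).1 add0r stw_rt brZr.
  exact: (gsubZ gK _ (kills_s_rt hu Ju y s i)).2.
- have -> : telt (br x 0 + d *: stw (rt s i) + 0 *: y) (br x (rt s i) + br y 0) 0
      (B y (stw (rt s i))) (d * 0)
     = telt (d *: stw (rt s i)) 0 0 0 0 + telt 0 (br x (rt s i)) 0 0 0
       + telt 0 0 0 (B y (stw (rt s i))) 0.
    by rewrite !teltD !br0r scale0r mulr0 !addr0 !add0r.
  rewrite !brDr br_central addr0 (kills_s_rt hu Ju x s i).2 addr0 stw_rt scalerA.
  exact: (gsubZ gK _ (Ju s i)).1.
Qed.

(** A root vector is a bracket with a toral element, and invariance moves this element to the other,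
    abelian, side. *)
Lemma form_gh_rt y s i : B (ghs y) (rt s i) = 0.
Proof.
have [r _ r1] := w_dual wDs (fun=> 1).
have -> : rt s i = (-1) ^+ s *: br (ghs r) (rt s i).
  by rewrite gh_rt [ta i r]r1 mulr1 scalerA -signr_addb addbb scale1r.
by rewrite Defs.formZr -form_inv gh_gh Defs.form0l scaler0.
Qed.

(** The tool for checking relations modulo J_s: two toral elements without derivation component
    agree there as soon as their root values do. *)
Lemma JsG_torus x y k z : (forall j, ta j x = 0) -> (forall j, ta j y = 0) ->
  JsG (telt (ghs x) (ghs y) 0 k z).
Proof.
move=> x0 y0 s i; split; rewrite tak_brE.
  rewrite stw0 Defs.form0r stw_rt brZr !gh_rt x0 y0 !mulr0 !scale0r br0r scaler0.
  by rewrite !addr0.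
rewrite stw0 stw_rt Defs.formZr form_gh_rt !scaler0 gh_rt x0 !mulr0 !scale0r !br0r.
by rewrite !addr0.
Qed.

Lemma JsG_central k z : JsG (telt 0 0 0 k z).
Proof.
have h0 : ghs 0 = 0 := cs_h0 sys.
by rewrite -h0; apply: JsG_torus => j; rewrite linear0.
Qed.

(** Both coefficients of such an element are killed by all opposite simple root vectors, so they are
    singular in s and vanish. *)
Lemma JsG_npart0 s p y y' k z : npart sys s p y -> npart sys s p y' ->
  JsG (telt y y' 0 k z) -> y = 0 /\ y' = 0.
Proof.
move=> py py' J.
suff H x : npart sys s p x -> (forall j, br x (rt (~~ s) j) = 0) -> x = 0.
  split; apply: H => // j; have [J1 _] := J (~~ s) j.
    have : br y (rt (~~ s) j) + 0 *: stw 0 + 0 *: y' = 0 := congr1 (fun u => u.1.1.1.1) J1.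
    by rewrite !scale0r !addr0.
  have : br y 0 + br y' (stw (rt (~~ s) j)) = 0 := congr1 (fun u => u.1.1.1.2) J1.
  rewrite br0r add0r stw_rt brZr => /eqP; rewrite scaler_eq0 signr_eq0 => /eqP.
  by [].
move=> px H; apply: (singular0 wDs (s := s)); exists p => // j w.
by rewrite grootE brZl (br_swap0 (rt_homog (~~ s) j) (H j)) scaler0.
Qed.

Lemma JsG_rt s i a b k z : ghs (th i) != 0 ->
  JsG (telt (a *: rt s i) (b *: rt s i) 0 k z) -> a = 0 /\ b = 0.
Proof.
move=> h0 J.
have r0 : rt s i != 0.
  apply: contraNneq h0 => r0; rewrite -rt_pair.
  by case: s {J} r0 => ->; rewrite ?br0l ?br0r.
have pr c : npart sys s 0 (c *: rt s i).
  by rewrite -(@grootE s i c); apply: np_gen.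
have [e1 e2] := JsG_npart0 (pr a) (pr b) J.
by split; [move/eqP: e1 | move/eqP: e2]; rewrite scaler_eq0 (negPf r0) orbF => /eqP.
Qed.
End TakiffOfKM.

(** * The embedding *)

Lemma addr_scale0 (F : fieldType) (V : lmodType F) (x y z : V) : x + 0 *: y + 0 *: z = x.
Proof. by rewrite !scale0r !addr0. Qed.

Lemma brZZ (F : fieldType) (L : lieSuper F) a b (x y : L) :
  br (a *: x) (b *: y) = (a * b) *: br x y.
Proof. by rewrite brZl brZr scalerA. Qed.

Lemma pair_br_lin (F : fieldType) (L : lieSuper F) (x y z : L) a b c d e :
  br x y = z -> a * b + c * d = e ->
  br (a *: x) (b *: y) + br (c *: x) (d *: y) = e *: z.
Proof. by move=> <- <-; rewrite !brZZ scalerDl. Qed.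

Section Embedding.
Variables (F : numClosedFieldType) (n : nat) (D : datum F n) (g : generators D).
Variables (p : 'I_n -> bool) (eta phi : 'I_n -> dh D -> F) (ph : dh D -> F).
Hypothesis hD : cartan_datum D.
Hypothesis hf : frame g p eta phi.
Hypothesis phE : forall i x, phi i x = ph x.
Hypothesis ph_lin : forall c x y, ph (c *: x + y) = c * ph x + ph y.
Hypothesis ph_even : forall x, homog false x -> ph x = 0.
Hypothesis ph_H : forall i, ph (gen_H g i) = 0.
Hypothesis eta_H : forall i j, eta j (gen_H g i) = cartan_mx g i j.
Hypothesis al_c : forall i j, dalpha D j (gen_c g i) = 0.
Hypothesis h_neq0 : forall i, gh (gen_h g i) != 0.
Hypothesis hp : forall i, p i = (cartan_mx g i i != 2).

Variables (t : vectType F) (ta : 'I_n -> {scalar t}) (th : 'I_n -> t).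
Hypothesis mr : min_realization (cartan_mx g) ta th.
Local Notation A := (cartan_mx g).
Local Notation Ds := (km_datum A ta th).
Local Notation gs := (galg Ds).
Local Notation sys := (galg_sys Ds).
Variable ob : option (inv_form gs F^o).
Local Notation T := (takiff ob).
Local Notation B := (tak_form ob).
Local Notation telt x y d k z := (@tak_elt F gs (tak_center ob) x y d k z : T).
Local Notation ghs := (@gh F n Ds).
Local Notation rt := (@rt F n A t ta th).
Local Notation JsG := (@JsG F n A t ta th ob).
Local Notation Tb := (lie_quot (Js ob)).
Local Notation piJ := (lie_pi (Js ob)).

Let wD : weighted D := weighted_cartan hD.
Let wDs : weighted Ds := weighted_km mr.

Lemma th_neq0 i : ghs (th i) != 0.
Proof. exact: (km_coroot_neq0 mr hD hf erefl hp (h_neq0 i)). Qed.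

Lemma piJ_eq u v : JsG (u - v) -> piJ u = piJ v.
Proof. by move=> J; apply/lie_pi_eq; apply: ideal_gen_sub; rewrite (JsE mr). Qed.
Lemma piJ_eq0 u : piJ u = 0 -> JsG u.
Proof.
by move/lie_pi_eq0; rewrite (JsE mr) ideal_gen_id //; apply: JsG_ideal.
Qed.
Let mJ := lie_pi_morph (Js ob).

Lemma telt_eq x x' y y' d d' k k' z z' : x = x' -> y = y' -> d = d' -> k = k' -> z = z' ->
  telt x y d k z = telt x' y' d' k' z'.
Proof. by do 5!move->. Qed.

Definition es s i : dmod D s i :=
  if s as b return dmod D b i then gen_f g i else gen_e g i.
Definition Es s i : dmod D s i :=
  if s as b return dmod D b i then gen_F g i else gen_E g i.
(* The sign in E_i |-> kap e_i (x) xi is forced by [d/dxi, y (x) xi] = (-1)^|y| y. *)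
Definition kap (s : bool) i : F := if s then 1 else (-1) ^+ p i.

Lemma es_homog s i : homog (p i) (es s i).
Proof. by case: s; [exact: (fr_hf hf) | exact: (fr_he hf)]. Qed.
Lemma Es_homog s i : homog (~~ p i) (Es s i).
Proof. by case: s; [exact: (fr_hF hf) | exact: (fr_hE hf)]. Qed.
Lemma es_neq0 s i : es s i != 0.
Proof. by case: s; [exact: (fr_f0 hf) | exact: (fr_e0 hf)]. Qed.
Lemma Es_neq0 s i : Es s i != 0.
Proof. by case: s; [exact: (fr_F0 hf) | exact: (fr_E0 hf)]. Qed.
Lemma es_span s i (v : dmod D s i) : exists m : F * F, v = m.1 *: es s i + m.2 *: Es s i.
Proof.
case: s v => v.
  by have [a [b ->]] := fr_spanN hf v; exists (a, b).
by have [a [b ->]] := fr_span hf v; exists (a, b).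
Qed.
Lemma kapK s i : kap s i * kap s i = 1.
Proof. by case: s; rewrite /kap ?mulr1 // -signr_addb addbb. Qed.
Lemma kap_neq0 s i : kap s i != 0.
Proof. by case: s; rewrite /kap ?oner_neq0 ?signr_eq0. Qed.
Lemma act_es s i x : act x (es s i) = ((-1) ^+ s * dalpha D i x) *: es s i
  + (kap s i * (-1) ^+ p i * (-1) ^+ s * eta i x) *: Es s i.
Proof.
case: s; rewrite /es /Es /kap.
  by rewrite (fr_af hf) -scaleNr; congr (_ *: _ + _ *: _); ring.
by rewrite (fr_ae hf) -signr_addb addbb; congr (_ *: _ + _ *: _); ring.
Qed.
Lemma act_Es s i x : act x (Es s i) = ((-1) ^+ s * dalpha D i x) *: Es s i
  + (kap s i * (-1) ^+ p i * ph x) *: es s i.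
Proof.
case: s; rewrite /es /Es /kap.
  by rewrite (fr_aF hf) phE; congr (_ *: _ + _ *: _); ring.
by rewrite (fr_aE hf) phE -signr_addb addbb; congr (_ *: _ + _ *: _); ring.
Qed.

Definition co s i (v : dmod D s i) : F * F := projT1 (cid (es_span v)).
Lemma coE s i (v : dmod D s i) : v = (co v).1 *: es s i + (co v).2 *: Es s i.
Proof. by rewrite /co; case: cid. Qed.
Lemma co_uniq s i (a b : F) : co (a *: es s i + b *: Es s i) = (a, b).
Proof.
have := coE (a *: es s i + b *: Es s i).
move/(homog_indep (es_homog s i) (Es_homog s i) (es_neq0 s i) (Es_neq0 s i)) => [].
by case: (co _) => u w /= -> ->.
Qed.
Lemma co_lin s i c (v w : dmod D s i) :
  co (c *: v + w) = (c * (co v).1 + (co w).1, c * (co v).2 + (co w).2).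
Proof.
rewrite -(co_uniq s i) {1}(coE v) {1}(coE w); congr co.
by rewrite scalerDr !scalerA !scalerDl addrACA.
Qed.

Lemma dual_basis : exists b : 'I_n -> t, forall i j, ta j (b i) = (j == i)%:R.
Proof.
have /choice[b Hb] : forall i, exists b, forall j, ta j b = (j == i)%:R.
  by move=> i; have [x _ xc] := w_dual wDs (fun j => (j == i)%:R); exists x.
by exists b.
Qed.
Definition tb := projT1 (cid dual_basis).
Lemma tbE i j : ta j (tb i) = (j == i)%:R.
Proof. by rewrite /tb; case: cid. Qed.

Definition tcomb (c : 'I_n -> F) : t := \sum_i c i *: tb i.
Lemma ta_tcomb c j : ta j (tcomb c) = c j.
Proof.
rewrite /tcomb linear_sum (bigD1 j) //= linearZ /= tbE eqxx mulr1 big1 ?addr0 // => i ij.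
by rewrite linearZ /= tbE eq_sym (negPf ij) mulr0.
Qed.
Lemma tcomb_lin a (c d e : 'I_n -> F) : (forall i, e i = a * c i + d i) ->
  tcomb e = a *: tcomb c + tcomb d.
Proof.
move=> H; rewrite /tcomb scaler_sumr -big_split; apply: eq_bigr => i _ /=.
by rewrite H scalerDl scalerA.
Qed.
Lemma tcomb0 c : (forall i, c i = 0) -> tcomb c = 0.
Proof. by move=> H; rewrite /tcomb big1 // => i _; rewrite H scale0r. Qed.

(** The element of the torus of s with the same root values as [x]; modulo J_s only these values
    matter. *)
Definition tt x := tcomb (fun i => dalpha D i x).
Definition tt1 x := tcomb (fun i => eta i x).

Definition psih x : Tb := piJ (telt (ghs (tt x)) (ghs (tt1 x)) (ph x) 0 0).
Definition psir s i (v : dmod D s i) : Tb :=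
  piJ (telt ((co v).1 *: rt s i) (((co v).2 * kap s i) *: rt s i) 0 0 0).

Let ghs_lin c x y : ghs (c *: x + y) = c *: ghs x + ghs y := cs_h_lin sys c x y.
Let ghs0 : ghs 0 = 0 := cs_h0 sys.
Let eta_odd i x : eta i (spr true x) = eta i x.
Proof.
rewrite -{2}[x]spr_sum -[spr false x]scale1r (fr_eta_lin hf).
by rewrite (fr_eta_even hf _ (homog_spr false x)) mulr0 add0r.
Qed.
Let ph_odd x : ph (spr true x) = ph x.
Proof.
by rewrite -{2}[x]spr_sum -[spr false x]scale1r ph_lin (ph_even (homog_spr false x)) mulr0 add0r.
Qed.
Let al_even i x : dalpha D i (spr false x) = dalpha D i x.
Proof. by rewrite -{2}[x]spr_sum linearD /= (cd_alpha_odd hD i (homog_spr true x)) addr0. Qed.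

Lemma psih_lin c x y : psih (c *: x + y) = c *: psih x + psih y.
Proof.
rewrite /psih -(morph_lin mJ); congr piJ.
have -> : tt (c *: x + y) = c *: tt x + tt y by apply: tcomb_lin => i; rewrite linearP.
have -> : tt1 (c *: x + y) = c *: tt1 x + tt1 y.
  by apply: tcomb_lin => i; apply: (fr_eta_lin hf).
by rewrite !ghs_lin ph_lin teltZ teltD !(scaler0, mulr0, addr0).
Qed.

Lemma psih_spr b x : psih (spr b x) = spr b (psih x).
Proof.
rewrite /psih -(morph_spr mJ) spr_telt; congr piJ.
have H (y : t) : spr true (ghs y) = 0 := homog_oppo (gh_even y).
have H0 (y : t) : spr false (ghs y) = ghs y := gh_even y.
case: b.
  rewrite [spr true (ghs _)]H [spr (~~ true) _]H0.
  have -> : tt (spr true x) = 0.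
    by apply: tcomb0 => i; rewrite (cd_alpha_odd hD i (homog_spr true x)).
  have -> : tt1 (spr true x) = tt1 x by apply: eq_bigr => i _; rewrite eta_odd.
  by rewrite ghs0 ph_odd.
rewrite [spr false (ghs _)]H0 [spr (~~ false) _]H.
have -> : tt (spr false x) = tt x by apply: eq_bigr => i _; rewrite al_even.
have -> : tt1 (spr false x) = 0.
  by apply: tcomb0 => i; rewrite (fr_eta_even hf _ (homog_spr false x)).
by rewrite ghs0 (ph_even (homog_spr false x)).
Qed.

Lemma psir_lin s i c (v w : dmod D s i) : psir (c *: v + w) = c *: psir v + psir w.
Proof.
rewrite /psir co_lin -(morph_lin mJ) teltZ teltD; congr piJ; apply: telt_eq.
- by rewrite scalerA -scalerDl.
- by rewrite scalerA -scalerDl mulrDl mulrA.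
- by rewrite mulr0 addr0.
- by rewrite scaler0 addr0.
- by rewrite mulr0 addr0.
Qed.

Lemma psir_spr s i b (v : dmod D s i) : psir (spr b v) = spr b (psir v).
Proof.
rewrite /psir -(morph_spr mJ) spr_telt !sprZ; congr piJ.
have hr := rt_homog A ta th s i; rewrite -hp in hr.
have cb : co (spr b v) = if b == p i then ((co v).1, 0) else (0, (co v).2).
  have [-> |bp] := eqVneq b (p i).
    rewrite -(co_uniq s i); congr co; rewrite {1}(coE v) sprD !sprZ.
    have := homog_oppo (Es_homog s i); rewrite negbK => ->.
    by rewrite (es_homog s i : spr _ _ = _) scaler0 scale0r.
  have {bp} -> : b = ~~ p i by case: b (p i) bp => [] [].
  rewrite -(co_uniq s i); congr co; rewrite {1}(coE v) sprD !sprZ.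
  rewrite (homog_oppo (es_homog s i)) (Es_homog s i : spr _ _ = _).
  by rewrite scaler0 scale0r.
rewrite cb; have [-> |bp] := eqVneq b (p i).
  apply: telt_eq.
  - by rewrite (hr : spr _ _ = _).
  - by rewrite (homog_oppo hr) scaler0 mul0r scale0r.
  - by case: (p i).
  - by case: (p i).
  - by case: (p i).
have {bp} -> : b = ~~ p i by case: b (p i) bp {cb} => [] [].
apply: telt_eq.
- by rewrite (homog_oppo hr) scaler0 scale0r.
- by rewrite negbK (hr : spr _ _ = _).
- by case: (p i).
- by case: (p i).
- by case: (p i).
Qed.

(** Only the odd parts of [x] and [y] contribute to [[x, y]]. The central terms and the toral
    difference lie in J_s, the latter by [alpha_j([x, y]) = phi(x) eta_j(y) + phi(y) eta_j(x)],
    which is read off from the action on e_j. *)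
Lemma psih_br x y : br (psih x) (psih y) = psih (br x y).
Proof.
rewrite /psih -(morph_br mJ) tak_brE; apply: piJ_eq.
have hb : br x y = br (spr true x) (spr true y).
  rewrite -{1}[x]spr_sum -{1}[y]spr_sum !(brDl, brDr).
  rewrite !(cd_quasi_toral hD _ (homog_spr false x)) !add0r.
  rewrite (br_skew (homog_spr true x) (homog_spr false y)).
  by rewrite (cd_quasi_toral hD _ (homog_spr false y)) scaler0 oppr0 add0r.
have h0 : homog false (br x y).
  by rewrite hb; apply: (br_homog (homog_spr true x) (homog_spr true y)).
have -> : tt1 (br x y) = 0 by apply: tcomb0 => i; rewrite (fr_eta_even hf).
have s0 (z : t) : stw (ghs z) = ghs z.
  by rewrite (stw_homog (gh_even z)) scale1r.
have -> : telt (br (ghs (tt x)) (ghs (tt y)) + ph x *: stw (ghs (tt1 y)) + ph y *: ghs (tt1 x))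
    (br (ghs (tt x)) (ghs (tt1 y)) + br (ghs (tt1 x)) (stw (ghs (tt y)))) 0
    (B (ghs (tt1 x)) (stw (ghs (tt1 y)))) (ph x * ph y)
    - telt (ghs (tt (br x y))) (ghs 0) (ph (br x y)) 0 0
  = telt (ghs (ph x *: tt1 y + (ph y *: tt1 x - tt (br x y)))) (ghs 0) 0
    (B (ghs (tt1 x)) (stw (ghs (tt1 y)))) (ph x * ph y).
  rewrite -[X in _ - X]scale1r -scaleNr teltZ teltD; apply: telt_eq.
  - rewrite !s0 gh_gh add0r ghs_lin -addrA; congr (_ + _).
    by rewrite ghs_lin -[- tt _]scaleN1r -[-1 *: tt _]addr0 ghs_lin ghs0 addr0.
  - by rewrite s0 !gh_gh ghs0 scaler0 !addr0.
  - by rewrite (ph_even h0) mulr0 addr0.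
  - by rewrite scaler0 addr0.
  - by rewrite mulr0 addr0.
apply: (JsG_torus mr) => j; last by rewrite linear0.
rewrite linearD linearB !linearZ /= !ta_tcomb hb.
suff -> : dalpha D j (br (spr true x) (spr true y)) = ph x * eta j y + ph y * eta j x by ring.
have h1 := homog_spr true x; have h2 := homog_spr true y.
have := cd_mod_weight hD (gen_e g j) (br_homog h1 h2); rewrite mul1r.
rewrite (act_br _ h1 h2) scaleN1r opprK !(fr_ae hf) !(cd_alpha_odd hD j h1).
rewrite !(cd_alpha_odd hD j h2) !scale0r !add0r !actZr !(fr_aE hf) !phE.
rewrite !(cd_alpha_odd hD j h1) !(cd_alpha_odd hD j h2) !scale0r !add0r !scalerA -scalerDl.
move/eqP; rewrite -subr_eq0 -scalerBl scaler_eq0 (negPf (fr_e0 hf j)) orbF subr_eq0.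
by move/eqP => <-; rewrite !eta_odd !ph_odd; ring.
Qed.

(** This relation holds in T s itself, before passing to the quotient: toral elements are orthogonal
    to root vectors, so no c-term arises. *)
Lemma psi_act s i x (v : dmod D s i) : br (psih x) (psir v) = psir (act x v).
Proof.
rewrite /psih /psir -(morph_br mJ) tak_brE; congr piJ.
set a := (co v).1; set b := (co v).2.
have -> : co (act x v) =
   (a * ((-1) ^+ s * dalpha D i x) + b * (kap s i * (-1) ^+ p i * ph x),
    b * ((-1) ^+ s * dalpha D i x) + a * (kap s i * (-1) ^+ p i * (-1) ^+ s * eta i x)).
  rewrite -(co_uniq s i) {1}(coE v) actDr !actZr act_es act_Es; congr co.
  rewrite -/a -/b !scalerDr !scalerDl !scalerA; zmod_eq.
have sZ c : stw (c *: rt s i) = (c * (-1) ^+ p i) *: rt s i.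
  by rewrite hp /stw !sprZ -scalerBr -/(stw _) stw_rt scalerA.
apply: telt_eq.
- rewrite sZ brZr gh_rt ta_tcomb scale0r addr0 !scalerA -scalerDl; congr (_ *: _).
  by rewrite /=; ring.
- rewrite sZ !brZr !gh_rt !ta_tcomb !scalerA -scalerDl; congr (_ *: _) => /=.
  rewrite [in RHS]mulrDl; congr (_ + _); first by ring.
  transitivity (a * (-1) ^+ p i * ((-1) ^+ s * eta i x) * (kap s i * kap s i)); last by ring.
  by rewrite kapK mulr1.
- by [].
- by rewrite sZ Defs.formZr (form_gh_rt mr) scaler0.
- by rewrite mulr0.
Qed.
(** Here [X = A] enters: the xi-component of the left side is a multiple of the coroot, with root
    values a_ij, and must match the numbers eta_j(H_i). Similarly c_i must be invisible to the
    roots, and H_i must have no derivation component. *)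
Lemma psi_pair i (u : dmod D false i) (v : dmod D true i) :
  br (psir u) (psir v) = psih (dpair u v).
Proof.
rewrite /psih /psir -(morph_br mJ) tak_brE; apply: piJ_eq.
set a := (co u).1; set c := (co u).2; set a' := (co v).1; set c' := (co v).2.
have sZ d : stw (d *: rt true i) = (d * (-1) ^+ p i) *: rt true i.
  by rewrite hp /stw !sprZ -scalerBr -/(stw _) stw_rt scalerA.
have pE : dpair u v = (a * a') *: gen_h g i + ((a * c' + c * a') *: gen_H g i
    + (c * c') *: gen_c g i).
  rewrite (coE u) (coE v) -/a -/c -/a' -/c' /= (cd_pair_linl hD) (pairZl hD).
  rewrite !(cd_pair_linr hD) !(pairZr hD) (pair_eF hD hf) -/(gen_h g i) -/(gen_H g i).
  rewrite -/(gen_c g i) !scalerDr !scalerDl !scalerA; zmod_eq.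
clearbody a c a' c'.
have eh x : homog false x -> forall j, eta j x = 0 by move=> hx j; apply: (fr_eta_even hf).
have et j : eta j (dpair u v) = (a * c' + c * a') * A i j.
  rewrite pE (fr_eta_lin hf) (fr_eta_lin hf) eta_H (eh _ (gen_h_even hD hf i)).
  rewrite -[_ *: gen_c g i]addr0 (fr_eta_lin hf) (eh _ (gen_c_even hD hf i)).
  by rewrite (eh _ (homog0 _ false)); ring.
have at_ j : dalpha D j (dpair u v) = a * a' * A i j.
  rewrite pE linearP linearP /= linearZ /= al_c (cd_alpha_odd hD _ (gen_H_odd hD hf i)) mxE.
  by rewrite !mulr0 !addr0.
have pt : ph (dpair u v) = 0.
  rewrite pE !ph_lin ph_H (ph_even (gen_h_even hD hf i)).
  rewrite -[_ *: gen_c g i]addr0 ph_lin (ph_even (gen_c_even hD hf i)).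
  by rewrite (ph_even (homog0 _ false)); ring.
rewrite pt; have [_ _ eA _] := mr.
have k1 : kap false i * (-1) ^+ p i = 1 by rewrite -signr_addb addbb.
set k := B _ _.
have -> : telt (br (a *: rt false i) (a' *: rt true i) + 0 *: stw ((c' * kap true i) *: rt true i)
      + 0 *: ((c * kap false i) *: rt false i))
    (br (a *: rt false i) ((c' * kap true i) *: rt true i)
      + br ((c * kap false i) *: rt false i) (stw (a' *: rt true i))) 0 k (0 * 0)
    - telt (ghs (tt (dpair u v))) (ghs (tt1 (dpair u v))) 0 0 0
  = telt (ghs ((a * a') *: th i - tt (dpair u v)))
      (ghs ((a * c' + c * a') *: th i - tt1 (dpair u v))) 0 k 0.
  have ghsB d (x : t) y : ghs (d *: x - y) = d *: ghs x - ghs y.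
    by rewrite ghs_lin -[- y]scaleN1r -[-1 *: y]addr0 ghs_lin ghs0 addr0 scaleN1r.
  rewrite -[X in _ - X]scale1r -scaleNr teltZ teltD; apply: telt_eq.
  - rewrite addr_scale0 ghsB scaleN1r; congr (_ - _).
    by rewrite brZZ rt_pair.
  - rewrite ghsB scaleN1r sZ; congr (_ - _).
    apply: pair_br_lin; first exact: rt_pair.
    rewrite [kap true i]/kap mulr1; congr (_ + _).
    by rewrite mulrACA k1 mulr1.
  - by rewrite mulr0 addr0.
  - by rewrite scaler0 addr0.
  - by rewrite !mulr0 addr0.
apply: (JsG_torus mr) => j; rewrite linearB linearZ /= eA ta_tcomb.
  by rewrite at_ subrr.
by rewrite et subrr.
Qed.

Lemma psi_neq i j (u : dmod D false i) (v : dmod D true j) : i != j ->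
  br (psir u) (psir v) = 0.
Proof.
move=> ij; rewrite /psir -(morph_br mJ) tak_brE -(morph0 mJ); apply: piJ_eq.
rewrite subr0; set k := B _ _; clearbody k.
move: (co u).1 ((co u).2 * kap false i) (co v).1 ((co v).2 * kap true j) => a c a' c'.
suff -> : br (a *: rt false i) (a' *: rt true j) + 0 *: stw (c' *: rt true j)
    + 0 *: (c *: rt false i) = 0.
  suff -> : br (a *: rt false i) (c' *: rt true j)
      + br (c *: rt false i) (stw (a' *: rt true j)) = 0.
    by rewrite mulr0; apply: (JsG_central mr).
  rewrite /stw !sprZ -scalerBr -/(stw _) stw_rt scalerA.
  by rewrite (pair_br_lin (rt_neq _ _ _ ij) erefl) scaler0.
by rewrite addr_scale0 brZZ rt_neq // scaler0.
Qed.

Lemma psi_exists : exists f : gtilde D -> Tb, [/\ lie_morph f,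
  forall x, f (gt_h x) = psih x & forall s i (v : dmod D s i), f (gt_root v) = psir v].
Proof.
apply: gtilde_lift.
- exact: psih_lin.
- exact: psih_spr.
- exact: psir_lin.
- exact: psir_spr.
- exact: psih_br.
- exact: psi_act.
- exact: psi_pair.
- exact: psi_neq.
Qed.

(** * Kernel of the homomorphism on g~ *)

Section Psi.
Variable psi : gtilde D -> Tb.
Hypothesis mpsi : lie_morph psi.
Hypothesis psi_h : forall x, psi (gt_h x) = psih x.
Hypothesis psi_r : forall s i (v : dmod D s i), psi (gt_root v) = psir v.
Local Notation gtD := (gt_sys D).

Lemma psir_es s i : psir (es s i) = piJ (telt (rt s i) 0 0 0 0).
Proof.
have := co_uniq s i 1 0; rewrite scale1r scale0r addr0 => e.
by rewrite /psir e mul0r scale1r scale0r.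
Qed.

Lemma psir_Es s i : psir (kap s i *: Es s i) = piJ (telt 0 (rt s i) 0 0 0).
Proof.
have := co_uniq s i 0 (kap s i); rewrite scale0r add0r => e.
by rewrite /psir e /= kapK scale1r scale0r.
Qed.

(** Heights and the sign s are preserved, and neither a toral nor a derivation component appears;
    each bracket adds only a c-term, which lies in J_s. *)
Lemma psi_npart s q x : npart gtD s q x -> exists y y',
  [/\ npart sys s q y, npart sys s q y' & psi x = piJ (telt y y' 0 0 0)].
Proof.
have nr i c : npart sys s 0 (c *: rt s i).
  by rewrite -(@grootE _ _ A _ ta th s i c); apply: np_gen.
have nbr i c r y : npart sys s r y -> npart sys s r.+1 (br (c *: rt s i) y).
  by move=> ny; rewrite -(@grootE _ _ A _ ta th s i c); apply: np_br.
elim=> {q x}.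
- move=> i v; exists ((co v).1 *: rt s i), (((co v).2 * kap s i) *: rt s i).
  by split; [exact: nr | exact: nr | exact: psi_r].
- move=> r i v x _ [y [y' [ny ny' E]]].
  move: (psi_r v); rewrite /psir; move: (co v).1 ((co v).2 * kap s i) => a c Ev.
  exists (br (a *: rt s i) y), (br (a *: rt s i) y' + br (c *: rt s i) (stw y)).
  have gN := npart_sub sys s r; have gN1 := npart_sub sys s r.+1.
  split; first exact: nbr.
    apply: (gsubD gN1); apply: nbr => //.
    by apply: (gsubD gN); [|apply: (gsubN gN)]; apply: (gsub_spr gN).
  rewrite (morph_br mpsi) E [psi _]Ev -(morph_br mJ) tak_brE; apply: piJ_eq.
  set k := B _ _; clearbody k.
  suff -> : telt (br (a *: rt s i) y + 0 *: stw y' + 0 *: (c *: rt s i))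
     (br (a *: rt s i) y' + br (c *: rt s i) (stw y)) 0 k (0 * 0)
     - telt (br (a *: rt s i) y) (br (a *: rt s i) y' + br (c *: rt s i) (stw y)) 0 0 0
     = telt 0 0 0 k 0 by exact: (JsG_central mr).
  rewrite -[X in _ - X]scale1r -scaleNr teltZ teltD; apply: telt_eq.
  - by rewrite addr_scale0 scaleN1r subrr.
  - by rewrite scaleN1r subrr.
  - by rewrite mulr0 addr0.
  - by rewrite scaler0 addr0.
  - by rewrite !mulr0 addr0.
- move=> q; exists 0, 0; split; try exact: np_zero.
  by rewrite (morph0 mpsi) -(morph0 mJ).
- move=> q c x z _ [y [y' [ny ny' E]]] _ [w [w' [nw nw' E']]].
  exists (c *: y + w), (c *: y' + w'); split; try exact: np_lin.
  rewrite (morph_lin mpsi) E E' -(morph_lin mJ) teltZ teltD; congr piJ; apply: telt_eq => //.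
  + by rewrite mulr0 addr0.
  + by rewrite scaler0 addr0.
  + by rewrite mulr0 addr0.
Qed.

(** An even element of h with root values 1 at [i] and 0 elsewhere projects, up to sign, onto the
    i-th simple root space. *)
Lemma root_component (U : set (gtilde D)) s (u : forall i, dmod D s i) :
  graded_subspace U -> (forall y x, U x -> U (br (gt_h y) x)) ->
  U (\sum_i gt_root (u i)) -> forall i, U (gt_root (u i)).
Proof.
move=> gU hU Ux i; have [a ha ai] := w_dual wD (fun j => (j == i)%:R).
have E j : br (gt_h a) (gt_root (u j)) = ((-1) ^+ s * (j == i)%:R) *: gt_root (u j).
  by rewrite gt_act (w_mod wD) // ai [LHS](cs_rootZ gtD).
have -> : gt_root (u i) = (-1) ^+ s *: br (gt_h a) (\sum_j gt_root (u j)).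
  rewrite br_sumr (bigD1 i) // big1 => [|j /negPf ji]; last by rewrite E ji mulr0 scale0r.
  by rewrite [X in _ *: X]addr0 E eqxx mulr1 scalerA -signr_addb addbb scale1r.
by apply: (gsubZ gU); apply: hU.
Qed.

(** From any nonzero vector of the root space, the odd elements of [fr_dual] produce first [Es s i]
    and then [es s i]. Bracketing with the opposite generator puts h_i into the ideal, although h_i
    is nonzero. *)
Lemma ideal_no_root (I : set (gtilde D)) s i (v : dmod D s i) : lie_ideal I ->
  (forall y, I (gt_h y) -> gt_h y = 0) -> I (gt_root v) -> v = 0.
Proof.
move=> idI I0 Iv; have [gI bI] := idI; apply: contrapT => /eqP v0.
have [a [b [ha hb [a1 a2] [b1 b2]]]] := fr_dual hf i; rewrite phE in a2; rewrite phE in b2.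
have act_in x (w : dmod D s i) : I (gt_root w) -> I (gt_root (act x w)).
  by move=> Iw; rewrite -gt_act; apply: bI.
have scale_in c (w : dmod D s i) : c != 0 -> I (gt_root (c *: w)) -> I (gt_root w).
  move=> c0 Iw; have := gsubZ gI c^-1 Iw.
  by rewrite [gt_root _](cs_rootZ gtD) scalerA mulVf // scale1r.
have IE : I (gt_root (Es s i)).
  have := coE v; set x := (co v).1; set y := (co v).2 => e.
  have [x0|x0] := eqVneq x 0.
    have y0 : y != 0 by apply: contraNneq v0 => y0; rewrite e x0 y0 !scale0r addr0.
    by apply: (scale_in y) => //; move: Iv; rewrite e x0 scale0r add0r.
  have := act_in b _ Iv; rewrite e actDr !actZr act_es act_Es (cd_alpha_odd hD _ hb) b1 b2.
  rewrite !mulr0 !scale0r addr0 scaler0 addr0 add0r scalerA mulr1; apply: scale_in.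
  by rewrite !mulf_neq0 ?kap_neq0 ?signr_eq0.
have Ie : I (gt_root (es s i)).
  have := act_in a _ IE; rewrite act_Es (cd_alpha_odd hD _ ha) a2.
  rewrite mulr0 scale0r add0r mulr1; apply: scale_in.
  by rewrite mulf_neq0 ?kap_neq0 ?signr_eq0.
have Ih : I (gt_h (gen_h g i)).
  rewrite /gen_h -gt_pair; case: s v v0 Iv act_in scale_in IE Ie => *; first exact: bI.
  exact: (ideal_br_l _ idI).
by have /eqP := h_neq0 i; apply; rewrite /gh I0.
Qed.

(** Induction on the height. Brackets with opposite simple root vectors remain in the ideal at
    smaller height and are sent to 0, so the coefficients of the image of [x] are singular in s. At
    height one the ideal contains nothing. *)
Lemma psi_ideal_npart (I : set (gtilde D)) : lie_ideal I ->
  (forall y, I (gt_h y) -> gt_h y = 0) ->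
  forall s q x, npart gtD s q x -> I x -> psi x = 0.
Proof.
move=> idI I0 s; have [gI bI] := idI; elim=> [|q IH] x nx Ix.
  have [u eu] := npart0P nx.
  have -> : x = 0; last exact: (morph0 mpsi).
  rewrite eu big1 // => i _.
  have /(ideal_no_root idI I0) -> : I (gt_root (u i)).
    by apply: (root_component gI) => [y z|]; [apply: bI | move: Ix; rewrite eu].
  exact: (cs_root0 gtD).
have [y [y' [ny ny' E]]] := psi_npart nx.
have ss : ~~ s != s by case: (s).
have K j : br (rt (~~ s) j) y = 0 /\ br (rt (~~ s) j) y' = 0.
  have nz : psi (br (gt_root (es (~~ s) j)) x) = 0.
    apply: IH; last exact: bI.
    exact: (npart_opp (cs := gtD) (es (~~ s) j) nx ss).
  move: nz; rewrite (morph_br mpsi) psi_r psir_es E -(morph_br mJ) tak_brE => /piJ_eq0.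
  have -> : telt (br (rt (~~ s) j) y + 0 *: stw y' + 0 *: 0)
     (br (rt (~~ s) j) y' + br 0 (stw y)) 0 (B 0 (stw y')) (0 * 0)
     = telt (br (rt (~~ s) j) y) (br (rt (~~ s) j) y') 0 0 0.
    apply: telt_eq => //.
    - by rewrite addr_scale0.
    - by rewrite br0l addr0.
    - by rewrite Defs.form0l.
    - by rewrite mulr0.
  apply: (JsG_npart0 mr (s := s) (p := q)).
    exact: (npart_opp (cs := sys) ((1 : F) : dmod Ds (~~ s) j) ny ss).
  exact: (npart_opp (cs := sys) ((1 : F) : dmod Ds (~~ s) j) ny' ss).
have Z z : npart sys s q.+1 z -> (forall j, br (rt (~~ s) j) z = 0) -> z = 0.
  move=> nz Kz; apply: (singular0 wDs (s := s)); exists q.+1 => // j w.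
  by rewrite grootE brZl Kz scaler0.
rewrite E (Z y ny (fun j => (K j).1)) (Z y' ny' (fun j => (K j).2)).
exact: (morph0 mJ).
Qed.

Lemma psi_gt_max x : Defs.gt_max x -> psi x = 0.
Proof.
move=> [I [idI I0 Ix]]; have [gI bI] := idI.
have [|c [s [us _ zc -> Ic]]] := zspan_components (cs := gtD) wD gI _ (zspan_all gtD x) Ix.
  by move=> y z; apply: bI.
rewrite (morph_sum mpsi) big_seq big1 // => k /Ic Ik; move: (zc k) Ik.
case: k => [[|q]|q]; last 2 first.
- exact: psi_ideal_npart.
- exact: psi_ideal_npart.
by case=> y _ <- /I0 /= ->; apply: (morph0 mpsi).
Qed.

Lemma psi_root_inj s i (v : dmod D s i) : psi (gt_root v) = 0 -> v = 0.
Proof.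
rewrite psi_r /psir => /piJ_eq0 /(JsG_rt mr (th_neq0 i))[e1 /eqP].
rewrite mulf_eq0 (negPf (kap_neq0 s i)) orbF => /eqP e2.
by rewrite (coE v) e1 e2 !scale0r addr0.
Qed.

Lemma psi_npart0 s x : npart gtD s 0 x -> psi x = 0 -> x = 0.
Proof.
move=> nx ex; have [u eu] := npart0P nx; have [gK bK] := kernel_ideal mpsi.
rewrite eu big1 // => i _.
have /psi_root_inj -> : psi (gt_root (u i)) = 0.
  by apply: (root_component gK) => [y z|]; [apply: bK | move: ex; rewrite eu].
exact: (cs_root0 gtD).
Qed.

Definition sgnp (s : bool) : pred int := fun k => if s then k < 0 else 0 < k.

Lemma zpart_sgn s k x : sgnp s k -> zpart gtD k x ->
  exists2 q, npart gtD s q x & k = if s then Negz q else Posz q.+1.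
Proof. by rewrite /sgnp; case: s; case: k => [[|q]|q] //= _ nx; exists q. Qed.

(** The kernel inside n_s could leave n_s only by an opposite root vector taking height one into h,
    but no nonzero element of height one is in the kernel. *)
Lemma psi_kernel_ideal s : lie_ideal [set x | psi x = 0 /\ zspan gtD (sgnp s) x].
Proof.
have gZ := zspan_sub gtD (sgnp s); have [gK bK] := kernel_ideal mpsi.
apply: (ideal_of_gens (cs := gtD)).
- split.
  + by split; [apply: (gsub0 gK) | apply: (gsub0 gZ)].
  + move=> c x y [? ?] [? ?]; split.
      by apply: (gsubD gK) => //; apply: (gsubZ gK).
    by apply: (gsubD gZ) => //; apply: (gsubZ gZ).
  + by move=> b x [? ?]; split; [apply: (gsub_spr gK) | apply: (gsub_spr gZ)].
- move=> y x [ex zx]; split; first exact: bK.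
  by apply: zspan_br zx => k z Kk zz; apply: (zspan_in (k := k)) => //; apply: zpart_h.
move=> s' i v x [ex zx]; split; first exact: bK.
have [|c [l [ul Kl zc -> Kc]]] := zspan_components (cs := gtD) wD gK _ zx ex.
  by move=> y z; apply: bK.
rewrite br_sumr big_seq; apply: (gsub_sum gZ) => k kl.
have Kk := allP Kl k kl; have ck := Kc k kl.
have [q nq kq] := zpart_sgn Kk (zc k).
have [e|e] := eqVneq s' s.
  subst s'; apply: (zspan_in _ (zpart_root v (zc k))).
  move: Kk; rewrite /sgnp; case: (s) => Kk.
    by apply: lt_trans Kk; rewrite ltrBlDr ltrDl.
  by apply: lt_trans Kk _; rewrite ltrDl.
case: q nq kq => [|q] nq kq.
  by rewrite (psi_npart0 nq ck) br0r; apply: (gsub0 gZ).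
have := npart_opp v nq e => /= nq'.
by apply: (zspan_in (k := if s then Negz q else Posz q.+1)); case: (s) nq'.
Qed.

Lemma psi_kernel_npart s q x : npart gtD s q x -> psi x = 0 -> Defs.gt_max x.
Proof.
move=> nx ex; exists [set x | psi x = 0 /\ zspan gtD (sgnp s) x]; split.
- exact: psi_kernel_ideal.
- move=> y [_ zy]; apply: (zspan_gt_h wD); move: zy; apply: (zspan_lin_ind (zspan_sub _ _)).
  move=> k z Kk zz; apply: (zspan_in (k := k)) => //; move: Kk; rewrite /sgnp /= neq_lt.
  by case: (s) => ->; rewrite ?orbT.
split=> //; apply: (zspan_in (k := if s then Negz q else Posz q.+1)).
  by rewrite /sgnp; case: (s).
by case: (s) nx.
Qed.

(** Testing against root vectors tensored with 1 and xi recovers [dalpha D i y], [eta i y] and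
    [ph y], which together determine the action on every g_{alpha_i}. *)
Lemma psih_eq0 y : psih y = 0 <-> forall i (v : dmod D false i), act y v = 0.
Proof.
split=> [/piJ_eq0 J i v|H].
  have [J1 J2] := J false i.
  have r0 : rt false i != 0.
    by apply: contraNneq (th_neq0 i) => r0; rewrite -rt_pair r0 br0l.
  have H c : c *: rt false i = 0 -> c = 0.
    by move/eqP; rewrite scaler_eq0 (negPf r0) orbF => /eqP.
  have : br (ghs (tt y)) (rt false i) + ph y *: stw 0 + 0 *: ghs (tt1 y) = 0
    := congr1 (fun u => u.1.1.1.1) J1.
  rewrite stw0 scaler0 scale0r !addr0 gh_rt ta_tcomb mul1r => /H ay.
  have : br (ghs (tt y)) 0 + br (ghs (tt1 y)) (stw (rt false i)) = 0
    := congr1 (fun u => u.1.1.1.2) J1.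
  rewrite br0r add0r stw_rt brZr gh_rt ta_tcomb mul1r scalerA => /H /eqP.
  rewrite mulf_eq0 signr_eq0 => /eqP ey.
  have : br (ghs (tt y)) 0 + ph y *: stw (rt false i) + 0 *: ghs (tt1 y) = 0
    := congr1 (fun u => u.1.1.1.1) J2.
  rewrite br0r add0r scale0r addr0 stw_rt scalerA => /H /eqP.
  rewrite mulf_eq0 signr_eq0 orbF => /eqP py.
  have [a [b ->]] := fr_span hf v; rewrite actDr !actZr (fr_ae hf) (fr_aE hf) phE ay ey py.
  by rewrite !scale0r !addr0 !scaler0 addr0.
have z i : dalpha D i y = 0 /\ eta i y = 0.
  apply: (homog_indep (fr_he hf i) (fr_hE hf i) (fr_e0 hf i) (fr_E0 hf i)).
  by rewrite -(fr_ae hf) H !scale0r addr0.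
(* Without simple roots nothing constrains [ph y], but then the annihilation conditions are empty
   and J_s is the whole of T s. *)
have py : n = 0%N \/ ph y = 0.
  have [n0|n0] := posnP n; [by left | right].
  pose i := Ordinal n0; have := H i (gen_E g i); rewrite (fr_aE hf) (z i).1 scale0r add0r phE.
  by move/eqP; rewrite scaler_eq0 (negPf (fr_e0 hf i)) orbF => /eqP.
rewrite /psih [tt y]tcomb0 ?[tt1 y]tcomb0 ?ghs0; try by move=> i; case: (z i).
case: py => [n0|->]; last exact: (morph0 mJ).
by rewrite -(morph0 mJ); apply: piJ_eq => s i; have := ltn_ord i; rewrite [X in (_ < X)%N]n0.
Qed.

Lemma psi_kernel x : psi x = 0 -> lie_pi (JA D) (lie_pi (@Defs.gt_max F n D) x) = 0.
Proof.
have [gK bK] := kernel_ideal mpsi => ex.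
have [|c [l [ul _ zc -> Kc]]] := zspan_components (cs := gtD) wD gK _ (zspan_all gtD x) ex.
  by move=> y z; apply: bK.
have m1 := lie_pi_morph (@Defs.gt_max F n D); have m2 := lie_pi_morph (JA D).
rewrite (morph_sum m1) (morph_sum m2) big_seq big1 // => k /Kc ck; move: (zc k) ck.
have N s q z : npart gtD s q z -> psi z = 0 ->
    lie_pi (JA D) (lie_pi (@Defs.gt_max F n D) z) = 0.
  by move=> nz ez; have /(galg_pi_eq0 wD) -> := psi_kernel_npart nz ez; exact: (morph0 m2).
case: k => [[|q]|q]; [|exact: N|exact: N].
case=> y _ <- /= ey; apply/lie_pi_eq0; apply: ideal_gen_sub; exists y => //=.
by apply/psih_eq0; rewrite -psi_h.
Qed.
End Psi.

(** An element killing all g_{alpha_i} has vanishing root values, [eta] and [phi], and so also kills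
    each g_{-alpha_i}, whose action has the same entries up to sign. Its brackets with root vectors
    are therefore zero. *)
Lemma JA_ideal : lie_ideal (JA D).
Proof.
have spr0 b x : (forall i (v : dmod D false i), act x v = 0) ->
    forall i (v : dmod D false i), act (spr b x) v = 0.
  move=> H i v; have E a : act (spr b x) (spr a v) = 0.
    have := congr1 (spr (a (+) b)) (H i (spr a v)); rewrite Defs.spr0 spr_act !spr_spr.
    by case: a; case: b => /=; rewrite ?act0r ?addr0 ?add0r.
  by rewrite -[v]spr_sum actDr !E addr0.
apply: (ideal_of_gens (cs := galg_sys D)).
- split.
  + by exists 0; [move=> i v; apply: act0l | apply: (cs_h0 (galg_sys D))].
  + move=> c _ _ [x Hx <-] [y Hy <-]; exists (c *: x + y); last exact: (cs_h_lin (galg_sys D)).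
    by move=> i v; rewrite act_linl Hx Hy scaler0 addr0.
  + move=> b _ [x Hx <-]; exists (spr b x); last exact: (cs_h_spr (galg_sys D)).
    exact: spr0.
- move=> y _ [x Hx <-]; exists (br y x); last by rewrite [RHS](cs_h_br (galg_sys D)).
  move=> i v; have E a b : act (br (spr a y) (spr b x)) v = 0.
    by rewrite (act_br _ (homog_spr a y) (homog_spr b x)) !(spr0 _ _ Hx) act0r scaler0 subrr.
  by rewrite -[y]spr_sum -[x]spr_sum !(brDl, brDr) !actDl !E !addr0.
- move=> s i v _ [x Hx <-].
  have Z b (w : dmod D s i) : act (spr b x) w = 0.
    have Hb := spr0 b x Hx; case: s w v => w _; last exact: Hb.
    have z j : dalpha D j (spr b x) = 0 /\ eta j (spr b x) = 0.
      apply: (homog_indep (fr_he hf j) (fr_hE hf j) (fr_e0 hf j) (fr_E0 hf j)).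
      by rewrite -(fr_ae hf) Hb !scale0r addr0.
    have py : ph (spr b x) = 0.
      have := Hb i (gen_E g i); rewrite (fr_aE hf) (z i).1 scale0r add0r phE.
      by move/eqP; rewrite scaler_eq0 (negPf (fr_e0 hf i)) orbF => /eqP.
    have [a [c ->]] := fr_spanN hf w; rewrite actDr !actZr (fr_af hf) (fr_aF hf) phE py.
    by rewrite (z i).1 (z i).2 oppr0 !mulr0 !scale0r subr0 addr0 !scaler0 addr0.
  have -> : br (cs_root (galg_sys D) v) (gh x) = 0; last first.
    by exists 0; [move=> j w; apply: act0l | apply: (cs_h0 (galg_sys D))].
  apply: (br_swap_in (U := [set 0]) (proj1 (zero_ideal _))) => a b.
  rewrite -(cs_h_spr (galg_sys D)) -(cs_root_spr (galg_sys D)) (cs_act (galg_sys D)) Z.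
  exact: (cs_root0 (galg_sys D)).
Qed.

(** Injectivity is the computation of the kernel. For surjectivity on a weight space it suffices to
    find preimages in n_- (x) C[xi] and n_+ (x) C[xi]. *)
Lemma embedding : exists phi : lie_quot (JA D) -> Tb,
  [/\ lie_morph phi, injective phi
    & forall k : 'I_n -> int, (exists i, k i != 0) ->
      phi @` weight_space (fun x : dh D => lie_pi (JA D) (gh x)) k
      = weight_space (fun x : dh Ds => piJ (tak_tensor ob (ghs x) 0)) k].
Proof.
have [psi [mpsi psi_h psi_r]] := psi_exists.
have [f1 m1 e1] := lie_quot_lift mpsi (psi_gt_max mpsi psi_r).
have [|f m e] := @lie_quot_lift _ _ (JA D) _ f1 m1.
  by move=> _ [x Hx <-]; rewrite e1 psi_h; apply/psih_eq0.
have fE x : f (lie_pi (JA D) (lie_pi (@Defs.gt_max F n D) x)) = psi x by rewrite e e1.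
have surj (a : lie_quot (JA D)) : exists x, a = lie_pi (JA D) (lie_pi (@Defs.gt_max F n D) x).
  by have [b ->] := lie_pi_surj a; have [x ->] := lie_pi_surj b; exists x.
have finj : injective f.
  move=> a b ab; apply/eqP; rewrite -subr_eq0; apply/eqP.
  have : f (a - b) = 0 by rewrite (morphB m) ab subrr.
  by have [x ->] := surj (a - b); rewrite fE => /(psi_kernel mpsi psi_h psi_r).
(* The two tori are matched through root values, so that weights can be transported in both
   directions. *)
have ftor (y : dh D) (x : t) : homog false y -> (forall i, dalpha D i y = ta i x) ->
    f (lie_pi (JA D) (gh y)) = piJ (tak_tensor ob (ghs x) 0).
  move=> hy yx; rewrite fE psi_h; apply: piJ_eq.
  have -> : telt (ghs (tt y)) (ghs (tt1 y)) (ph y) 0 0 - tak_tensor ob (ghs x) 0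
      = telt (ghs (1 *: tt y - x)) (ghs 0) 0 0 0.
    rewrite -[X in _ - X]scale1r -scaleNr teltZ teltD; apply: telt_eq.
    - by rewrite ghs_lin -[- x]scaleN1r -[-1 *: x]addr0 ghs_lin ghs0 addr0 scale1r.
    - rewrite scaler0 addr0; congr (ghs _).
      by apply: tcomb0 => i; apply: (fr_eta_even hf).
    - by rewrite mulr0 addr0; apply: ph_even.
    - by rewrite scaler0 addr0.
    - by rewrite mulr0 addr0.
  apply: (JsG_torus mr) => j; last by rewrite linear0.
  by rewrite scale1r linearB /= ta_tcomb yx subrr.
exists f; split=> // k k0; rewrite eqEsubset; split.
  move=> _ [v wv <-] x _.
  have [y hy yx] := w_dual wD (fun i => ta i x).
  rewrite -(ftor y x hy yx) -(morph_br m) (wv y hy) (morphZ m).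
  by congr (_ *: _); apply: eq_bigr => i _; rewrite yx.
move=> w ww.
(* Any preimage has the right weight, by injectivity of [f] and the comparison of tori. *)
suff [v ev] : exists v, w = f v.
  exists v => // y hy; apply: finj; rewrite (morph_br m) (morphZ m) -ev.
  have al j : dalpha D j y = ta j (tt y) by rewrite ta_tcomb.
  apply: etrans (congr1 ((@br _ _)^~ w) (ftor y (tt y) hy al)) _.
  apply: etrans (ww (tt y) (erefl _)) _.
  by congr (_ *: _); apply: eq_bigr => i _; rewrite al.
have gR : graded_subspace (range f).
  split.
  - by exists 0 => //; apply: (morph0 m).
  - by move=> c _ _ [a _ <-] [b _ <-]; exists (c *: a + b) => //; apply: (morph_lin m).
  - by move=> b _ [a _ <-]; exists (spr b a) => //; apply: (morph_spr m).
have [x0 e0] := weight_elt mr k0.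
suff [v _ ev] : range f w by exists v.
(* Writing [w] as a bracket with a toral element on which the weight is 1 removes the toral,
   derivation and central components of its representative. *)
have <- : br (piJ (tak_tensor ob (ghs x0) 0)) w = w by rewrite ww // e0 scale1r.
have [u ->] := lie_pi_surj w; case: u => [[[[x y] d] c] z].
(* Requiring both z (x) 1 and z (x) xi makes [U] stable under the simple root vectors tensored with
   1, and its simple root vectors are images of the e_i, f_i and of multiples of the E_i, F_i. *)
pose U := [set z : gs | range f (piJ (telt z 0 0 0 0)) /\ range f (piJ (telt 0 z 0 0 0))].
have gU : graded_subspace U.
  split.
  - by split; rewrite [piJ _](morph0 mJ); apply: (gsub0 gR).
  - move=> a v v' [r1 r2] [r1' r2']; split.
      have -> : telt (a *: v + v') 0 0 0 0 = a *: telt v 0 0 0 0 + telt v' 0 0 0 0.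
        by rewrite teltZ teltD; apply: telt_eq; rewrite ?(scaler0, mulr0, addr0).
      by rewrite (morph_lin mJ); apply: (gsubD gR) => //; apply: (gsubZ gR).
    have -> : telt 0 (a *: v + v') 0 0 0 = a *: telt 0 v 0 0 0 + telt 0 v' 0 0 0.
      by rewrite teltZ teltD; apply: telt_eq; rewrite ?(scaler0, mulr0, addr0).
    by rewrite (morph_lin mJ); apply: (gsubD gR) => //; apply: (gsubZ gR).
  - move=> b v [r1 r2]; split.
      have -> : telt (spr b v) 0 0 0 0 = spr b (telt v 0 0 0 0).
        by rewrite spr_telt; apply: telt_eq; rewrite ?spr0 //; case: (b).
      by rewrite (morph_spr mJ); apply: (gsub_spr gR).
    have -> : telt 0 (spr b v) 0 0 0 = spr (~~ b) (telt 0 v 0 0 0).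
      by rewrite spr_telt negbK; apply: telt_eq; rewrite ?spr0 //; case: (b).
    by rewrite (morph_spr mJ); apply: (gsub_spr gR).
have rb a b : range f a -> range f b -> range f (br a b).
  by move=> [a' _ <-] [b' _ <-]; exists (br a' b') => //; apply: (morph_br m).
have rr s i (v : dmod D s i) : range f (psir v).
  by exists (lie_pi (JA D) (lie_pi (@Defs.gt_max F n D) (gt_root v))) => //; rewrite fE.
have Un s q v : npart sys s q v -> U v.
  apply: (npart_rt_ind gU) => [i|i v' [r1 r2]].
    by split; [rewrite -psir_es | rewrite -psir_Es].
  split.
    have -> : telt (br (rt s i) v') 0 0 0 0 = br (telt (rt s i) 0 0 0 0) (telt v' 0 0 0 0).
      rewrite tak_brE stw0; apply: telt_eq => //.
      - by rewrite addr_scale0.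
      - by rewrite br0r br0l addr0.
      - by rewrite Defs.form0l.
      - by rewrite mulr0.
    by rewrite (morph_br mJ) -psir_es; apply: rb.
  have -> : telt 0 (br (rt s i) v') 0 0 0 = br (telt (rt s i) 0 0 0 0) (telt 0 v' 0 0 0).
    rewrite tak_brE stw0; apply: telt_eq => //.
    - by rewrite addr_scale0 br0r.
    - by rewrite br0l addr0.
    - by rewrite Defs.form0l.
    - by rewrite mulr0.
  by rewrite (morph_br mJ) -psir_es; apply: rb.
rewrite -(morph_br mJ) -/(telt x y d c z) tak_brE.
have -> : telt (br (ghs x0) x + 0 *: stw y + d *: 0) (br (ghs x0) y + br 0 (stw x)) 0
    (B 0 (stw y)) (0 * d)
  = telt (br (ghs x0) x) 0 0 0 0 + telt 0 (br (ghs x0) y) 0 0 0.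
  rewrite teltD; apply: telt_eq.
  - by rewrite scale0r scaler0 !addr0.
  - by rewrite br0l addr0 add0r.
  - by rewrite addr0.
  - by rewrite Defs.form0l addr0.
  - by rewrite mul0r addr0.
rewrite (morphD mJ); apply: (gsubD gR).
  exact: (torus_bracket_in x0 gU Un x).1.
exact: (torus_bracket_in x0 gU Un y).2.
Qed.
End Embedding.

(** * Rescaled generators and the conclusion *)

Section Rescaling.
Variables (F : numClosedFieldType) (n : nat) (D : datum F n) (g : generators D).
Variable r : 'I_n -> F.
Hypothesis r0 : forall i, r i != 0.

Lemma std_rescale : std_generators g -> std_generators (rescale r g).
Proof.
move=> hg i; have [ty [theta [rt vi [he hE e0 E0] [ef eF] nrm]]] := hg i.
exists ty, theta; split=> //=.
  by split=> //; [apply: homogZ | rewrite scaler_eq0 negb_or r0].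
split=> //; rewrite eF; have [thl _ _ _] := vi.
have th0 : theta 0 = 0 by have := thl (-1) 0 0; rewrite scaler0 addr0 scaleN1r addNr.
by rewrite -[r i *: gen_E g i]addr0 thl th0 addr0 !scalerA mulrC.
Qed.

Lemma Y_rescale : cartan_datum D -> Y_matrix g 0 -> Y_matrix (rescale r g) 0.
Proof.
move=> hD hY i j; have := hY i j; rewrite !mxE !scale0r /gen_H /= => e.
by rewrite (pairZl hD) actZl actZr e !scaler0.
Qed.
End Rescaling.

Theorem theorem1p3 (R : realType) (n : nat) (D : datum R[i] n)
    (g : generators D)
    (hD : cartan_datum D) (hQKM : qkm D) (hind : indecomposable D)
    (hg : std_generators g) (hY : Y_matrix g 0) :
  (exists r : 'I_n -> R[i],
     (forall i, r i != 0) /\ X_matrix (rescale r g) (cartan_mx g))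
  /\
  (forall (t : vectType R[i]) (ta : 'I_n -> {scalar t}) (th : 'I_n -> t),
     min_realization (cartan_mx g) ta th ->
     let Ds := km_datum (cartan_mx g) ta th in
     forall ob : option (inv_form (galg Ds) R[i]^o),
     takiff_choice (cartan_mx g) ob ->
     [/\ lie_ideal (JA D), lie_ideal (Js ob)
       & exists phi : lie_quot (JA D) -> lie_quot (Js ob),
         [/\ lie_morph phi, injective phi
           & forall k : 'I_n -> int, (exists i, k i != 0) ->
             phi @` weight_space (fun x : dh D => lie_pi (JA D) (gh x)) k
             = weight_space
                 (fun x : dh Ds => lie_pi (Js ob) (tak_tensor ob (gh x) 0)) k]]).
Proof.
have [p [eta [phi hf]]] := frame_exists hD hQKM hg.
have [r [ph [r0 rph]]] := common_phi hD hf hY hQKM hind.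
have hX := coupled_X_matrix hD hf hY hQKM r0 rph.
split; first by exists r.
move=> t ta th mr Ds ob _.
have hg' := std_rescale r0 hg; have hY' := Y_rescale r hD hY.
have [p' [eta' [phi' hf']]] := frame_exists hD hQKM hg'.
have phi'E i x : phi' i x = ph x.
  rewrite -(rph i); have := fr_aE hf' i x; rewrite /= actZr (fr_aE hf) scalerDr !scalerA.
  rewrite [r i * dalpha D i x]mulrC => /addrI /eqP; rewrite -subr_eq0 -scalerBl scaler_eq0.
  by rewrite (negPf (fr_e0 hf i)) orbF subr_eq0 => /eqP ->.
(* All [phi' i] agree, so any index may be picked; the default 0 covers the case without simple
   roots and keeps the functional linear. *)
pose ph' x := if [pick i : 'I_n] is Some i then phi' i x else 0.
have phE i x : phi' i x = ph' x.
  by rewrite /ph'; case: pickP => [j _|/(_ i)//]; rewrite !phi'E.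
have ph_lin c x y : ph' (c *: x + y) = c * ph' x + ph' y.
  rewrite /ph'; case: pickP => [j _|_]; last by rewrite mulr0 addr0.
  exact: (fr_phi_lin hf').
have ph_even x : homog false x -> ph' x = 0.
  by rewrite /ph'; case: pickP => [j _ hx|_ _] //; apply: (fr_phi_even hf').
have ph_H i : ph' (gen_H (rescale r g) i) = 0.
  by rewrite -(phE i); apply: (phi_gen_H hD hf' hY').
have eta_H i j : eta' j (gen_H (rescale r g) i) = cartan_mx (rescale r g) i j.
  have := hX i j; rewrite (fr_ae hf') (cd_alpha_odd hD _ (gen_H_odd hD hf' i)) scale0r add0r.
  move=> /eqP; rewrite -subr_eq0 -scalerBl scaler_eq0 (negPf (fr_E0 hf' j)) orbF subr_eq0.
  by move=> /eqP.
have al_c := alpha_gen_c hD hf' hY' hQKM.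
have wD := weighted_cartan hD.
have h_neq0 i := (std_gen_h hD wD hf' i hg').1.
have hp i := (std_gen_h hD wD hf' i hg').2.
split; first exact: (JA_ideal hf' phE).
  by rewrite (JsE mr); apply: JsG_ideal.
exact: (@embedding _ _ _ _ _ _ _ _ hD hf' phE ph_lin ph_even ph_H eta_H al_c h_neq0 hp _ _ _ mr).
Qed.
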